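(* Let $d\geq 2$ and $1\leq q_1<\dots<q_d$ be integers. Let $(X_{ij})_{i,j\in\mathbb{N}}$ be i.i.d. random variables with $P(X_{ij}=\pm1)=\frac12$, and let $X_n:=\big(X_{ij}/\sqrt n\big)_{1\le i,j\le n}$. Define the random vector $$\mathbf{F}_n=\big(\mathrm{trace}(X_n^{q_1})-\mathbb{E}[\mathrm{trace}(X_n^{q_1})],\dots,\mathrm{trace}(X_n^{q_d})-\mathbb{E}[\mathrm{trace}(X_n^{q_d})]\big)$$ and let $\mathbf{N}$ be a centred Gaussian random vector with covariance matrix $\Sigma=(\sigma_{ij})_{i,j=1}^d$ such that $\sigma_{ii}=q_i$ for $1\leq i\leq d$ and $\sigma_{ij}=0$ for $1\leq i\neq j\leq d$. Then, for all $n\in\mathbb{N}$, $$d_4(\mathbf{F}_n,\mathbf{N})\leq C\, n^{-1/4}$$ for a constant $0<C<\infty$ depending only on $q_1,q_2,\dots,q_d$ and $d$.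
   Context: $\mathrm{trace}(X_n^q)=n^{-q/2}\sum_{i_1,\dots,i_q=1}^nX_{i_1i_2}X_{i_2i_3}\cdots X_{i_qi_1}$ is the trace of the $q$th power of the (non-symmetric) Bernoulli matrix $X_n$. For $h:\mathbb{R}^d\to\mathbb{R}$ put $M_k(h)=\max_{1\le i_1,\dots,i_k\le d}\sup_{x\in\mathbb{R}^d}|\frac{\partial^k}{\partial x_{i_1}\cdots\partial x_{i_k}}h(x)|$. Then $d_4(\mathbf{Z},\mathbf{N})=\sup_g|\mathbb{E}g(\mathbf{Z})-\mathbb{E}g(\mathbf{N})|$, the supremum running over all $g:\mathbb{R}^d\to\mathbb{R}$ having continuous partial derivatives up to order $4$ and satisfying $M_i(g)\le1$ for $i\in\{1,2,3,4\}$. *)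

(* Defs.v *)
From HB Require Import structures.
From mathcomp Require Import all_boot all_order all_algebra.
From mathcomp Require Import all_classical all_reals all_analysis.
Import Order.TTheory GRing.Theory Num.Theory.
Import numFieldNormedType.Exports.

Set Implicit Arguments.
Unset Strict Implicit.
Unset Printing Implicit Defensive.

Local Open Scope classical_set_scope.
Local Open Scope ring_scope.

Section SmoothTestFunctions.
Context {R : realType} {d : nat}.
Implicit Types (g : 'rV[R]_d -> R) (s : seq 'I_d).

Definition partials s g : 'rV[R]_d -> R :=
  foldr (fun i (f : 'rV[R]_d -> R) x => 'D_(delta_mx 0 i) f x) g s.

(* 'D_v is a total operator, so the existence of each partial derivative of
   order at most n is required separately. *)
Definition continuous_partials_upto (n : nat) g : Prop :=
  (forall s i x, (size s < n)%N -> derivable (partials s g) x (delta_mx 0 i))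
  /\ (forall s, (size s <= n)%N -> continuous (partials s g)).

Definition max_partial (k : nat) g : \bar R :=
  \big[maxe/0%E]_(s : k.-tuple 'I_d)
    ereal_sup [set `|partials s g x|%:E | x in [set: 'rV[R]_d]].

Definition d4_test g : Prop :=
  continuous_partials_upto 4 g /\
  (forall k, (1 <= k <= 4)%N -> (max_partial k g <= 1)%E).

End SmoothTestFunctions.

(* The two random vectors may live on different probability spaces. *)
Definition d4 {R : realType} {d : nat} d1 d2
    {T1 : measurableType d1} {T2 : measurableType d2}
    (P : probability T1 R) (Z : T1 -> 'rV[R]_d)
    (Q : probability T2 R) (N : T2 -> 'rV[R]_d) : \bar R :=
  ereal_sup [set `| 'E_P[g \o Z] - 'E_Q[g \o N] |%E
            | g in [set g : 'rV[R]_d -> R | d4_test g]].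

Section RandomVectors.
Context {R : realType} {dT : measure_display} {T : measurableType dT}.
Variable P : probability T R.

Definition mutually_independent (I : eqType) (X : I -> {RV P >-> R}) : Prop :=
  forall (s : seq I) (B : I -> set R), uniq s -> (forall i, measurable (B i)) ->
    P (\bigcap_(i in [set` s]) (X i @^-1` B i)) =
    (\prod_(i <- s) P (X i @^-1` B i))%E.

Definition random_vector d (X : 'I_d -> {RV P >-> R}) : T -> 'rV[R]_d :=
  fun w => \row_i X i w.

Definition standard_gaussian_vector l (G : 'I_l -> {RV P >-> R}) : Prop :=
  mutually_independent G /\
  (forall i (B : set R), measurable B ->
     distribution P (G i) B = normal_prob 0 1 B).

End RandomVectors.

(* A Gaussian vector is a random vector with the law of an affine image of a
   standard Gaussian vector, degenerate covariances being allowed.  Laws are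
   compared on the Borel sets of R^d. *)
Definition gaussian_vector (R : realType) dT (T : measurableType dT)
    (P : probability T R) d (N : 'I_d -> {RV P >-> R}) : Prop :=
  exists (l : nat) (d' : measure_display) (T' : measurableType d')
         (P' : probability T' R) (G : 'I_l -> {RV P' >-> R})
         (m : 'rV[R]_d) (A : 'M[R]_(l, d)),
    standard_gaussian_vector G /\
    (forall B : set 'rV[R]_d, <<s open >> B ->
       P (random_vector N @^-1` B) =
       P' ((fun w => m + random_vector G w *m A) @^-1` B)).

Definition centered_gaussian_vector (R : realType) dT (T : measurableType dT)
    (P : probability T R) d (N : 'I_d -> {RV P >-> R}) (Sigma : 'M[R]_d) : Prop :=
  [/\ gaussian_vector N,
      (forall i, 'E_P[N i] = 0)%E &
      (forall i j, covariance P (N i) (N j) = (Sigma i j)%:E)].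

Section BernoulliMatrix.
Context {R : realType} {dT : measure_display} {T : measurableType dT}.
Variable P : probability T R.

Definition iid_rademacher (X : nat -> nat -> {RV P >-> R}) : Prop :=
  mutually_independent (fun ij : nat * nat => X ij.1 ij.2) /\
  (forall i j, P (X i j @^-1` [set 1]) = (2^-1)%:E /\
               P (X i j @^-1` [set -1]) = (2^-1)%:E).

Variable X : nat -> nat -> {RV P >-> R}.

(* Rows and columns are numbered from 0. *)
Definition bernoulli_mx (n : nat) (w : T) : 'M[R]_n :=
  \matrix_(i < n, j < n) (X i j w / Num.sqrt n%:R).

Definition trace_pow (n q : nat) (w : T) : R := \tr (bernoulli_mx n w ^+ q).

Definition centered_traces d (q : 'I_d -> nat) (n : nat) (w : T) : 'rV[R]_d :=
  \row_i (trace_pow n (q i) w - fine 'E_P[trace_pow n (q i)]%E).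

End BernoulliMatrix.

(* Main.v *)
(** Let [F] be the vector of centred traces, [M = X / sqrt n] and [rho = 1 / sqrt n].
    Differentiating [E g(sin t F + cos t N)] in [t], Gaussian integration by
    parts cancels the term coming from [N], so that
    [|E g(F) - E g(N)|] is controlled by the Stein discrepancies
    [E (F_i f(F)) - q_i E (d_i f(F))] of functions [f] with two bounded
    derivatives.  These are estimated by integration by parts on the sign cube:
    for a single sign [X_xy] and any [h], [E (X_xy h) = E (X_xy (h - h') / 2)],
    where [h'] is [h] with that sign flipped.  Writing a trace as
    [rho * sum_xy X_xy (M^Q)_yx], the flip acts on [(M^Q)_yx] and on [f(F)];
    up to errors of order [rho], the result is a combination of the overlaps
    [rho^2 tr (M^a (M^b)^T)].  The same integration by parts gives a recursion
    showing that such an overlap is within [O(rho)] of [1] (if [a = b]) or [0]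
    (otherwise) in mean square, and Cauchy-Schwarz turns this into the
    final rate [sqrt rho = n^(-1/4)].  The error terms are estimated by the moment
    bound [E |(M^a)_xy|^(2p) = O(rho^(2p))]: flipping all the signs of the column of
    a vertex shows that only walks visiting it an even number of times contribute. *)
Require Import Defs.
From HB Require Import structures.
From mathcomp Require Import all_boot all_order all_algebra.
From mathcomp Require Import ring lra zify.
From mathcomp Require Import all_classical all_reals all_analysis.
From mathcomp Require Import measurable_realfun.
Import Order.TTheory GRing.Theory Num.Theory.
Import numFieldNormedType.Exports.

Set Implicit Arguments.
Unset Strict Implicit.
Unset Printing Implicit Defensive.

Local Open Scope ring_scope.

(** * Averages over a finite type and moment bounds *)

(** Everything is done with exact finite sums. The trace vector is a function on the finite cube of
    signs, and the standard Gaussians behind [N] are replaced by independent variables on a grid of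
    mesh [1/m]; the path is then a finite sum, differentiated term by term, and the grid error
    vanishes as [m] grows with [n] fixed. A flip is not a derivation: its product rule has a
    second-order term and leaves flipped factors. Each such correction carries an additional factor
    [rho], so moment bounds absorb it. These bounds must be uniform in the exponent, though [M^0]
    has diagonal entries of size [1]; hence the scale [eta], whose row sums are still of the order
    of those of [rho]. In the discrepancy of [F_i] with [q_i = Q + 1], the derivative of [(M^Q)_yx]
    yields overlaps concentrating on a deterministic number, which the centring of the trace
    removes. The derivative of [f(F)] yields [q_j] times the overlap of [M^Q] with [M^(q_j - 1)],
    and injectivity of [q] leaves only [j = i]: this is the variance. All other remainders are
    [O(rho)]; only the fluctuation of the overlaps, known in mean square, costs a square root. *)

Section Mean.
Context {R : rcfType} {T : finType}.
Implicit Types (f g h : T -> R) (c : R).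

Definition mean f : R := (\sum_w f w) / #|T|%:R.

Lemma eq_mean f g : f =1 g -> mean f = mean g.
Proof. by move=> fg; rewrite /mean (eq_bigr g). Qed.

Lemma meanD f g : mean (fun w => f w + g w) = mean f + mean g.
Proof. by rewrite /mean big_split mulrDl. Qed.

Lemma meanZ c f : mean (fun w => c * f w) = c * mean f.
Proof. by rewrite /mean -mulr_sumr mulrA. Qed.

Lemma meanZr c f : mean (fun w => f w * c) = mean f * c.
Proof. by rewrite mulrC -meanZ; apply: eq_mean => w; rewrite mulrC. Qed.

Lemma meanN f : mean (fun w => - f w) = - mean f.
Proof. by rewrite -mulN1r -meanZ; apply: eq_mean => w; rewrite mulN1r. Qed.

Lemma meanB f g : mean (fun w => f w - g w) = mean f - mean g.
Proof. by rewrite meanD meanN. Qed.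

Lemma mean_sum (I : Type) (r : seq I) (P : pred I) (F : I -> T -> R) :
  mean (fun w => \sum_(i <- r | P i) F i w) = \sum_(i <- r | P i) mean (F i).
Proof. by rewrite /mean exchange_big /= mulr_suml. Qed.

Lemma mean_ge0 f : (forall w, 0 <= f w) -> 0 <= mean f.
Proof. by move=> f0; rewrite divr_ge0 ?sumr_ge0. Qed.

Lemma ler_mean f g : (forall w, f w <= g w) -> mean f <= mean g.
Proof.
move=> fg; rewrite -subr_ge0 -meanB mean_ge0 // => w.
by rewrite subr_ge0.
Qed.

Lemma ler_norm_mean f : `|mean f| <= mean (fun w => `|f w|).
Proof.
rewrite /mean normrM [`|_^-1|]ger0_norm ?invr_ge0 // ler_wpM2r ?invr_ge0 //.
exact: ler_norm_sum.
Qed.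

Lemma mean_inj f (s : T -> T) : injective s -> mean (f \o s) = mean f.
Proof. by move=> si; rewrite /mean [in RHS](reindex_inj si). Qed.

Hypothesis T_gt0 : (0 < #|T|)%N.

Lemma mean_cst c : mean (fun=> c) = c.
Proof.
by rewrite /mean sumr_const -[c *+ _]mulr_natr mulfK // pnatr_eq0 -lt0n.
Qed.

Lemma mean_cauchy_schwarz f g : mean (fun w => f w * g w) ^+ 2 <=
  mean (fun w => f w ^+ 2) * mean (fun w => g w ^+ 2).
Proof.
rewrite /mean exprMn [leRHS]mulrACA -expr2 ler_wpM2r ?sqr_ge0 //.
(* Lagrange's identity: expanding this double sum gives twice the difference of the two sides. *)
have: 0 <= \sum_v \sum_w (f v * g w - f w * g v) ^+ 2.
  by apply: sumr_ge0 => v _; apply: sumr_ge0 => w _; rewrite sqr_ge0.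
under eq_bigr => v _ do under eq_bigr => w _ do
  (rewrite (_ : _ ^+ 2 = f v ^+ 2 * g w ^+ 2 + g v ^+ 2 * f w ^+ 2
     - 2 * (f v * g v) * (f w * g w)); last by ring).
under eq_bigr => v _ do rewrite sumrB big_split /= -!mulr_sumr.
rewrite sumrB big_split /= -!mulr_suml.
rewrite -mulr_sumr; nra.
Qed.

Lemma mean_norm_sqr f : mean (fun w => `|f w|) ^+ 2 <= mean (fun w => f w ^+ 2).
Proof.
have := mean_cauchy_schwarz (fun w => `|f w|) (fun=> 1).
rewrite (@eq_mean (fun w => _ * 1) (fun w => `|f w|)); last by move=> w; rewrite mulr1.
rewrite (@eq_mean (fun w => _ ^+ 2) (fun w => f w ^+ 2)); last first.
  by move=> w; rewrite real_normK ?num_real.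
by rewrite expr1n mean_cst mulr1.
Qed.

End Mean.

(** * Calculus of moment bounds *)

Section Bounded.
Context {R : rcfType} {T : finType}.
Hypothesis T_gt0 : (0 < #|T|)%N.
Implicit Types (y z : T -> R) (s t : R) (K L : nat -> R).

(* All moments of [y] are those of a variable of size [s], with constants [K]. *)
Definition bd K s y :=
  [/\ forall p, 1 <= K p, 0 <= s &
      forall p, mean (fun w => `|y w| ^+ p) <= K p * s ^+ p].

(** Cauchy-Schwarz applied to [|y|^p * |z|^p] calls for moments of order [2 * p], hence the doubled
    index. The square root it produces is dropped, which is harmless because the constants are at
    least [1]. *)
Definition prodK K L p := K (2 * p)%N * L (2 * p)%N.

Lemma bd_ext K s y z : y =1 z -> bd K s y -> bd K s z.
Proof.
move=> yz [K1 s0 H]; split=> // p.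
by rewrite (@eq_mean _ _ _ (fun w => `|y w| ^+ p)) // => w; rewrite yz.
Qed.

Lemma bdW K L s t y : (forall p, K p <= L p) -> s <= t -> bd K s y -> bd L t y.
Proof.
move=> KL st [K1 s0 H]; split=> [p||p].
- exact: le_trans (K1 p) (KL p).
- exact: le_trans s0 st.
- apply: le_trans (H p) _; apply: ler_pM => //.
  + exact: le_trans ler01 (K1 p).
  + exact: exprn_ge0.
  + by rewrite lerXn2r ?nnegrE // (le_trans s0).
Qed.

Lemma bd_scale K s t y : s <= t -> bd K s y -> bd K t y.
Proof. exact: bdW. Qed.

Lemma bd_cst K c : (forall p, 1 <= K p) -> bd K `|c| (fun=> c).
Proof.
move=> K1; split=> // p; rewrite mean_cst //.
by rewrite ler_peMl // exprn_ge0.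
Qed.

Lemma bdZ K s c y : bd K s y -> bd K (`|c| * s) (fun w => c * y w).
Proof.
move=> [K1 s0 H]; split=> // [|p]; first by rewrite mulr_ge0.
rewrite (@eq_mean _ _ _ (fun w => `|c| ^+ p * `|y w| ^+ p)); last first.
  by move=> w; rewrite normrM exprMn.
by rewrite meanZ exprMn [leRHS]mulrCA ler_wpM2l ?exprn_ge0.
Qed.

Lemma bdN K s y : bd K s y -> bd K s (fun w => - y w).
Proof.
move=> H; apply: bd_ext (bd_scale _ (bdZ (-1) H)) => [w|]; first by rewrite mulN1r.
by rewrite normrN1 mul1r.
Qed.

Lemma bd_comp K s y (v : T -> T) : injective v -> bd K s y -> bd K s (y \o v).
Proof. by move=> vi [K1 s0 H]; split=> // p; have := H p; rewrite -(mean_inj _ vi). Qed.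

Lemma bdM K L s t y z :
  bd K s y -> bd L t z -> bd (prodK K L) (s * t) (fun w => y w * z w).
Proof.
move=> [K1 s0 HK] [L1 t0 HL]; split=> [p||p]; rewrite ?mulr_ge0 //.
  by rewrite mulr_ege1.
set X := mean _.
have X0 : 0 <= X by apply: mean_ge0 => w; rewrite exprn_ge0.
have KL1 : 1 <= prodK K L p.
  by rewrite mulr_ege1.
have XX : X ^+ 2 <= prodK K L p * (s * t) ^+ p ^+ 2.
  have := mean_cauchy_schwarz (fun w => `|y w| ^+ p) (fun w => `|z w| ^+ p).
  rewrite (_ : mean _ = X); last first.
    by apply: eq_mean => w; rewrite normrM exprMn.
  move=> /le_trans; apply; rewrite /prodK exprMn exprMn [leRHS]mulrACA.
  have mE (u : T -> R) :
      mean (fun w => (`|u w| ^+ p) ^+ 2) = mean (fun w => `|u w| ^+ (2 * p)).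
    by apply: eq_mean => w; rewrite -exprM mulnC.
  rewrite (mE y) (mE z) -!exprM [(p * 2)%N]mulnC.
  by apply: ler_pM => //; apply: mean_ge0 => w; rewrite exprn_ge0.
have KL0 := le_trans ler01 KL1.
have st0 : 0 <= (s * t) ^+ p by rewrite exprn_ge0 ?mulr_ge0.
have : X ^+ 2 <= (prodK K L p * (s * t) ^+ p) ^+ 2.
  apply: le_trans XX _.
  by rewrite [leRHS]exprMn ler_wpM2r ?sqr_ge0 // expr2 ler_peMr.
by rewrite ler_sqr // nnegrE ?[0 <= prodK _ _ _ * _]mulr_ge0.
Qed.

(** Jensen's inequality for a power, with unnormalised weights [s] and [t]. The induction step
    reduces to [(a - b) * (a^(p+1) - b^(p+1)) >= 0]. *)
Lemma convex_expr2 (p : nat) s t (a b : R) : 0 <= s -> 0 <= t -> 0 <= a -> 0 <= b ->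
  (s * a + t * b) ^+ p.+1 <= (s + t) ^+ p * (s * a ^+ p.+1 + t * b ^+ p.+1).
Proof.
move=> s0 t0 a0 b0; elim: p => [|p IH]; first by rewrite !expr1 expr0 mul1r.
rewrite exprS; apply: (@le_trans _ _
  ((s * a + t * b) * ((s + t) ^+ p * (s * a ^+ p.+1 + t * b ^+ p.+1)))).
  by rewrite ler_wpM2l // addr_ge0 ?mulr_ge0.
rewrite [(s + t) ^+ p.+1]exprSr mulrCA -[leRHS]mulrA ler_wpM2l ?exprn_ge0 ?addr_ge0 //.
rewrite [a ^+ p.+2]exprS [b ^+ p.+2]exprS; set x := a ^+ _; set y := b ^+ _.
have : 0 <= (a - b) * (x - y).
  have [ab|/ltW ab] := leP a b.
    by rewrite mulr_le0 // subr_le0 // lerXn2r ?nnegrE.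
  by rewrite mulr_ge0 // subr_ge0 // lerXn2r ?nnegrE.
move=> H; rewrite -subr_ge0.
rewrite (_ : _ - _ = s * t * ((a - b) * (x - y))); last by ring.
by rewrite mulr_ge0 // mulr_ge0.
Qed.

(** Minkowski's inequality, from [convex_expr2] at [|y| / s] and [|z| / t]. It is essential that [K]
    does not deteriorate: the sums below have a number of terms that grows with [n]. *)
Lemma bdD K s t y z : bd K s y -> bd K t z -> bd K (s + t) (fun w => y w + z w).
Proof.
move=> [K1 s0 HK] [_ t0 HL]; split=> // [|[|p]]; first by rewrite addr_ge0.
  by rewrite !expr0 mulr1 mean_cst.
(* If [s = 0], the bound forces [y] to vanish at every point of the finite type, and division by [s]
   is avoided. *)
have [s00|sN0] := eqVneq s 0.
  have y0 w : y w = 0.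
    have := HK p.+1; rewrite s00 expr0n mulr0 /mean.
    rewrite ler_pdivrMr ?ltr0n // mul0r => H.
    have /eqP : \sum_w `|y w| ^+ p.+1 = 0.
      by apply/eqP; rewrite eq_le H sumr_ge0 // => v _; rewrite exprn_ge0.
    rewrite psumr_eq0 => [|v _]; last by rewrite exprn_ge0.
    by move=> /allP /(_ w (mem_index_enum _)); rewrite expf_eq0 normr_eq0 => /eqP.
  by rewrite s00 add0r (@eq_mean _ _ _ (fun w => `|z w| ^+ p.+1)) // => w;
    rewrite y0 add0r.
have [t00|tN0] := eqVneq t 0.
  have z0 w : z w = 0.
    have := HL p.+1; rewrite t00 expr0n mulr0 /mean.
    rewrite ler_pdivrMr ?ltr0n // mul0r => H.
    have /eqP : \sum_w `|z w| ^+ p.+1 = 0.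
      by apply/eqP; rewrite eq_le H sumr_ge0 // => v _; rewrite exprn_ge0.
    rewrite psumr_eq0 => [|v _]; last by rewrite exprn_ge0.
    by move=> /allP /(_ w (mem_index_enum _)); rewrite expf_eq0 normr_eq0 => /eqP.
  by rewrite t00 addr0 (@eq_mean _ _ _ (fun w => `|y w| ^+ p.+1)) // => w;
    rewrite z0 addr0.
have Hpt w : `|y w + z w| ^+ p.+1 <= (s + t) ^+ p *
    (s * (s ^- p.+1 * `|y w| ^+ p.+1) + t * (t ^- p.+1 * `|z w| ^+ p.+1)).
  have := @convex_expr2 p s t (`|y w| / s) (`|z w| / t) s0 t0.
  rewrite !divr_ge0 // => /(_ isT isT); rewrite !expr_div_n.
  rewrite [s * (_ / s)]mulrC [t * (_ / t)]mulrC !divfK //.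
  rewrite [_ / s ^+ _]mulrC [_ / t ^+ _]mulrC; apply: le_trans.
  by rewrite lerXn2r ?nnegrE ?addr_ge0 // ler_normD.
apply: le_trans (ler_mean Hpt) _; rewrite meanZ meanD !meanZ.
rewrite [(s + t) ^+ p.+1]exprSr [leRHS]mulrCA ler_wpM2l ?exprn_ge0 ?addr_ge0 // mulrDr.
rewrite lerD // mulrC ler_wpM2r //.
  by rewrite mulrC ler_pdivrMr ?exprn_gt0 ?lt_def ?sN0.
by rewrite mulrC ler_pdivrMr ?exprn_gt0 ?lt_def ?tN0.
Qed.

Lemma bd_sum K (I : Type) (r : seq I) (P : pred I) (s : I -> R) (y : I -> T -> R) :
  (forall p, 1 <= K p) -> (forall i, P i -> bd K (s i) (y i)) ->
  bd K (\sum_(i <- r | P i) s i) (fun w => \sum_(i <- r | P i) y i w).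
Proof.
move=> K1 H; elim: r => [|i r IH].
  rewrite big_nil; apply: bd_ext (bd_scale _ (bd_cst 0 K1)) => [w|]; last by rewrite normr0.
  by rewrite big_nil.
rewrite big_cons; case: ifPn => Pi.
  by apply: bd_ext (bdD (H i Pi) IH) => w; rewrite big_cons Pi.
by apply: bd_ext IH => w; rewrite big_cons (negbTE Pi).
Qed.

Lemma bd_mean K s y : bd K s y -> mean (fun w => `|y w|) <= K 1%N * s.
Proof. by case=> _ _ /(_ 1%N); rewrite expr1; under eq_mean do rewrite expr1. Qed.

End Bounded.

(** * Moments of the entries of powers of a sign matrix *)

Lemma leq_size_count (T : eqType) (k : nat) (L s : seq T) :
  uniq L -> (forall z, z \in L -> k <= count_mem z s)%N -> (k * size L <= size s)%N.
Proof.
elim: L s => [|z L IH] s /=; first by rewrite muln0.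
move=> /andP [zL uL] H.
have := IH [seq y <- s | y != z] uL.
have E : (count_mem z s + size [seq y <- s | y != z] = size s)%N.
  by rewrite size_filter (count_predC (pred1 z)).
have -> : (forall y, y \in L -> (k <= count_mem y [seq y <- s | y != z])%N) <->
          True.
  split=> // _ y yL; rewrite count_filter.
  rewrite (_ : count _ s = count_mem y s); first by rewrite H // inE yL orbT.
  apply: eq_count => u /=; case: eqP => // -> /=.
  by apply: contraNneq zL => <-.
by move=> /(_ I); have := H z (mem_head _ _); rewrite -E mulnS; lia.
Qed.

Lemma sum_tupleS (R : nmodType) (T : finType) a (F : a.+1.-tuple T -> R) :
  \sum_t F t = \sum_z \sum_(t : a.-tuple T) F [tuple of z :: t].
Proof.
rewrite pair_big /= (reindex (fun p : T * a.-tuple T => [tuple of p.1 :: p.2])) //.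
exists (fun t => (thead t, [tuple of behead t])) => [[z t] _|t _] /=.
  by congr pair; apply: val_inj.
by rewrite [in RHS](tuple_eta t); apply: val_inj.
Qed.

Section SignMatrix.
Context {R : rcfType} {n : nat}.

(** [true] encodes the sign [-1], so that flipping a set of signs is the exclusive or with a fixed
    pattern, an involution preserving the uniform mean. *)
Definition cube := {ffun 'I_n * 'I_n -> bool}.
Implicit Types (w v : cube) (x y z : 'I_n).

Lemma cube_gt0 : (0 < #|{: cube}|)%N.
Proof. by apply/card_gt0P; exists [ffun=> false]. Qed.

Definition xorc v w : cube := [ffun e => v e (+) w e].

Lemma xorcK v : involutive (xorc v).
Proof. by move=> w; apply/ffunP => e; rewrite !ffunE addKb. Qed.

Lemma mean_xorc v (f : cube -> R) : mean (fun w => f (xorc v w)) = mean f.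
Proof. exact: (mean_inj _ (inv_inj (xorcK v))). Qed.

Definition sgn w x y : R := (-1) ^+ w (x, y).

Lemma sgnK w x y : sgn w x y * sgn w x y = 1.
Proof. by rewrite /sgn; case: (w _); rewrite ?expr1 ?expr0 ?mulrNN mulr1. Qed.

Lemma normr_sgn w x y : `|sgn w x y| = 1.
Proof. by rewrite /sgn normrX normrN1 expr1n. Qed.

Definition inv_sqrtn : R := (Num.sqrt n%:R)^-1.
Local Notation rho := inv_sqrtn.
Definition smx w : 'M[R]_n := \matrix_(x, y) (sgn w x y / Num.sqrt n%:R).
Definition mpow a w x y : R := (smx w ^+ a) x y.

Fixpoint walk w x (s : seq 'I_n) y : R :=
  if s is z :: s' then sgn w x z * walk w z s' y else sgn w x y.

Lemma mpowS a w x y : mpow a.+1 w x y = \sum_z rho * sgn w x z * mpow a w z y.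
Proof.
rewrite /mpow exprS mxE; apply: eq_bigr => z _; rewrite mxE /inv_sqrtn.
by rewrite [sgn _ _ _ / _]mulrC.
Qed.

Lemma mpow0 w x y : mpow 0 w x y = (x == y)%:R.
Proof. by rewrite /mpow expr0 mxE. Qed.

Lemma mpow_walk a w x y :
  mpow a.+1 w x y = rho ^+ a.+1 * \sum_(t : a.-tuple 'I_n) walk w x t y.
Proof.
elim: a x => [|a IH] x.
  rewrite mpowS (bigD1 y) //= mpow0 eqxx mulr1 big1 ?addr0 => [|z /negbTE zy].
    rewrite (big_pred1 [tuple]) /= ?expr1 // => t.
    by apply/esym/eqP; rewrite [LHS]tuple0 [RHS]tuple0.
  by rewrite mpow0 zy mulr0.
rewrite mpowS sum_tupleS mulr_sumr; apply: eq_bigr => z _.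
rewrite IH /= -[in RHS]mulr_sumr [in RHS]exprS. ring.
Qed.

Lemma normr_walk w x s y : `|walk w x s y| = 1.
Proof. by elim: s x => [|z s IH] x /=; rewrite ?normrM ?IH normr_sgn ?mulr1. Qed.

(** A step from [u] to [v] reads a sign in column [v]. The flip of column [z] therefore counts the
    arrivals of a walk at [z]: the starting point is not counted, the endpoint is. *)
Definition colpat z : cube := [ffun e => e.2 == z].

Lemma walk_colpat z w x s y :
  walk (xorc (colpat z) w) x s y = (-1) ^+ count_mem z (rcons s y) * walk w x s y.
Proof.
have E (u v : 'I_n) : sgn (xorc (colpat z) w) u v = (-1) ^+ (v == z) * sgn w u v.
  by rewrite /sgn !ffunE /= signr_addb.
elim: s x => [|u s IH] x /=; first by rewrite E addn0.
by rewrite IH E exprD mulrACA.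
Qed.

(** The vertex [y], common endpoint of all the walks, is exempt. This does not spoil the count,
    since visits to [y] involve no choice of a vertex. *)
Definition even_visits (W a : nat) y (tau : {ffun 'I_W -> a.-tuple 'I_n}) :=
  [forall z, (z != y) ==> ~~ odd (\sum_i count_mem z (tau i))].

(* If [z <> y] is entered an odd number of times, flipping every sign of the
   column of [z] changes the sign of the product. *)
Lemma mean_walks (W a : nat) x y (tau : {ffun 'I_W -> a.-tuple 'I_n}) :
  mean (fun w => \prod_i walk w x (tau i) y) <= (even_visits y tau)%:R.
Proof.
have le1 : mean (fun w => \prod_i walk w x (tau i) y) <= 1.
  apply: le_trans (ler_norm _) _; apply: le_trans (ler_norm_mean _) _.
  rewrite -[leRHS](mean_cst cube_gt0) ler_mean // => w.
  by rewrite normr_prod big1 // => i _; rewrite normr_walk.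
have [//|/forallPn [z]] := boolP (even_visits _ _).
rewrite negb_imply negbK => /andP [/negbTE zy zodd].
set f := fun w => _; rewrite mulr0n.
have : mean f = - mean f; last by lra.
rewrite -[LHS](mean_xorc (colpat z)) -meanN; apply: eq_mean => w; rewrite /f.
under eq_bigr do rewrite walk_colpat.
rewrite big_split /= -expr_sum.
under eq_bigr do rewrite -cats1 count_cat /= [y == z]eq_sym zy !addn0.
by rewrite -signr_odd zodd expr1 mulN1r.
Qed.

(* An even family enters at most [m = p * a] vertices [z <> y], each at least twice;
   it is encoded by the list [p.2] of these vertices, padded with [y], and the
   positions [p.1] in it of the vertices of the walks. *)
Definition decode_walks (W a m : nat) y
    (p : {ffun 'I_W -> a.-tuple 'I_m.+1} * m.-tuple 'I_n) :
    {ffun 'I_W -> a.-tuple 'I_n} :=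
  [ffun i => [tuple of [seq nth y p.2 (c : 'I_m.+1) | c <- p.1 i]]].

Lemma card_even_visits (p a : nat) y : (#|[set tau | @even_visits (2 * p) a y tau]| <=
   ((p * a).+1 ^ a) ^ (2 * p) * n ^ (p * a))%N.
Proof.
set m := (p * a)%N.
have -> : (((m.+1 ^ a) ^ (2 * p)) * n ^ m =
    #|{: {ffun 'I_(2 * p) -> a.-tuple 'I_m.+1} * m.-tuple 'I_n}|)%N.
  by rewrite card_prod card_ffun !card_tuple !card_ord.
rewrite -cardsT; apply: leq_trans (leq_imset_card (@decode_walks _ _ _ y) _).
apply/subset_leq_card/fintype.subsetP => tau; rewrite inE => /forallP gtau.
pose s := flatten [seq val (tau i) | i <- enum 'I_(2 * p)].
pose L := [seq z <- undup s | z != y].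
have countE z : count_mem z s = \sum_i count_mem z (tau i).
  rewrite /s count_flatten -map_comp sumnE big_map big_enum /=.
  by apply: eq_bigr.
have sizes : size s = (2 * m)%N.
  rewrite size_flatten /shape -map_comp sumnE big_map big_enum /=.
  under eq_bigr do rewrite size_tuple.
  by rewrite sum_nat_const card_ord mulnA.
(* A vertex of [L] occurs in [s], and does so an even number of times, hence at least twice; [s] has
   [2 * m] entries. *)
have sizeL : (size L <= m)%N.
  rewrite -(leq_pmul2l (isT : 0 < 2)%N) -sizes leq_size_count //.
    by rewrite filter_uniq ?undup_uniq.
  move=> z; rewrite mem_filter mem_undup => /andP [zy].
  rewrite -has_pred1 has_count; have := gtau z; rewrite zy countE /=.
  by case: (\sum_i _) => [|[]].
have sL : size (L ++ nseq (m - size L) y) == m.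
  by rewrite size_cat size_nseq subnKC.
have zs i z : z \in val (tau i) -> z \in s.
  move=> zi; apply/flattenP; exists (val (tau i)) => //.
  by apply/mapP; exists i; rewrite ?mem_enum.
apply/imsetP; exists ([ffun i => [tuple of
    [seq (inord (index z L) : 'I_m.+1) | z <- tau i]]], Tuple sL); rewrite ?inE //.
apply/ffunP => i; rewrite ffunE /=; apply: val_inj; rewrite /= ffunE /=.
rewrite -map_comp -[LHS]map_id; apply/eq_in_map => z zi /=.
rewrite inordK ?ltnS ?(leq_trans (index_size _ _)) //.
rewrite nth_cat index_mem; case: ifPn => zL; first by rewrite nth_index.
(* A vertex missing from [L] is [y]. Its index in [L] is [size L], where the decoding reads the
   padding or, beyond it, the default value, both equal to [y]. *)
have -> : z = y.
  by apply/eqP; apply: contraNT zL => zy; rewrite mem_filter zy mem_undup (zs i).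
by rewrite nth_nseq; case: ifP.
Qed.

Lemma rho_ge0 : 0 <= rho. Proof. by rewrite /inv_sqrtn invr_ge0 sqrtr_ge0. Qed.

(** Of the [2 * p * a] inner vertices, at most [p * a] are free. The resulting [n^(p * a)] cancels
    [rho^(2 * p * a)] exactly; the remaining [rho^(2 * p)] comes from the one step that each walk
    has in excess of its inner vertices. *)
Lemma mean_mpow_even (p a : nat) x y : mean (fun w => mpow a.+1 w x y ^+ (2 * p)) <=
   (((p * a).+1 ^ a) ^ (2 * p))%:R * rho ^+ (2 * p).
Proof.
set c := (_ ^ (2 * p))%N.
have E w : mpow a.+1 w x y ^+ (2 * p) = rho ^+ (2 * p * a.+1) *
    \sum_(tau : {ffun 'I_(2 * p) -> a.-tuple 'I_n}) \prod_i walk w x (tau i) y.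
  rewrite mpow_walk exprMn -exprM [(a.+1 * _)%N]mulnC; congr (_ * _).
  rewrite -(bigA_distr_bigA (fun _ (t : a.-tuple 'I_n) => walk w x t y)) /=.
  by rewrite prodr_const card_ord.
rewrite (eq_mean E) meanZ mean_sum.
have H : \sum_(tau : {ffun 'I_(2 * p) -> a.-tuple 'I_n})
    mean (fun w => \prod_i walk w x (tau i) y) <= (c * n ^ (p * a))%:R.
  apply: le_trans (ler_sum _ (fun tau _ => mean_walks x y tau)) _.
  rewrite -natr_sum ler_nat; apply: leq_trans (card_even_visits p a y).
  by rewrite -sum1_card [leqRHS]big_mkcond /=; under [leqRHS]eq_bigr do rewrite inE.
have K : rho ^+ (2 * p * a) * n%:R ^+ (p * a) = 1.
  have n0 : n%:R != 0 :> R.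
    by rewrite pnatr_eq0 -lt0n (leq_ltn_trans _ (ltn_ord x)).
  by rewrite -mulnA exprM -exprMn /inv_sqrtn exprVn sqr_sqrtr // mulVf ?expr1n.
apply: le_trans (ler_wpM2l (exprn_ge0 _ rho_ge0) H) _.
by rewrite mulnS exprD natrM natrX mulrCA -[_ * _ * _]mulrA K mulr1.
Qed.

Lemma mean_mpow (p a : nat) x y : mean (fun w => `|mpow a.+1 w x y| ^+ p) <=
  (1 + (((p * a).+1 ^ a) ^ (2 * p))%:R) * rho ^+ p.
Proof.
set K := _%:R.
have r0 : 0 < rho.
  by rewrite /inv_sqrtn invr_gt0 sqrtr_gt0 ltr0n (leq_ltn_trans _ (ltn_ord x)).
have rp0 : 0 < rho ^+ p by rewrite exprn_gt0.
(* Passes from even moments to all moments without taking roots: with [u] the [p]-th power of the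
   entry, [u^2] is its even power [2 * p]. *)
have H (u : R) : 0 <= u -> u <= rho ^+ p + u ^+ 2 / rho ^+ p.
  move=> u0; rewrite -(ler_pM2r rp0) mulrDl divfK ?gt_eqF //.
  by have := ltW rp0; set v := rho ^+ p => v0; nra.
apply: le_trans (ler_mean (fun w => H _ (exprn_ge0 p (normr_ge0 (mpow a.+1 w x y))))) _.
rewrite meanD meanZr mean_cst ?cube_gt0 // mulrDl mul1r lerD2l ler_pdivrMr //.
rewrite -mulrA -exprD addnn -mul2n; apply: le_trans (mean_mpow_even p a x y).
rewrite le_eqVlt; apply/orP; left; apply/eqP; apply: eq_mean => w.
by rewrite -exprM mulnC exprM real_normK ?num_real // -exprM.
Qed.

(** Indexed by the exponent [a] of the matrix, whose walks have [a.-1] inner vertices. It depends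
    neither on [n] nor on the entry, and the summand [1] gives the lower bound demanded by [bd]. *)
Definition Kmpow (a p : nat) : R := 1 + (((p * a.-1).+1 ^ a.-1) ^ (2 * p))%:R.

(* The order of magnitude of [mpow a w x y], uniformly in [a]. *)
Definition eta x y : R := if x == y then 1 else rho.

Lemma bd_mpowS a x y : bd (Kmpow a.+1) rho (fun w => mpow a.+1 w x y).
Proof.
split=> [p||p]; rewrite ?rho_ge0 ?lerDl //; exact: mean_mpow.
Qed.

Lemma rho_le1 : rho <= 1.
Proof.
rewrite /inv_sqrtn; case: n => [|k]; first by rewrite sqrtr0 invr0.
by rewrite invf_le1 ?sqrtr_gt0 ?ltr0n // -{1}sqrtr1 ler_sqrt ?ler1n.
Qed.

Lemma eta_ge0 x y : 0 <= eta x y.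
Proof. by rewrite /eta; case: eqP; rewrite ?rho_ge0. Qed.

Lemma eta_le1 x y : eta x y <= 1.
Proof. by rewrite /eta; case: eqP; rewrite ?rho_le1. Qed.

Lemma rho_le_eta x y : rho <= eta x y.
Proof. by rewrite /eta; case: eqP; rewrite ?rho_le1. Qed.

Lemma eta_sym x y : eta x y = eta y x.
Proof. by rewrite /eta eq_sym. Qed.

Lemma bd_mpow a x y : bd (Kmpow a) (eta x y) (fun w => mpow a w x y).
Proof.
case: a => [|a]; last exact: bd_scale (rho_le_eta x y) (bd_mpowS a x y).
have K1 p : 1 <= Kmpow 0 p by rewrite lerDl.
apply: bd_ext (bd_scale _ (bd_cst cube_gt0 (x == y)%:R K1)) => [w|].
  by rewrite mpow0.
by rewrite /eta; case: eqP => _; rewrite /= ?normr1 // normr0 rho_ge0.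
Qed.

End SignMatrix.

Arguments cube : clear implicits.
Arguments inv_sqrtn : clear implicits.

(** * Integration by parts on the sign cube *)

Lemma subrX_noncomm (A : pzRingType) (a b : A) k :
  a ^+ k - b ^+ k = \sum_(i < k) b ^+ i * (a - b) * a ^+ (k.-1 - i).
Proof.
elim: k => [|k IH]; first by rewrite big_ord0 subrr.
rewrite big_ord_recl /= expr0 mul1r subn0.
rewrite (eq_bigr (fun i : 'I_k => b * (b ^+ i * (a - b) * a ^+ (k.-1 - i)))).
  by rewrite -mulr_sumr -IH mulrBl mulrBr !exprS subrKA.
by move=> i _ /=; rewrite /bump /= add1n exprS !mulrA subnS -predn_sub.
Qed.

Section Edge.
Context {R : rcfType} {n : nat}.
Hypothesis n_gt0 : (0 < n)%N.
Local Notation cube := (cube n).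
Local Notation rho := (inv_sqrtn R n).
Implicit Types (w : cube) (x y z s t : 'I_n) (f g h : cube -> R).

Definition flip x y w : cube := xorc [ffun e => e == (x, y)] w.

Lemma flipK x y : involutive (flip x y). Proof. exact: xorcK. Qed.

Lemma sgn_flip x y s t w :
  sgn (flip x y w) s t = (if (s, t) == (x, y) then - sgn w s t else sgn w s t) :> R.
Proof.
by rewrite /sgn !ffunE; case: eqP => _ //; rewrite addTb signrN.
Qed.

(* The discrete derivative of [f] with respect to the sign [(x, y)]. *)
Definition edgeD x y f w : R := sgn w x y * (f w - f (flip x y w)) / 2.

Lemma mean_edgeD x y f : mean (fun w => sgn w x y * f w) = mean (edgeD x y f).
Proof.
rewrite /edgeD meanZr -[LHS](mulfK (x := 2)) ?pnatr_eq0 //; congr (_ / 2).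
under [RHS]eq_mean do rewrite mulrBr.
rewrite meanB -[mean (fun w => sgn w x y * f (flip x y w))](mean_inj _ (inv_inj (flipK x y))).
rewrite mulr_natr mulr2n; congr (_ + _); rewrite -meanN; apply: eq_mean => w /=.
by rewrite flipK sgn_flip eqxx mulNr opprK.
Qed.

Lemma edgeD_sub x y f w : f w - f (flip x y w) = 2 * sgn w x y * edgeD x y f w.
Proof.
have := @sgnK R n w x y; rewrite /edgeD; set e := sgn _ _ _ => e1.
by rewrite [RHS](_ : _ = (e * e) * (f w - f (flip x y w))); [rewrite e1 mul1r | field].
Qed.

Lemma edgeD_subr x y f w : f (flip x y w) = f w - 2 * sgn w x y * edgeD x y f w.
Proof. by rewrite -edgeD_sub opprB addrC subrK. Qed.

Lemma edgeDM x y f g w :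
  edgeD x y (fun w => f w * g w) w =
  edgeD x y f w * g w + f (flip x y w) * edgeD x y g w.
Proof. by rewrite /edgeD; field. Qed.

(** The form of the product rule in which the first-order terms contain no flipped factor; the price
    is the second-order last term. *)
Lemma edgeDMl x y f g w :
  edgeD x y (fun w => f w * g w) w =
  edgeD x y f w * g w + f w * edgeD x y g w
  - 2 * sgn w x y * edgeD x y f w * edgeD x y g w.
Proof. by rewrite edgeDM edgeD_subr; ring. Qed.

Lemma edgeD_sum x y (I : Type) (r : seq I) (P : pred I) (F : I -> cube -> R) w :
  edgeD x y (fun w => \sum_(i <- r | P i) F i w) w =
  \sum_(i <- r | P i) edgeD x y (F i) w.
Proof. by rewrite /edgeD -sumrB mulr_sumr mulr_suml. Qed.

Lemma edgeDZ x y c f w : edgeD x y (fun w => c * f w) w = c * edgeD x y f w.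
Proof. by rewrite /edgeD; ring. Qed.

Lemma smx_flip x y w :
  smx w - smx (flip x y w) = (2 * rho * sgn w x y) *: delta_mx x y :> 'M[R]_n.
Proof.
apply/matrixP => s t; rewrite !mxE sgn_flip xpair_eqE /inv_sqrtn.
case: eqP => [->|_]; case: eqP => [->|_] //=; rewrite ?subrr ?mulr0 //.
by rewrite mulr1 mulNr opprK; ring.
Qed.

Lemma mul_delta_mx_entry (A B : 'M[R]_n) x y s t :
  (A *m delta_mx x y *m B) s t = A s x * B y t.
Proof.
rewrite mxE (bigD1 y) //= big1 ?addr0 => [|j jy].
  rewrite mxE (bigD1 x) //= big1 ?addr0 => [|k kx]; rewrite mxE ?eqxx ?mulr1 //.
  by rewrite (negbTE kx) mulr0.
rewrite mxE big1 ?mul0r // => k _.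
by rewrite mxE (negbTE jy) andbF mulr0.
Qed.

(** The flip changes the matrix by a multiple of [delta_mx x y], so each term of the noncommutative
    telescoping splits at that entry into a walk from [s] to [x], read after the flip, and a walk
    from [y] to [t], read before it. *)
Lemma edgeD_mpow x y a s t w :
  edgeD x y (fun w => mpow a w s t) w =
  rho * \sum_(k < a) mpow k (flip x y w) s x * mpow (a.-1 - k) w y t.
Proof.
have -> : edgeD x y (fun w => mpow a w s t) w =
   sgn w x y * (smx w ^+ a - smx (flip x y w) ^+ a) s t / 2.
  by rewrite !mxE.
rewrite subrX_noncomm smx_flip summxE mulr_sumr mulr_suml mulr_sumr.
apply: eq_bigr => k _.
rewrite -!mulmxE -scalemxAr -scalemxAl mxE mul_delta_mx_entry.
have := @sgnK R n w x y; set e := sgn _ _ _ => e1.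
have eN0 : e != 0 by apply: contraTneq (oner_neq0 R) => e0; rewrite -e1 e0 mul0r eqxx.
by rewrite -[RHS]mul1r -[X in _ = X * _]e1 /mpow; field.
Qed.

(** [edgeD x y f] is unchanged by the flip itself, so the flipped and unflipped factors may trade
    places. In [edgeD_trpow] this puts an unflipped factor next to the summation vertex [z], where
    it merges with the other one. *)
Lemma edgeD_mpow_sym x y a s t w :
  edgeD x y (fun w => mpow a w s t) w =
  rho * \sum_(k < a) mpow k w s x * mpow (a.-1 - k) (flip x y w) y t.
Proof.
have := edgeD_mpow x y a s t (flip x y w); rewrite flipK => <-.
by rewrite /edgeD flipK sgn_flip eqxx; ring.
Qed.

Definition trpow a w : R := \tr (smx w ^+ a).

Lemma mpow_mul a b w s t : \sum_z mpow a w s z * mpow b w z t = mpow (a + b) w s t :> R.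
Proof. by rewrite /mpow exprD mxE. Qed.

(** By cyclicity the entry may sit at any of the [r] positions of the closed walk, each giving
    [mpow r.-1 w y x]. The correction arises from replacing the flipped left factor by the unflipped
    one. *)
Lemma edgeD_trpow x y r w : edgeD x y (trpow r) w =
  rho * (r%:R * mpow r.-1 w y x) -
  rho * (2 * sgn w x y * (rho * \sum_(k < r) \sum_(l < k)
    mpow (r.-1 - k + l) w y x * mpow (k.-1 - l) (flip x y w) y x)).
Proof.
rewrite -mulrBr.
have -> : edgeD x y (trpow r) w = \sum_z edgeD x y (fun w => mpow r w z z) w.
  by rewrite -edgeD_sum.
under eq_bigr do rewrite edgeD_mpow.
rewrite -mulr_sumr; congr (_ * _); rewrite exchange_big /=.
have E (k : 'I_r) : \sum_z mpow k (flip x y w) z x * mpow (r.-1 - k) w y z =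
    mpow r.-1 w y x - 2 * sgn w x y * (rho * \sum_(l < k)
    mpow (r.-1 - k + l) w y x * mpow (k.-1 - l) (flip x y w) y x).
  under eq_bigr => z _ do rewrite (edgeD_subr x y (fun w => mpow k w z x))
    edgeD_mpow_sym mulrBl [mpow k w z x * _]mulrC.
  rewrite sumrB mpow_mul subnK; last by have := ltn_ord k; lia.
  congr (_ - _); rewrite [2 * _ * (rho * _)]mulrA.
  rewrite (eq_bigr (fun z => 2 * sgn w x y * rho * \sum_(l < k)
      mpow (r.-1 - k) w y z * mpow l w z x * mpow (k.-1 - l) (flip x y w) y x)).
    rewrite -mulr_sumr exchange_big /=; congr (_ * _); apply: eq_bigr => l _.
    by rewrite -mulr_suml mpow_mul.
  move=> z _; rewrite [2 * _ * (rho * _)]mulrA -[LHS]mulrA; congr (_ * _).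
  rewrite mulr_suml.
  by apply: eq_bigr => l _; ring.
under eq_bigr do rewrite E.
by rewrite sumrB sumr_const card_ord -[_ *+ r]mulr_natl -!mulr_sumr.
Qed.

Lemma trpowS r w : trpow r.+1 w = \sum_x \sum_y rho * (sgn w x y * mpow r w y x).
Proof.
apply: eq_bigr => x _; rewrite -[LHS]/(mpow r.+1 w x x) mpowS.
by apply: eq_bigr => y _; rewrite mulrA.
Qed.

Lemma rho_gt0 : 0 < rho. Proof. by rewrite /inv_sqrtn invr_gt0 sqrtr_gt0 ltr0n. Qed.

Lemma rho2n : rho ^+ 2 * n%:R = 1.
Proof. by rewrite /inv_sqrtn exprVn sqr_sqrtr // mulVf // pnatr_eq0 -lt0n. Qed.

(** The diagonal contributes [1 <= 1 / rho] and the other terms at most [n * rho = 1 / rho]: working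
    with [eta] instead of [rho] costs at most a factor [2]. *)
Lemma sum_eta x : \sum_y eta x y <= 2 / rho :> R.
Proof.
rewrite ler_pdivlMr ?rho_gt0 // (bigD1 x) //= {1}/eta eqxx.
rewrite (eq_bigr (fun=> rho)) => [|y]; last by rewrite /eta eq_sym => /negbTE ->.
have : \sum_(y | y != x) rho <= n%:R * rho.
  rewrite sumr_const -[leLHS]mulr_natl ler_wpM2r ?rho_ge0 // ler_nat.
  by rewrite -[leqRHS]card_ord max_card.
by have := rho2n; have := rho_gt0; have := rho_le1 (R := R) (n := n); nra.
Qed.

Lemma sum_eta2 x : \sum_y eta x y * eta x y <= 2 :> R.
Proof.
rewrite (bigD1 x) //= {1 2}/eta eqxx mulr1.
rewrite (eq_bigr (fun=> rho ^+ 2)) => [|y]; last first.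
  by rewrite /eta eq_sym => /negbTE ->; rewrite expr2.
have : \sum_(y | y != x) rho ^+ 2 <= n%:R * rho ^+ 2.
  rewrite sumr_const -[leLHS]mulr_natl ler_wpM2r ?sqr_ge0 // ler_nat.
  by rewrite -[leqRHS]card_ord max_card.
by have := rho2n; lra.
Qed.

Lemma sum_eta_eta x z : \sum_y eta x y * eta z y <= 2 :> R.
Proof.
have : \sum_y eta x y * eta z y <=
    \sum_y (eta x y * eta x y / 2 + eta z y * eta z y / 2) :> R.
  apply: ler_sum => y _; have := sqr_ge0 (eta x y - eta z y : R); nra.
rewrite big_split /= -!mulr_suml.
by have := sum_eta2 x; have := sum_eta2 z; lra.
Qed.

Lemma sum_sum_eta2 : \sum_(x < n) \sum_(y < n) eta x y * eta x y <= 2 * n%:R :> R.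
Proof.
apply: le_trans (ler_sum _ (fun x _ => sum_eta2 x)) _.
by rewrite sumr_const card_ord -[leLHS]mulr_natl mulrC.
Qed.

End Edge.

(** * Concentration of the overlaps *)

Section Constants.
Context {R : rcfType}.
Variable D : nat.

Definition Kdeg (p : nat) : R := \sum_(a < D.+1) Kmpow a p.

Lemma Kmpow_ge1 a p : 1 <= Kmpow a p :> R.
Proof. by rewrite lerDl. Qed.

Lemma Kmpow_le a p : (a <= D)%N -> Kmpow a p <= Kdeg p.
Proof.
move=> aD; rewrite /Kdeg (bigD1 (Ordinal (aD : a < D.+1)%N)) //= lerDl.
by apply: sumr_ge0 => i _; rewrite (le_trans ler01) ?Kmpow_ge1.
Qed.

Lemma Kdeg_ge1 p : 1 <= Kdeg p.
Proof. exact: le_trans (Kmpow_ge1 0 p) (Kmpow_le p (leq0n D)). Qed.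

(** Moment constants for a product of [k.+1] matrix entries, nested to the left as [bdM] produces
    them. *)
Fixpoint Kpow (k : nat) : nat -> R :=
  if k is k'.+1 then prodK (Kpow k') Kdeg else Kdeg.

Lemma Kpow_ge1 k p : 1 <= Kpow k p.
Proof.
elim: k p => [|k IH] p /=; first exact: Kdeg_ge1.
by rewrite mulr_ege1 ?IH ?Kdeg_ge1.
Qed.

End Constants.

Section Covariances.
Context {R : rcfType} {n : nat}.
Variable (D : nat).
Hypothesis n_gt0 : (0 < n)%N.
Local Notation cube := (cube n).
Local Notation rho := (inv_sqrtn R n).
Local Notation Kdeg := (@Kdeg R D).
Local Notation Kpow := (@Kpow R D).
Implicit Types (w : cube) (x y z s t : 'I_n) (f g h : cube -> R).

Lemma bd_deg a x y : (a <= D)%N -> bd Kdeg (eta x y) (fun w => mpow a w x y).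
Proof. by move=> aD; apply: bdW (bd_mpow a x y) => // p; apply: Kmpow_le. Qed.

Lemma bd_degS a x y : (a < D)%N -> bd Kdeg rho (fun w => mpow a.+1 w x y).
Proof. by move=> aD; apply: bdW (bd_mpowS a x y) => // p; apply: Kmpow_le. Qed.

Lemma bd_flip K c f x y : bd K c f -> bd K c (fun w => f (flip x y w)).
Proof. exact: (bd_comp (inv_inj (flipK x y))). Qed.

Lemma bd_sumI K (I : finType) c (f : I -> cube -> R) :
  (forall p, 1 <= K p) -> (forall i, bd K c (f i)) ->
  bd K (#|I|%:R * c) (fun w => \sum_i f i w).
Proof.
move=> K1 H; rewrite mulr_natl -sumr_const.
by apply: (bd_sum cube_gt0).
Qed.

Lemma bd_edgeD_mpow a x y s t : (a <= D)%N ->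
  bd (Kpow 1) (D%:R * rho * (eta s x * eta y t)) (edgeD x y (fun w => mpow a w s t)).
Proof.
move=> aD; apply: bd_ext (fun w => esym (edgeD_mpow x y a s t w)) _.
apply: (@bd_scale _ _ _ (`|rho| * (#|'I_a|%:R * (eta s x * eta y t)))).
  rewrite ger0_norm ?rho_ge0 // card_ord mulrCA mulrA.
  rewrite !ler_wpM2r ?mulr_ge0 ?eta_ge0 ?rho_ge0 // ler_nat //.
apply: bdZ; apply: bd_sumI => [p|k]; first exact: Kpow_ge1.
have := ltn_ord k => ka.
apply: bdM.
  by apply: (bd_flip x y (bd_deg s x _)); lia.
by apply: bd_deg; lia.
Qed.

(* This is [tr (M^a (M^b)^T) / n] for [M = smx w]. *)
Definition overlap a b w : R := rho ^+ 2 * \sum_x \sum_y mpow a w x y * mpow b w x y.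
Local Notation cov := overlap.

Lemma covC a b w : cov a b w = cov b a w.
Proof.
rewrite /overlap; congr (_ * _).
by apply: eq_bigr => x _; apply: eq_bigr => y _; rewrite mulrC.
Qed.

Lemma cov00 w : cov 0 0 w = 1.
Proof.
rewrite /overlap -[RHS](rho2n n_gt0); congr (_ * _).
rewrite -[in RHS](card_ord n) -sumr_const /=; apply: eq_bigr => x _.
rewrite (bigD1 x) //= !mpow0 eqxx mulr1 big1 ?addr0 // => y /negbTE yx.
by rewrite mpow0 eq_sym yx mul0r.
Qed.

Lemma bd_cov a b : (a <= D)%N -> (b <= D)%N -> bd (Kpow 1) 2 (cov a b).
Proof.
move=> aD bD; have K1 := @Kpow_ge1 R D 1.
apply: (@bd_scale _ _ _ (`|rho ^+ 2| * \sum_(x < n) \sum_(y < n) eta x y * eta x y)).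
  rewrite ger0_norm ?sqr_ge0 // (le_trans (ler_wpM2l (sqr_ge0 _) (sum_sum_eta2 n_gt0))) //.
  by rewrite mulrCA rho2n // mulr1.
apply/bdZ/(bd_sum cube_gt0) => // x _; apply: (bd_sum cube_gt0) => // y _.
by apply: bdM; apply: bd_deg.
Qed.

(** Each of the two terms of the product rule is at most [D * rho * eta s x * eta y t * eta s t].
    The sum over [t] gives [2], the sum over [s] gives [2 / rho], and the prefactor of the overlap
    is [rho^2]. *)
Lemma bd_edgeD_cov c d x y : (c <= D)%N -> (d <= D)%N ->
  bd (Kpow 2) (8 * D%:R * rho ^+ 2) (edgeD x y (cov c d)).
Proof.
move=> cD dD.
have r0 : 0 < rho := rho_gt0 n_gt0.
have E w : edgeD x y (cov c d) w = rho ^+ 2 * \sum_s \sum_t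
   (edgeD x y (fun w => mpow c w s t) w * mpow d w s t +
    mpow c (flip x y w) s t * edgeD x y (fun w => mpow d w s t) w).
  rewrite /overlap edgeDZ edgeD_sum; congr (_ * _); apply: eq_bigr => s _.
  by rewrite edgeD_sum; apply: eq_bigr => t _; rewrite edgeDM.
apply: bd_ext (fun w => esym (E w)) _.
apply: (@bd_scale _ _ _ (`|rho ^+ 2| * \sum_(s < n) \sum_(t < n)
   (D%:R * rho * (eta s x * eta y t) * eta s t + eta s t * (D%:R * rho * (eta s x * eta y t))))).
  rewrite ger0_norm ?sqr_ge0 // mulrC ler_wpM2r ?sqr_ge0 //.
  rewrite (eq_bigr (fun s => 2 * D%:R * rho * eta s x * \sum_t eta y t * eta s t)).
    apply: (@le_trans _ _ (\sum_s 2 * D%:R * rho * eta s x * 2)).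
      apply: ler_sum => s _; rewrite ler_wpM2l ?sum_eta_eta //.
      by rewrite !mulr_ge0 ?eta_ge0 ?rho_ge0.
    rewrite -mulr_suml -mulr_sumr.
    under eq_bigr do rewrite eta_sym.
    have H : 4 * D%:R * rho * \sum_y eta x y <= 4 * D%:R * rho * (2 / rho).
      by rewrite ler_wpM2l ?sum_eta // !mulr_ge0 ?rho_ge0.
    have E2 : 4 * D%:R * rho * (2 / rho) = 8 * D%:R by field; rewrite gt_eqF.
    by rewrite -E2; apply: le_trans H; rewrite le_eqVlt; apply/orP; left; apply/eqP; ring.
  move=> s _; rewrite mulr_sumr; apply: eq_bigr => t _; ring.
apply/bdZ/(bd_sum cube_gt0) => // [p|s _]; first exact: Kpow_ge1.
apply: (bd_sum cube_gt0) => // [p|t _]; first exact: Kpow_ge1.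
apply: (bdD cube_gt0).
  apply: bdM; first exact: bd_edgeD_mpow.
  exact: bd_deg.
apply: bd_ext (_ : bd (Kpow 2) _ (fun w =>
    edgeD x y (fun w => mpow d w s t) w * mpow c (flip x y w) s t)) => [w|].
  by rewrite mulrC.
rewrite mulrC; apply: bdM; first exact: bd_edgeD_mpow.
exact: (bd_flip x y (bd_deg s t _)).
Qed.

(** The total of the three kinds of error in [cov_rec]. With [n = rho^-2] they contribute [4], [8]
    and [16] times [D * rho], whence the constant [28]. *)
Lemma sum_scales :
  rho ^+ 3 * \sum_(x < n) \sum_(y < n) \sum_(z < n)
    (2 * D%:R * rho ^+ 2 * (eta z y * eta z y) +
     2 * D%:R * rho ^+ 2 * (eta z x * eta z y) +
     8 * D%:R * rho ^+ 3 * eta z y) <= 28 * D%:R * rho.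
Proof.
have r0 : 0 < rho := rho_gt0 n_gt0.
have rn : rho ^+ 2 * n%:R = 1 := rho2n n_gt0.
have nE : n%:R = (rho ^+ 2)^-1 :> R.
  by rewrite -[LHS](mulKf (x := rho ^+ 2)) ?expf_neq0 ?gt_eqF // rn mulr1.
have T1 (x : 'I_n) : \sum_(y < n) \sum_(z < n) eta z y * eta z y <= 2 * n%:R :> R.
  by rewrite exchange_big; exact: sum_sum_eta2.
have T2 : \sum_(x < n) \sum_(y < n) \sum_(z < n) eta z x * eta z y <=
    n%:R * (2 / rho * (2 / rho)) :> R.
  under eq_bigr do rewrite exchange_big /=; rewrite exchange_big /=.
  under eq_bigr do (under eq_bigr do rewrite -mulr_sumr); 
  under eq_bigr do rewrite -mulr_suml.
  apply: (@le_trans _ _ (\sum_(z < n) (2 / rho * (2 / rho)))).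
    apply: ler_sum => z _; apply: ler_pM; rewrite ?sum_eta //;
    by apply: sumr_ge0 => *; rewrite eta_ge0.
  by rewrite sumr_const card_ord -[leLHS]mulr_natl.
have T3 (x : 'I_n) : \sum_(y < n) \sum_(z < n) eta z y <= n%:R * (2 / rho) :> R.
  apply: (@le_trans _ _ (\sum_(y < n) (2 / rho))).
    apply: ler_sum => y _; under eq_bigr do rewrite eta_sym; exact: sum_eta.
  by rewrite sumr_const card_ord -[leLHS]mulr_natl.
have -> : \sum_(x < n) \sum_(y < n) \sum_(z < n)
    (2 * D%:R * rho ^+ 2 * (eta z y * eta z y) +
     2 * D%:R * rho ^+ 2 * (eta z x * eta z y) + 8 * D%:R * rho ^+ 3 * eta z y) =
    2 * D%:R * rho ^+ 2 * \sum_(x < n) \sum_(y < n) \sum_(z < n) (eta z y * eta z y) +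
    2 * D%:R * rho ^+ 2 * \sum_(x < n) \sum_(y < n) \sum_(z < n) (eta z x * eta z y) +
    8 * D%:R * rho ^+ 3 * \sum_(x < n) \sum_(y < n) \sum_(z < n) eta z y.
  rewrite !mulr_sumr -!big_split /=; apply: eq_bigr => x _.
  rewrite !mulr_sumr -!big_split /=; apply: eq_bigr => y _.
  by rewrite !mulr_sumr -!big_split.
have T1' : \sum_(x < n) \sum_(y < n) \sum_(z < n) eta z y * eta z y <= n%:R * (2 * n%:R) :> R.
  by apply: le_trans (ler_sum _ (fun x _ => T1 x)) _; rewrite sumr_const card_ord -[leLHS]mulr_natl.
have T3' : \sum_(x < n) \sum_(y < n) \sum_(z < n) eta z y <= n%:R * (n%:R * (2 / rho)) :> R.
  by apply: le_trans (ler_sum _ (fun x _ => T3 x)) _; rewrite sumr_const card_ord -[leLHS]mulr_natl.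
have D0 : 0 <= D%:R :> R by [].
have c2 : 0 <= 2 * D%:R * rho ^+ 2 by rewrite mulr_ge0 ?sqr_ge0 ?mulr_ge0.
have c3 : 0 <= 8 * D%:R * rho ^+ 3 by apply: mulr_ge0; [exact: mulr_ge0|exact/exprn_ge0/ltW].
have H := lerD (lerD (ler_wpM2l c2 T1') (ler_wpM2l c2 T2)) (ler_wpM2l c3 T3').
apply: le_trans (ler_wpM2l (exprn_ge0 3 (ltW r0)) H) _.
rewrite nE le_eqVlt; apply/orP; left; apply/eqP; field.
by rewrite gt_eqF.
Qed.

(** The first step of the walk in [M^(a+1)] is opened, and the sign of that step is integrated by
    parts against all the rest. *)
Lemma mean_covS a b f : mean (fun w => cov a.+1 b w * f w) =
  rho ^+ 3 * \sum_x \sum_y \sum_z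
    mean (edgeD x z (fun w => mpow b w x y * (mpow a w z y * f w))).
Proof.
under [in RHS]eq_bigr do under eq_bigr do under eq_bigr do rewrite -mean_edgeD.
have E w : cov a.+1 b w * f w = rho ^+ 3 * \sum_x \sum_y \sum_z
    sgn w x z * (mpow b w x y * (mpow a w z y * f w)).
  rewrite /overlap [rho ^+ 3]exprSr -[LHS]mulrA -[RHS]mulrA; congr (_ * _).
  rewrite mulr_suml mulr_sumr; apply: eq_bigr => x _.
  rewrite mulr_suml mulr_sumr; apply: eq_bigr => y _.
  rewrite mpowS !mulr_suml mulr_sumr; apply: eq_bigr => z _; ring.
rewrite (eq_mean E) meanZ mean_sum; congr (_ * _); apply: eq_bigr => x _.
by rewrite mean_sum; apply: eq_bigr => y _; rewrite mean_sum.
Qed.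

Definition Kcov := prodK (Kpow 2) (Kpow 1).

(** The main term comes from the walk of [M^(b+1)] using the sign [(x, z)] at its first step, where
    the left factor is [mpow 0 x x = 1]. Nothing then depends on [x], and the sum over [x] yields
    [rho^2 * n = 1], leaving the overlap of [a] and [b]. The three parts of [rem] are the later
    positions in that walk, the derivative of [mpow a], and the derivative of [h]. The factor
    [cov c d] is carried along so that second moments of overlaps can be reached. *)
Lemma cov_rec a b c d : (a < D)%N -> (b < D)%N -> (c <= D)%N -> (d <= D)%N ->
  `|mean (fun w => cov a.+1 b.+1 w * cov c d w) - mean (fun w => cov a b w * cov c d w)|
    <= Kcov 1 * (28 * D%:R) * rho.
Proof.
move=> aD bD cD dD; set h := cov c d; rewrite mean_covS.
pose rem x y z w := (rho * \sum_(k < b) mpow k.+1 (flip x z w) x x * mpow (b - k.+1) w z y) *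
    mpow a w z y * h w +
  edgeD x z (fun w => mpow a w z y) w * mpow b.+1 (flip x z w) x y * h w +
  edgeD x z h w * (mpow b.+1 (flip x z w) x y * mpow a (flip x z w) z y).
have E x y z w : edgeD x z (fun w => mpow b.+1 w x y * (mpow a w z y * h w)) w =
    rho * (mpow a w z y * mpow b w z y * h w) + rem x y z w.
  rewrite edgeDM edgeDM edgeD_mpow big_ord_recl /= mpow0 eqxx mul1r subn0 /rem.
  under eq_bigr do rewrite /bump /= add1n.
  by ring.
have -> : mean (fun w => cov a b w * h w) = rho ^+ 3 * \sum_(x < n) \sum_y \sum_z
     mean (fun w => rho * (mpow a w z y * mpow b w z y * h w)).
  rewrite sumr_const card_ord -[_ *+ n]mulr_natr.
  under eq_bigr do under eq_bigr do rewrite meanZ.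
  under eq_bigr do rewrite -mulr_sumr.
  rewrite -mulr_sumr.
  rewrite (_ : _ * _ = (rho ^+ 2 * n%:R) * (rho ^+ 2 *
    \sum_(y < n) \sum_(z < n) mean (fun w => mpow a w z y * mpow b w z y * h w))); last by ring.
  rewrite rho2n // mul1r exchange_big /=.
  have E2 w : cov a b w * h w =
      rho ^+ 2 * \sum_x \sum_y mpow a w x y * mpow b w x y * h w.
    rewrite /overlap -mulrA mulr_suml; congr (_ * _); apply: eq_bigr => x _.
    by rewrite mulr_suml.
  rewrite (eq_mean E2) meanZ mean_sum; congr (_ * _).
  by apply: eq_bigr => x _; rewrite mean_sum.
rewrite -mulrBr -sumrB; under eq_bigr do rewrite -sumrB.
under eq_bigr do under eq_bigr do rewrite -sumrB.
have E3 x y z : mean (edgeD x z (fun w => mpow b.+1 w x y * (mpow a w z y * h w))) -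
   mean (fun w => rho * (mpow a w z y * mpow b w z y * h w)) = mean (rem x y z).
  by rewrite -meanB; apply: eq_mean => w; rewrite E addrC addKr.
under eq_bigr do under eq_bigr do under eq_bigr do rewrite E3.
have r0 : 0 <= rho := rho_ge0.
have Hrem x y z : `|mean (rem x y z)| <= Kcov 1 *
    (2 * D%:R * rho ^+ 2 * (eta z y * eta z y) +
     2 * D%:R * rho ^+ 2 * (eta z x * eta z y) + 8 * D%:R * rho ^+ 3 * eta z y).
  apply: le_trans (ler_norm_mean _) _; apply: bd_mean.
  apply: (bdD cube_gt0); first apply: (bdD cube_gt0).
  - apply: (@bd_scale _ _ _ (`|rho| * (#|'I_b|%:R * (rho * eta z y)) * eta z y * 2)).
      rewrite ger0_norm // card_ord; have : b%:R <= D%:R :> R by rewrite ler_nat ltnW.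
      move=> bD2; rewrite 
         [leLHS](_ : _ = b%:R * (2 * rho ^+ 2 * (eta z y * eta z y))); last by ring.
      rewrite [leRHS](_ : _ = D%:R * (2 * rho ^+ 2 * (eta z y * eta z y))); last by ring.
      by apply: ler_wpM2r;
         [apply: mulr_ge0; [rewrite mulr_ge0 ?sqr_ge0|rewrite mulr_ge0 ?eta_ge0]|].
    apply: bdM; last exact: bd_cov.
    apply: bdM; last by apply: bd_deg; lia.
    apply: bdZ; apply: bd_sumI => [p|k]; first exact: (@Kpow_ge1 R D 1).
    have := ltn_ord k => kb.
    apply: bdM; last by apply: bd_deg; lia.
    by apply: (bd_flip x z (bd_degS x x _)); lia.
  - apply: (@bd_scale _ _ _ (D%:R * rho * (eta z x * eta z y) * rho * 2)).
      by rewrite le_eqVlt; apply/orP; left; apply/eqP; ring.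
    apply: bdM; last exact: bd_cov.
    apply: bdM; first by apply: bd_edgeD_mpow; lia.
    by apply: (bd_flip x z (bd_degS x y _)); lia.
  - apply: (@bd_scale _ _ _ (8 * D%:R * rho ^+ 2 * (rho * eta z y))).
      by rewrite le_eqVlt; apply/orP; left; apply/eqP; ring.
    apply: bdM; first exact: bd_edgeD_cov.
    apply: bdM; first by apply: (bd_flip x z (bd_degS x y _)); lia.
    by apply: (bd_flip x z (bd_deg z y _)); lia.
rewrite normrM ger0_norm ?exprn_ge0 //.
have K0 : 0 <= Kcov 1 by rewrite /Kcov /prodK mulr_ge0 // (le_trans ler01) ?Kpow_ge1.
rewrite -[leRHS]mulrA; apply: le_trans (ler_wpM2l K0 sum_scales).
rewrite mulrCA ler_wpM2l ?exprn_ge0 //.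
apply: le_trans (ler_norm_sum _ _ _) _; rewrite mulr_sumr; apply: ler_sum => x _.
apply: le_trans (ler_norm_sum _ _ _) _; rewrite mulr_sumr; apply: ler_sum => y _.
apply: le_trans (ler_norm_sum _ _ _) _; rewrite mulr_sumr; apply: ler_sum => z _.
exact: Hrem.
Qed.

Definition Crec := Kcov 1 * (28 * D%:R).
Definition Ctr := 2 * prodK Kdeg (Kpow 1) 1.

Lemma Kcov_ge0 : 0 <= Kcov 1.
Proof. by rewrite /Kcov /prodK mulr_ge0 // (le_trans ler01) ?Kpow_ge1. Qed.

Lemma Crec_ge0 : 0 <= Crec.
Proof. by rewrite /Crec mulr_ge0 ?Kcov_ge0 // mulr_ge0. Qed.

Lemma Ctr_ge0 : 0 <= Ctr.
Proof.
rewrite /Ctr /prodK mulr_ge0 // mulr_ge0 // (le_trans ler01) //.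
  exact: Kdeg_ge1.
exact: (@Kpow_ge1 R D 1).
Qed.

(** The overlap with the identity is a normalised trace: [n] diagonal entries of size [rho],
    multiplied by [rho^2]. *)
Lemma cov_Sn0 a c d : (a < D)%N -> (c <= D)%N -> (d <= D)%N ->
  `|mean (fun w => cov a.+1 0 w * cov c d w)| <= Ctr * rho.
Proof.
move=> aD cD dD; apply: le_trans (ler_norm_mean _) _.
have r0 : 0 <= rho := rho_ge0.
have bda : bd Kdeg rho (cov a.+1 0).
  have E w : rho ^+ 2 * \sum_x mpow a.+1 w x x = cov a.+1 0 w.
    rewrite /overlap; congr (_ * _); apply: eq_bigr => x _.
    rewrite (bigD1 x) //= mpow0 eqxx mulr1 big1 ?addr0 // => y /negbTE yx.
    by rewrite mpow0 eq_sym yx mulr0.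
  apply: bd_ext E _; apply: (@bd_scale _ _ _ (`|rho ^+ 2| * (#|'I_n|%:R * rho))).
    by rewrite card_ord ger0_norm ?sqr_ge0 // mulrA rho2n ?mul1r.
  by apply/bdZ/bd_sumI => [p|x]; [exact: Kdeg_ge1|exact: bd_degS].
have := bd_mean (bdM bda (bd_cov cD dD)).
by rewrite /Ctr [2 * _]mulrC -[_ * 2 * _]mulrA [2 * rho]mulrC.
Qed.

(** [cov_rec] lowers both exponents together until one of them is [0]. Equal exponents end at
    [cov 0 0 = 1], unequal ones at [cov_Sn0]; the error accumulates over at most [a] steps. *)
Lemma cov_delta a b c d : (a <= D)%N -> (b <= D)%N -> (c <= D)%N -> (d <= D)%N ->
  `|mean (fun w => cov a b w * cov c d w) - (a == b)%:R * mean (cov c d)| <=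
    (a%:R * Crec + Ctr) * rho.
Proof.
move=> + + cD dD; have r0 : 0 <= rho := rho_ge0.
elim: a b => [|a IH] [|b] aD bD.
- rewrite (@eq_mean _ _ _ (cov c d)) => [|w]; last by rewrite cov00 // mul1r.
  by rewrite mul1r subrr normr0 mulr_ge0 // mul0r add0r Ctr_ge0.
- rewrite (@eq_mean _ _ _ (fun w => cov b.+1 0 w * cov c d w)) => [|w]; last by rewrite covC.
  by rewrite mul0r subr0 mul0r add0r cov_Sn0.
- rewrite mul0r subr0; apply: le_trans (cov_Sn0 _ _ _) _ => //.
  by rewrite ler_wpM2r // lerDr mulr_ge0 ?Crec_ge0.
have H := cov_rec aD bD cD dD; have := IH b (ltnW aD) (ltnW bD).
rewrite eqSS; set X := mean (fun w => cov a.+1 _ _ * _) in H *.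
set Y := mean _ in H *; set Z := _ * _ => H2.
rewrite (_ : X - Z = (X - Y) + (Y - Z)); last by ring.
apply: le_trans (ler_normD _ _) _; apply: le_trans (lerD H H2) _.
by rewrite -/Crec -[a.+1%:R]natr1 le_eqVlt; apply/orP; left; apply/eqP; ring.
Qed.

Definition Ccov := 4 * (D%:R * Crec + Ctr).

Lemma Ccov_ge0 : 0 <= Ccov.
Proof. by rewrite mulr_ge0 // addr_ge0 ?Ctr_ge0 // mulr_ge0 ?Crec_ge0. Qed.

(** [cov_delta] is used twice: against [cov a b] itself for the second moment, and against
    [cov 0 0 = 1] for the mean. With [delta] the limit, the square is [(E c^2 - delta * E c) - delta
    * (E c - delta)], two terms of controlled size. *)
Lemma cov_L2 a b : (a <= D)%N -> (b <= D)%N ->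
  mean (fun w => (cov a b w - (a == b)%:R) ^+ 2) <= Ccov * rho.
Proof.
move=> aD bD; have r0 : 0 <= rho := rho_ge0.
have aDC : (a%:R * Crec + Ctr) * rho <= (D%:R * Crec + Ctr) * rho.
  by rewrite ler_wpM2r // lerD2r ler_wpM2r ?Crec_ge0 // ler_nat.
have H1 := le_trans (cov_delta aD bD aD bD) aDC.
have := le_trans (cov_delta aD bD (leq0n D) (leq0n D)) aDC.
rewrite (@eq_mean _ _ _ (cov a b)) => [|w]; last by rewrite cov00 // mulr1.
rewrite (@eq_mean _ _ (cov 0 0) (fun=> 1)) => [|w]; last by rewrite cov00.
rewrite mean_cst ?cube_gt0 // mulr1 => H2; rewrite /Ccov.
have -> : mean (fun w => (cov a b w - (a == b)%:R) ^+ 2) =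
   mean (fun w => cov a b w * cov a b w) - 2 * (a == b)%:R * mean (cov a b) + (a == b)%:R ^+ 2.
  rewrite -[X in _ + X](mean_cst (@cube_gt0 n)) -meanZ -meanB -meanD.
  by apply: eq_mean => w; ring.
have := le_trans (normr_ge0 _) H1; rewrite -[4 * _ * _]mulrA.
move: H1 H2; set c := _ * rho; case: (a == b); rewrite /= ?mul1r ?mul0r ?mulr0 ?mulr1 ?mul0r;
  rewrite !ler_norml => /andP [_ H1] /andP [H2 _] c0; lra.
Qed.

(** The step at which the rate drops from [rho] to its square root. *)
Lemma cov_L1 a b : (a <= D)%N -> (b <= D)%N ->
  mean (fun w => `|cov a b w - (a == b)%:R|) <= Num.sqrt (Ccov * rho).
Proof.
move=> aD bD; rewrite -[leLHS]ger0_norm; last by apply: mean_ge0.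
have C0 : 0 <= Ccov * rho by apply: mulr_ge0; [exact: Ccov_ge0|exact: rho_ge0].
by rewrite -sqrtr_sqr ler_sqrt //; apply: le_trans (mean_norm_sqr (@cube_gt0 n) _) (cov_L2 aD bD).
Qed.

End Covariances.

(** * The Stein discrepancy of the traces *)

Lemma bd_le {R : rcfType} {T : finType} (K : nat -> R) (c : R) (y z : T -> R) :
  (forall w, `|z w| <= `|y w|) -> bd K c y -> bd K c z.
Proof.
move=> zy [K1 c0 H]; split=> // p; apply: le_trans (H p).
by apply: ler_mean => w; rewrite lerXn2r ?nnegrE.
Qed.

Lemma collect_errors {R : rcfType} (a b c s r t x y : R) :
  a * r <= a * t -> b * r <= b * t -> c * r <= c * t ->
  2 * a * r + 2 * (x * (s * t)) + 2 * a * r + 2 * b * r + y * x * (s * t) +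
  2 * c * r <= (4 * a + 2 * b + 2 * c + (2 * x + y * x) * s) * t.
Proof. by move=> HA HB HC; lra. Qed.

Section Main.
Context {R : rcfType} {n : nat}.
Variables (d D : nat) (q : 'I_d -> nat).
Hypothesis n_gt0 : (0 < n)%N.
Hypothesis q_gt0 : forall i, (0 < q i)%N.
Hypothesis q_inj : injective q.
Hypothesis q_le : forall i, (q i <= D)%N.
Local Notation cube := (cube n).
Local Notation rho := (inv_sqrtn R n).
Local Notation Kdeg := (@Kdeg R D).
Local Notation Kpow := (@Kpow R D).
Local Notation cov := (@overlap R n).
Implicit Types (w : cube) (x y z s t : 'I_n) (g h phi : cube -> R).

Definition trv w : 'rV[R]_d := \row_i (trpow (q i) w - mean (@trpow R n (q i))).

Lemma edgeD_trv x y j w : edgeD x y (fun w => trv w 0 j) w = edgeD x y (trpow (q j)) w.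
Proof. by rewrite /edgeD /trv !mxE; congr (_ * _ / _); ring. Qed.

(* The second-order part of [edgeD x y (trpow r)], coming from the flipped entry
   occurring at least twice in a closed walk. *)
Definition trrem x y r w : R := 2 * sgn w x y * (rho * \sum_(k < r) \sum_(l < k)
    mpow (r.-1 - k + l) w y x * mpow (k.-1 - l) (flip x y w) y x).

Lemma bd_trrem x y r : (r <= D)%N ->
  bd (Kpow 1) (2 * D%:R ^+ 2 * rho * (eta y x * eta y x)) (trrem x y r).
Proof.
move=> rD.
apply: bd_le (_ : bd _ _ (fun w => (2 * rho) * \sum_(k < r) \sum_(l < k)
    mpow (r.-1 - k + l) w y x * mpow (k.-1 - l) (flip x y w) y x)) => [w|].
  by rewrite /trrem !normrM normr_sgn mulr1 mulrA.
have r0 : 0 <= rho := rho_ge0.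
apply: (@bd_scale _ _ _ (`|2 * rho| * (#|'I_r|%:R * (D%:R * (eta y x * eta y x))))).
  rewrite card_ord ger0_norm ?mulr_ge0 //.
  rewrite [leRHS](_ : _ = 2 * rho * (D%:R * (D%:R * (eta y x * eta y x)))); last by ring.
  by rewrite ler_wpM2l ?mulr_ge0 // ler_wpM2r ?mulr_ge0 ?eta_ge0 // ler_nat.
apply/bdZ/bd_sumI => [p|k]; first exact: (@Kpow_ge1 R D 1).
apply: (@bd_scale _ _ _ (#|'I_k|%:R * (eta y x * eta y x))).
  rewrite card_ord ler_wpM2r ?mulr_ge0 ?eta_ge0 // ler_nat.
  by have := ltn_ord k; lia.
apply: bd_sumI => [p|l]; first exact: (@Kpow_ge1 R D 1).
have := ltn_ord k; have := ltn_ord l => lk kr.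
apply: bdM; first by apply: bd_deg; lia.
by apply: (bd_flip x y (bd_deg y x _)); lia.
Qed.

Definition Ktr p := Kdeg p + Kpow 1 p.

Lemma Ktr_ge1 p : 1 <= Ktr p.
Proof.
rewrite /Ktr (le_trans (Kdeg_ge1 D p)) // lerDl (le_trans ler01) //.
exact: (@Kpow_ge1 R D 1).
Qed.

Definition Dtr : R := D%:R + 2 * D%:R ^+ 2.

Lemma Dtr_ge0 : 0 <= Dtr.
Proof. by rewrite addr_ge0 // mulr_ge0 // sqr_ge0. Qed.

Lemma bd_edgeD_trpow x y r : (r <= D)%N ->
  bd Ktr (Dtr * rho * eta y x) (edgeD x y (trpow r)).
Proof.
move=> rD; have r0 : 0 <= rho := rho_ge0.
apply: bd_ext (fun w => esym (edgeD_trpow n_gt0 x y r w)) _.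
apply: (@bd_scale _ _ _ (`|rho| * (`|r%:R| * eta y x) +
   `|rho| * (2 * D%:R ^+ 2 * rho * (eta y x * eta y x)))).
  rewrite /Dtr !ger0_norm //.
  rewrite [leRHS](_ : _ = D%:R * rho * eta y x + 2 * D%:R ^+ 2 * rho * eta y x); last by ring.
  apply: lerD.
    rewrite mulrA [rho * _]mulrC ler_wpM2r ?eta_ge0 // ler_wpM2r // ler_nat //.
  rewrite [leLHS](_ : _ = (2 * D%:R ^+ 2 * rho * eta y x) * (rho * eta y x)); last by ring.
  rewrite ler_piMr ?mulr_ge0 ?sqr_ge0 ?eta_ge0 //.
  by rewrite mulr_ile1 ?eta_ge0 ?rho_le1 ?eta_le1.
apply: (bdD cube_gt0).
  have rD1 : (r.-1 <= D)%N by lia.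
  apply: (bdW _ (lexx _) (bdZ _ (bdZ _ (bd_deg y x rD1)))) => p.
  by rewrite lerDl (le_trans ler01) // (@Kpow_ge1 R D 1).
apply: bdN; apply: (bdW _ (lexx _) (bdZ _ (bd_trrem x y rD))) => p.
by rewrite lerDr (le_trans ler01) // Kdeg_ge1.
Qed.

(** Every remainder of the discrepancy is brought to this shape: the squares of [eta] sum to at most
    [2 * n], and [rho^2 * n = 1] leaves one factor [rho]. *)
Lemma sum_errors (c : R) (r : 'I_n -> 'I_n -> R) : 0 <= c ->
  (forall x y, `|r x y| <= c * rho ^+ 2 * (eta y x * eta y x)) ->
  `|rho * \sum_x \sum_y r x y| <= 2 * c * rho.
Proof.
move=> c0 H; have r0 : 0 <= rho := rho_ge0.
rewrite normrM ger0_norm //.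
have H2 : `|\sum_x \sum_y r x y| <= c * rho ^+ 2 * (2 * n%:R).
  apply: le_trans (_ : _ <= c * rho ^+ 2 * \sum_(x < n) \sum_(y < n) eta y x * eta y x) _.
    rewrite mulr_sumr; apply: le_trans (ler_norm_sum _ _ _) (ler_sum _ _) => x _.
    by rewrite mulr_sumr; apply: le_trans (ler_norm_sum _ _ _) (ler_sum _ _) => y _.
  by rewrite ler_wpM2l ?mulr_ge0 ?sqr_ge0 // exchange_big sum_sum_eta2.
apply: le_trans (ler_wpM2l r0 H2) _.
rewrite [leLHS](_ : _ = 2 * c * rho * (rho ^+ 2 * n%:R)); last by ring.
by rewrite rho2n // mulr1.
Qed.

Section Fixed.
Variables (phi : cube -> R).
Hypothesis phi_le1 : forall w, `|phi w| <= 1.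
Variable Q : nat.
Hypothesis Q_le : (Q.+1 <= D)%N.

(** The leading part of the summed derivatives of [mpow Q w y x]. It concentrates on the number of
    [k < Q] with [k = Q - 1 - k], that is [1] for odd [Q] and [0] for even [Q]. *)
Definition trdiag w : R := \sum_(k < Q) cov k (Q.-1 - k) w.

Definition CtermA : R := Kpow 2 1 * (2 * D%:R ^+ 2).

(** Unflipping the left factor in [edgeD_mpow] costs [rem]; what remains sums exactly to [trdiag].
    The function [phi] is arbitrary so that the case [phi = 1] also computes the mean of the
    trace. *)
Lemma mean_edgeD_mpow_phi :
  `|rho * \sum_x \sum_y mean (fun w => edgeD x y (fun w => mpow Q w y x) w * phi w)
    - mean (fun w => trdiag w * phi w)| <= 2 * CtermA * rho.
Proof.
have r0 : 0 <= rho := rho_ge0.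
pose rem x y w : R := 2 * rho *  \sum_(k < Q)
   edgeD x y (fun w => mpow k w y x) w * mpow (Q.-1 - k) w y x.
have E x y w : edgeD x y (fun w => mpow Q w y x) w * phi w =
   rho * (\sum_(k < Q) mpow k w y x * mpow (Q.-1 - k) w y x) * phi w
   - sgn w x y * rem x y w * phi w.
  rewrite -mulrBl edgeD_mpow /rem; congr (_ * _).
  rewrite mulrCA -mulrA mulrA [2 * _]mulrC -mulrA -mulrBr; congr (_ * _).
  rewrite mulr_sumr mulr_sumr -sumrB; apply: eq_bigr => k _.
  by rewrite (edgeD_subr x y (fun w => mpow k w y x)); ring.
have -> : mean (fun w => trdiag w * phi w) = rho * \sum_x \sum_y mean (fun w =>
    rho * (\sum_(k < Q) mpow k w y x * mpow (Q.-1 - k) w y x) * phi w).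
  rewrite (@eq_mean _ _ _ (fun w => rho * \sum_x \sum_y
      rho * (\sum_(k < Q) mpow k w y x * mpow (Q.-1 - k) w y x) * phi w)).
    rewrite meanZ mean_sum; congr (_ * _); apply: eq_bigr => x _.
    by rewrite mean_sum.
  move=> w; rewrite /trdiag.
  under [in RHS]eq_bigr do rewrite -mulr_suml -mulr_sumr.
  rewrite -mulr_suml -mulr_sumr mulrA mulrA; congr (_ * _).
  rewrite /overlap -mulr_sumr expr2; congr (_ * _).
  rewrite exchange_big /=; rewrite [RHS]exchange_big /=; apply: eq_bigr => x _.
  by rewrite exchange_big.
rewrite -mulrBr -sumrB.
under eq_bigr do rewrite -sumrB.
apply: sum_errors => [|x y].
  apply: mulr_ge0; first exact: le_trans ler01 (Kpow_ge1 D 2 1).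
  by apply: mulr_ge0; rewrite ?sqr_ge0.
rewrite -meanB (@eq_mean _ _ _ (fun w => - (sgn w x y * rem x y w * phi w))); last first.
  by move=> w; rewrite E; ring.
rewrite meanN normrN; apply: le_trans (ler_norm_mean _) _.
apply: le_trans (_ : _ <= mean (fun w => `|rem x y w|)) _.
  by apply: ler_mean => w; rewrite normrM [X in X * _]normrM normr_sgn mul1r ler_piMr.
rewrite /CtermA -[Kpow 2 1 * _ * _]mulrA -[leRHS]mulrA; apply: bd_mean.
apply: (@bd_scale _ _ _ (`|2 * rho| * (#|'I_Q|%:R * (D%:R * rho * (eta y x * eta y x) * eta y x)))).
  rewrite card_ord ger0_norm ?mulr_ge0 //.
  rewrite [leRHS](_ : _ = 2 * rho * (D%:R * (D%:R * rho * (eta y x * eta y x)))); last by ring.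
  rewrite ler_wpM2l ?mulr_ge0 //; apply: ler_pM; rewrite ?mulr_ge0 ?eta_ge0 ?ler_nat //.
    by lia.
  by rewrite ler_piMr ?mulr_ge0 ?eta_ge0 ?eta_le1.
apply/bdZ/bd_sumI => [p|k]; first exact: (@Kpow_ge1 R D 2).
have := ltn_ord k => kQ.
apply: bdM; last by apply: bd_deg; lia.
by apply: bd_edgeD_mpow; lia.
Qed.

End Fixed.

Section Test.
Variables (f : 'rV[R]_d -> R) (fd : 'I_d -> 'rV[R]_d -> R).
Hypothesis f_le1 : forall u, `|f u| <= 1.
Hypothesis fd_le1 : forall j u, `|fd j u| <= 1.
Hypothesis f_lip : forall u v, `|f u - f v| <= \sum_j `|u 0 j - v 0 j|.
Hypothesis f_taylor : forall u v,
  `|f u - f v - \sum_j (u 0 j - v 0 j) * fd j v| <= (\sum_j `|u 0 j - v 0 j|) ^+ 2.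

Local Notation phi := (fun w => f (trv w)).

Definition sumD x y w : R := \sum_j `|edgeD x y (trpow (q j)) w|.

Lemma sumD_ge0 x y w : 0 <= sumD x y w.
Proof. exact: sumr_ge0. Qed.

Lemma bd_sumD x y : bd Ktr (d%:R * (Dtr * rho * eta y x)) (sumD x y).
Proof.
have := @bd_sumI R n Ktr 'I_d (Dtr * rho * eta y x)
  (fun j w => `|edgeD x y (trpow (q j)) w|) Ktr_ge1.
rewrite card_ord; apply => j.
apply: bd_le (bd_edgeD_trpow x y (q_le j)) => w.
by rewrite normr_id.
Qed.

Lemma trv_diff x y w j : trv w 0 j - trv (flip x y w) 0 j =
  2 * sgn w x y * edgeD x y (trpow (q j)) w.
Proof. by rewrite -edgeD_trv -(edgeD_sub x y (fun w => trv w 0 j)). Qed.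

Lemma sum_trv_diff x y w :
  \sum_j `|trv w 0 j - trv (flip x y w) 0 j| = 2 * sumD x y w.
Proof.
rewrite /sumD mulr_sumr; apply: eq_bigr => j _.
by rewrite trv_diff !normrM normr_sgn mulr1 ger0_norm.
Qed.

Lemma edgeD_phi_le x y w : `|edgeD x y phi w| <= sumD x y w.
Proof.
have := f_lip (trv w) (trv (flip x y w)); rewrite sum_trv_diff.
by rewrite (edgeD_sub x y phi) !normrM normr_sgn mulr1 ger0_norm // ler_pM2l.
Qed.

Lemma edgeD_phi_taylor x y w :
  `|edgeD x y phi w - \sum_j edgeD x y (trpow (q j)) w * fd j (trv w)| <=
  2 * sumD x y w ^+ 2.
Proof.
have := f_taylor (trv (flip x y w)) (trv w).
have -> : \sum_j `|trv (flip x y w) 0 j - trv w 0 j| = 2 * sumD x y w.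
  by rewrite -sum_trv_diff; apply: eq_bigr => j _; rewrite distrC.
have -> : \sum_j (trv (flip x y w) 0 j - trv w 0 j) * fd j (trv w) =
   - (2 * sgn w x y * \sum_j edgeD x y (trpow (q j)) w * fd j (trv w)).
  rewrite mulr_sumr -sumrN; apply: eq_bigr => j _.
  by rewrite -opprB trv_diff; ring.
rewrite -[f _ - f _]opprB (edgeD_sub x y phi) -opprD -mulrBr normrN !normrM normr_sgn.
by rewrite mulr1 ger0_norm //; lra.
Qed.

Variable Q : nat.
Hypothesis Q_le : (Q.+1 <= D)%N.

Definition CtermB : R := prodK Kdeg (prodK Ktr Ktr) 1 * (2 * (d%:R * Dtr) ^+ 2) +
   prodK Kdeg (Kpow 1) 1 * (2 * d%:R * D%:R ^+ 2).

Lemma prodK_ge0 (K L : nat -> R) : (forall p, 1 <= K p) -> (forall p, 1 <= L p) ->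
  forall p, 0 <= prodK K L p.
Proof. by move=> K1 L1 p; rewrite /prodK mulr_ge0 // (le_trans ler01). Qed.

Lemma prodK_ge1 (K L : nat -> R) : (forall p, 1 <= K p) -> (forall p, 1 <= L p) ->
  forall p, 1 <= prodK K L p.
Proof. by move=> K1 L1 p; rewrite /prodK mulr_ege1. Qed.

Lemma CtermB_ge0 : 0 <= CtermB.
Proof.
apply: addr_ge0; apply: mulr_ge0.
- apply: prodK_ge0; first exact: Kdeg_ge1.
  by apply: prodK_ge1; exact: Ktr_ge1.
- by apply: mulr_ge0; rewrite ?sqr_ge0.
- by apply: prodK_ge0; [exact: Kdeg_ge1|exact: (@Kpow_ge1 R D 1)].
- by apply: mulr_ge0; rewrite ?sqr_ge0 // mulr_ge0.
Qed.

(** By Taylor's formula the derivative of [phi] is a combination of the derivatives of the traces,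
    whose leading parts [rho * q_j * mpow (q j).-1 w y x] pair with [mpow Q w y x] into overlaps.
    The two summands of [CtermB] bound the Taylor error [remT] and the second-order part [remE] of
    the traces. *)
Lemma mean_mpow_edgeD_phi :
  `|rho * \sum_x \sum_y mean (fun w => mpow Q w y x * edgeD x y phi w)
    - \sum_j (q j)%:R * mean (fun w => cov Q (q j).-1 w * fd j (trv w))|
  <= 2 * CtermB * rho.
Proof.
have r0 : 0 <= rho := rho_ge0.
pose remT x y w := mpow Q w y x *
  (edgeD x y phi w - \sum_j edgeD x y (trpow (q j)) w * fd j (trv w)).
pose remE x y w := rho * \sum_j mpow Q w y x * trrem x y (q j) w * fd j (trv w).
have E x y w : mpow Q w y x * edgeD x y phi w =
    (\sum_j rho * (q j)%:R * (mpow Q w y x * mpow (q j).-1 w y x) * fd j (trv w)) +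
    (remT x y w - remE x y w).
  have -> : remE x y w = \sum_j rho * (q j)%:R *
        (mpow Q w y x * mpow (q j).-1 w y x) * fd j (trv w) -
      mpow Q w y x * \sum_j edgeD x y (trpow (q j)) w * fd j (trv w).
    rewrite /remE !mulr_sumr -sumrB; apply: eq_bigr => j _.
    by rewrite edgeD_trpow // -/(trrem x y (q j) w); ring.
  by rewrite /remT; ring.
have -> : \sum_j (q j)%:R * mean (fun w => cov Q (q j).-1 w * fd j (trv w)) =
    rho * \sum_x \sum_y mean (fun w =>
    \sum_j rho * (q j)%:R * (mpow Q w y x * mpow (q j).-1 w y x) * fd j (trv w)).
  under eq_bigr do rewrite -meanZ.
  rewrite -mean_sum (@eq_mean _ _ _ (fun w => rho * \sum_x \sum_y \sum_j
      rho * (q j)%:R * (mpow Q w y x * mpow (q j).-1 w y x) * fd j (trv w))).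
    rewrite meanZ mean_sum; congr (_ * _); apply: eq_bigr => x _.
    by rewrite mean_sum.
  move=> w; under [in RHS]eq_bigr do rewrite exchange_big /=.
  rewrite [in RHS]exchange_big /= mulr_sumr; apply: eq_bigr => j _.
  under [in RHS]eq_bigr do rewrite -mulr_suml -mulr_sumr.
  rewrite -mulr_suml -mulr_sumr /overlap [in RHS]exchange_big /=.
  by ring.
rewrite -mulrBr -sumrB; under eq_bigr do rewrite -sumrB.
apply: sum_errors => [|x y]; first exact: CtermB_ge0.
rewrite -meanB (@eq_mean _ _ _ (fun w => remT x y w - remE x y w)); last first.
  by move=> w; rewrite E addrC addKr.
apply: le_trans (ler_norm_mean _) _.
apply: le_trans (ler_mean (fun w => ler_normB _ _)) _.
rewrite meanD /CtermB -[leRHS]mulrA mulrDl; apply: lerD; rewrite -mulrA.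
  apply: le_trans (_ : _ <= mean (fun w =>
      `|mpow Q w y x * (sumD x y w * (2 * sumD x y w))|)) _.
    apply: ler_mean => w; rewrite /remT !normrM ler_wpM2l //.
    apply: le_trans (edgeD_phi_taylor x y w) _.
    by rewrite !ger0_norm ?sumD_ge0 // le_eqVlt; apply/orP; left; apply/eqP; ring.
  apply: bd_mean; apply: (@bd_scale _ _ _ (eta y x * (d%:R * (Dtr * rho * eta y x) *
     (`|2| * (d%:R * (Dtr * rho * eta y x)))))).
    rewrite ger0_norm //.
    rewrite [leLHS](_ : _ = (2 * (d%:R * Dtr) ^+ 2 * (rho ^+ 2 * (eta y x * eta y x))) *
      eta y x); last by ring.
    rewrite ler_piMr ?eta_le1 //.
    by apply: mulr_ge0; apply: mulr_ge0; rewrite ?sqr_ge0 // mulr_ge0 ?eta_ge0.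
  apply: bdM; first by apply: bd_deg; lia.
  by apply: bdM; [exact: bd_sumD|apply/bdZ/bd_sumD].
apply: le_trans (_ : _ <= mean (fun w =>
    `|rho * \sum_j `|mpow Q w y x * trrem x y (q j) w| |)) _.
  apply: ler_mean => w; rewrite /remE !normrM ler_wpM2l //.
  rewrite [leRHS]ger0_norm ?sumr_ge0 //.
  apply: le_trans (ler_norm_sum _ _ _) (ler_sum _ _) => j _.
  by rewrite normrM ler_piMr.
apply: bd_mean; apply: (@bd_scale _ _ _ (`|rho| * (#|'I_d|%:R * (eta y x *
     (2 * D%:R ^+ 2 * rho * (eta y x * eta y x)))))).
  rewrite ger0_norm // card_ord.
  rewrite [leLHS](_ : _ = (2 * d%:R * D%:R ^+ 2 * (rho ^+ 2 * (eta y x * eta y x))) *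
      eta y x); last by ring.
  rewrite ler_piMr ?eta_le1 //.
  by apply: mulr_ge0; apply: mulr_ge0; rewrite ?sqr_ge0 // mulr_ge0 ?eta_ge0.
apply/bdZ/bd_sumI => [p|j].
  by apply: prodK_ge1; [exact: Kdeg_ge1|exact: (@Kpow_ge1 R D 1)].
apply: (bd_le (y := fun w => mpow Q w y x * trrem x y (q j) w)) => [w|].
  by rewrite normr_id.
by apply: bdM; [apply: bd_deg; lia|exact: bd_trrem].
Qed.

Definition CtermC : R := prodK (Kpow 1) Ktr 1 * (2 * D%:R * d%:R * Dtr).

Lemma CtermC_ge0 : 0 <= CtermC.
Proof.
apply: mulr_ge0; first by apply: prodK_ge0; [exact: (@Kpow_ge1 R D 1)|exact: Ktr_ge1].
by rewrite mulr_ge0 ?Dtr_ge0 // mulr_ge0 // mulr_ge0.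
Qed.

(** The second-order term of the product rule. Each of the two derivatives has its own factor [rho],
    so the Lipschitz bound on [f] is enough here. *)
Lemma mean_edgeD_edgeD_phi :
  `|rho * \sum_x \sum_y mean (fun w => 2 * sgn w x y *
      edgeD x y (fun w => mpow Q w y x) w * edgeD x y phi w)|
  <= 2 * CtermC * rho.
Proof.
have r0 : 0 <= rho := rho_ge0.
apply: sum_errors => [|x y]; first exact: CtermC_ge0.
apply: le_trans (ler_norm_mean _) _.
apply: le_trans (_ : _ <= mean (fun w => `|2 *
  (edgeD x y (fun w => mpow Q w y x) w * sumD x y w)|)) _.
  apply: ler_mean => w; have := edgeD_phi_le x y w.
  move: (edgeD x y phi w) (edgeD x y (fun w => mpow Q w y x) w) => v u vS.
  rewrite -!mulrA normrM [in leRHS]normrM ler_wpM2l //.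
  rewrite normrM normr_sgn mul1r !normrM ler_wpM2l //.
  by rewrite [leRHS]ger0_norm ?sumD_ge0.
rewrite /CtermC -[leRHS]mulrA -[leRHS]mulrA; apply: bd_mean.
apply: (@bd_scale _ _ _ (`|2| * (D%:R * rho * (eta y x * eta y x) *
   (d%:R * (Dtr * rho * eta y x))))).
  rewrite ger0_norm //.
  rewrite [leLHS](_ : _ = (2 * D%:R * d%:R * Dtr * (rho ^+ 2 * (eta y x * eta y x))) *
      eta y x); last by ring.
  rewrite ler_piMr ?eta_le1 //.
  apply: mulr_ge0; rewrite ?mulr_ge0 ?Dtr_ge0 ?eta_ge0 ?sqr_ge0 //.
by apply/bdZ/bdM; [apply: bd_edgeD_mpow; lia|exact: bd_sumD].
Qed.

Lemma mean_trpow_phi (g : cube -> R) : mean (fun w => trpow Q.+1 w * g w) =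
  rho * \sum_x \sum_y mean (fun w => edgeD x y (fun w => mpow Q w y x) w * g w) +
  rho * \sum_x \sum_y mean (fun w => mpow Q w y x * edgeD x y g w) -
  rho * \sum_x \sum_y mean (fun w => 2 * sgn w x y *
      edgeD x y (fun w => mpow Q w y x) w * edgeD x y g w).
Proof.
rewrite -mulrDr -mulrBr -big_split /= -sumrB.
under [in RHS]eq_bigr do rewrite -big_split /= -sumrB.
under [in RHS]eq_bigr do under eq_bigr do rewrite -meanD -meanB.
have E w : trpow Q.+1 w * g w =
    rho * \sum_x \sum_y sgn w x y * (mpow Q w y x * g w).
  rewrite trpowS mulr_suml mulr_sumr; apply: eq_bigr => x _.
  rewrite mulr_suml mulr_sumr; apply: eq_bigr => y _; ring.
rewrite (eq_mean E) meanZ mean_sum; congr (_ * _); apply: eq_bigr => x _.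
rewrite mean_sum; apply: eq_bigr => y _; rewrite mean_edgeD.
by apply: eq_mean => w; rewrite edgeDMl.
Qed.

Local Notation Ccov := (@Ccov R D).

Definition Cstein : R := 4 * CtermA + 2 * CtermB + 2 * CtermC +
  (2 * D%:R + d%:R * D%:R) * Num.sqrt Ccov.

Lemma trdiag_L1 : mean (fun w => `|trdiag Q w - \sum_(k < Q) (k == Q.-1 - k :> nat)%N%:R|) <=
  D%:R * Num.sqrt (Ccov * rho).
Proof.
apply: le_trans (_ : _ <= mean (fun w =>
    \sum_(k < Q) `|cov k (Q.-1 - k) w - (k == Q.-1 - k :> nat)%N%:R|)) _.
  by apply: ler_mean => w; rewrite /trdiag -sumrB ler_norm_sum.
rewrite mean_sum.
apply: le_trans (_ : _ <= \sum_(k < Q) Num.sqrt (Ccov * rho)) _.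
  by apply: ler_sum => k _; apply: cov_L1 => //; have := ltn_ord k; lia.
rewrite sumr_const card_ord -[leLHS]mulr_natl ler_wpM2r ?sqrtr_ge0 // ler_nat.
exact: ltnW.
Qed.

(** After integration by parts, the part [XA] is close to [c0 * E phi] and the mean of the trace is
    close to [c0], so the centring cancels it. The part [XB] is close to [q_i * E (fd i)], and [XC]
    is small. *)
Lemma mean_trv_phi i : q i = Q.+1 ->
  `|mean (fun w => trv w 0 i * phi w) - (q i)%:R * mean (fun w => fd i (trv w))| <=
  Cstein * Num.sqrt rho.
Proof.
move=> qi; have r0 : 0 <= rho := rho_ge0.
set sr := Num.sqrt rho.
have rsr : rho <= sr.
  by rewrite -[leLHS](sqr_sqrtr r0) expr2 ler_piMr ?sqrtr_ge0 // -[leRHS]sqrtr1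
    ler_sqrt // rho_le1.
pose c0 : R := \sum_(k < Q) (k == Q.-1 - k :> nat)%N%:R.
have C0 := Ccov_ge0 (R := R) D.
have trE : mean (fun w => trv w 0 i * phi w) =
    mean (fun w => trpow Q.+1 w * phi w) - mean (@trpow R n Q.+1) * mean phi.
  by rewrite -meanZ -meanB; apply: eq_mean => w; rewrite /trv mxE qi; ring.
have one w : `|1 : R| <= 1 by rewrite normr1.
(* The constant test function gives the mean of the trace, [A2] the same estimate weighted by
   [phi]. *)
have A1 := mean_edgeD_mpow_phi (phi := fun=> 1) (fun=> one [ffun=> true]) Q_le.
have A2 := mean_edgeD_mpow_phi (phi := phi) (fun w => f_le1 _) Q_le.
have B := mean_mpow_edgeD_phi; have C := mean_edgeD_edgeD_phi.
have M1 : mean (@trpow R n Q.+1) =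
    rho * \sum_x \sum_y mean (fun w => edgeD x y (fun w => mpow Q w y x) w * 1).
  rewrite (@eq_mean _ _ (trpow Q.+1) (fun w => trpow Q.+1 w * 1)); last first.
    by move=> w; rewrite mulr1.
  rewrite mean_trpow_phi.
  have D0 x y w : edgeD x y (fun=> 1) w = 0 :> R by rewrite /edgeD subrr mulr0 mul0r.
  rewrite [X in _ + X - _](_ : _ = 0) ?[X in _ - X](_ : _ = 0) ?addr0 ?subr0 //.
    rewrite big1 ?mulr0 // => x _; rewrite big1 // => y _.
    rewrite -[RHS](mean_cst (@cube_gt0 n)); apply: eq_mean => w.
    by rewrite D0 mulr0.
  rewrite big1 ?mulr0 // => x _; rewrite big1 // => y _.
  rewrite -[RHS](mean_cst (@cube_gt0 n)); apply: eq_mean => w.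
  by rewrite D0 mulr0.
have Md : mean (fun w => trdiag Q w * 1) = mean (trdiag Q).
  by apply: eq_mean => w; rewrite mulr1.
rewrite -M1 Md in A1.
rewrite trE mean_trpow_phi.
set XA := rho * _ in A2 *; set XB := rho * _ in B *; set XC := rho * _ in C *.
set YA := mean _ in A2; set YB := \sum_j _ in B.
set m1 := mean (trpow _) in A1 *; set t1 := mean (trdiag _) in A1.
set p1 := mean phi; set e1 := mean (fun w => fd i _).
have p1le : `|p1| <= 1.
  apply: le_trans (ler_norm_mean _) _; rewrite -[leRHS](mean_cst (@cube_gt0 n)).
  exact: ler_mean.
(* Subtracting [c0] from [trdiag] in both terms does not change their difference, and makes each of
   them small by [trdiag_L1]. *)
have K1 : `|YA - t1 * p1| <= 2 * (D%:R * Num.sqrt (Ccov * rho)).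
  have -> : YA - t1 * p1 = mean (fun w => (trdiag Q w - c0) * phi w) -
      mean (fun w => trdiag Q w - c0) * p1.
    have -> : mean (fun w => (trdiag Q w - c0) * phi w) = YA - c0 * p1.
      by rewrite -meanZ -meanB; apply: eq_mean => w; ring.
    have -> : mean (fun w => trdiag Q w - c0) = t1 - c0.
      by rewrite -[in RHS](mean_cst (@cube_gt0 n) c0) -meanB.
    by ring.
  rewrite mulr2n mulrDl mul1r; apply: le_trans (ler_normB _ _) (lerD _ _).
    apply: le_trans (ler_norm_mean _) _; apply: le_trans trdiag_L1.
    by apply: ler_mean => w; rewrite normrM ler_piMr.
  rewrite normrM; apply: le_trans (ler_piMr _ p1le) _ => //.
  exact: le_trans (ler_norm_mean _) trdiag_L1.
have K2 : `|YB - (q i)%:R * e1| <= d%:R * D%:R * Num.sqrt (Ccov * rho).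
  have -> : YB - (q i)%:R * e1 =
     \sum_j (q j)%:R * mean (fun w => (cov Q (q j).-1 w - (Q == (q j).-1)%:R) * fd j (trv w)).
    (* Distinct exponents: [j = i] is the only index for which the limit of the overlap of [Q] with
       [(q j).-1] is not [0]. *)
    have -> : (q i)%:R * e1 = \sum_j (q j)%:R * ((Q == (q j).-1)%:R * mean (fun w => fd j (trv w))).
      rewrite (bigD1 i) //= qi eqxx mul1r big1 ?addr0 // => j ji.
      case: eqP => [E|_]; last by rewrite mul0r mulr0.
      have /q_inj ij : q i = q j by rewrite qi E prednK.
      by rewrite ij eqxx in ji.
    rewrite /YB -sumrB; apply: eq_bigr => j _; rewrite -mulrBr; congr (_ * _).
    by rewrite -meanZ -meanB; apply: eq_mean => w; rewrite mulrBl.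
  apply: le_trans (ler_norm_sum _ _ _) _.
  apply: le_trans (_ : _ <= \sum_(j < d) D%:R * Num.sqrt (Ccov * rho)) _; last first.
    by rewrite sumr_const card_ord -[leLHS]mulr_natl mulrA.
  apply: ler_sum => j _; rewrite normrM ger0_norm //.
  apply: ler_pM => //; first by rewrite ler_nat.
  have jD : ((q j).-1 <= D)%N by apply: leq_trans (leq_pred _) (q_le j).
  apply: le_trans (cov_L1 n_gt0 (ltnW Q_le) jD).
  apply: le_trans (ler_norm_mean _) _.
  by apply: ler_mean => w; rewrite normrM ler_piMr.
rewrite [Num.sqrt _]sqrtrM // -/sr in K1 K2.
have m1p : `|(m1 - t1) * p1| <= 2 * CtermA * rho.
  by rewrite normrM; apply: le_trans (ler_piMr _ p1le) A1.
have -> : XA + XB - XC - m1 * p1 - (q i)%:R * e1 = (XA - YA) + (YA - t1 * p1) -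
    (m1 - t1) * p1 + (XB - YB) + (YB - (q i)%:R * e1) - XC by ring.
apply: le_trans (ler_normB _ _) _.
apply: le_trans (lerD (le_trans (ler_normD _ _) (lerD (le_trans (ler_normD _ _) (lerD
  (le_trans (ler_normB _ _) (lerD (le_trans (ler_normD _ _) (lerD A2 K1)) m1p)) B)) K2)) C) _.
have CA0 : 0 <= CtermA.
  apply: mulr_ge0; first exact: le_trans ler01 (Kpow_ge1 D 2 1).
  by apply: mulr_ge0; rewrite ?sqr_ge0.
have HA := ler_wpM2l CA0 rsr; have HB := ler_wpM2l CtermB_ge0 rsr.
have HC := ler_wpM2l CtermC_ge0 rsr; rewrite /Cstein.
exact: collect_errors.
Qed.

End Test.

End Main.

(* Opened only now because [[set x | P x]] denotes a finite set above. *)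
Local Open Scope classical_set_scope.
Local Open Scope ring_scope.

(** * Taylor estimates for test functions *)

Section RealLine.
Context {R : realType}.
Implicit Types (f df : R -> R) (x y : R).

Lemma mean_value f df x y : (forall z : R, is_derive z 1 f (df z)) ->
  exists2 c, `|c - x| <= `|y - x| & f y - f x = (y - x) * df c.
Proof.
move=> fdf.
have fc a b : {within `[a, b], continuous f}.
  apply: continuous_subspaceT => z; apply: differentiable_continuous.
  by apply/derivable1_diffP; have [] := fdf z.
have [xy|/ltW yx] := leP x y.
  have [c cxy ->] := MVT_segment xy (fun z _ => fdf z) (fc _ _).
  exists c; last by rewrite mulrC.
  move: cxy; rewrite in_itv /= => /andP [xc cy].
  by rewrite !ger0_norm ?subr_ge0 // lerD2r.
have [c cxy E] := MVT_segment yx (fun z _ => fdf z) (fc _ _).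
exists c; last by rewrite -opprB E; ring.
move: cxy; rewrite in_itv /= => /andP [xc cy].
by rewrite !ler0_norm ?subr_le0 // lerN2 lerD2r.
Qed.

Lemma quadratic_remainder f df x y : (forall z : R, is_derive z 1 f (df z)) ->
  (forall u v, `|df u - df v| <= `|u - v|) ->
  `|f y - f x - (y - x) * df x| <= (y - x) ^+ 2.
Proof.
move=> fdf lip; have [c cx ->] := mean_value x y fdf.
rewrite -mulrBr normrM -real_normK ?num_real // expr2 ler_wpM2l //.
exact: le_trans (lip _ _) cx.
Qed.

Lemma lipschitz_derive f df (M : R) x y : (forall z : R, is_derive z 1 f (df z)) ->
  (forall z, `|df z| <= M) -> `|f y - f x| <= M * `|y - x|.
Proof.
move=> fdf dfM; have [c _ ->] := mean_value x y fdf.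
by rewrite normrM mulrC ler_wpM2r.
Qed.

Lemma sin_quadratic x y : `|sin y - sin x - (y - x) * cos x| <= (y - x) ^+ 2.
Proof.
apply: quadratic_remainder => u v.
rewrite -[leRHS]mul1r; apply: (lipschitz_derive (df := fun x => - sin x)) => z.
by rewrite normrN ler_norml sin_geN1 sin_le1.
Qed.

Lemma cos_quadratic x y : `|cos y - cos x + (y - x) * sin x| <= (y - x) ^+ 2.
Proof.
rewrite -[_ * sin x]opprK -mulrN.
apply: (quadratic_remainder (df := fun x => - sin x)) => u v.
rewrite -opprD normrN -[leRHS]mul1r; apply: (lipschitz_derive (df := cos)) => z.
by rewrite ler_norml cos_geN1 cos_le1.
Qed.

(** Taylor bounds in several variables are what is available for [g] and its partial derivatives
    along curves; this turns them into ordinary derivatives without a chain rule. *)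
Lemma is_derive_quadratic f (l B x : R) :
  (forall h, `|f (x + h) - f x - h * l| <= B * h ^+ 2) -> is_derive x 1 f l.
Proof.
move=> H.
have B0 : 0 <= B by have := le_trans (normr_ge0 _) (H 1); rewrite expr1n mulr1.
suff C : (fun h => h^-1 *: ((f \o shift x) (h *: (1 : R)) - f x)) @ 0^' --> l.
  split; first exact: cvgP C.
  exact: cvg_lim C.
apply/cvgrPdist_le => e e0; near=> h.
have h0 : h != 0 by near: h; exact: nbhs_dnbhs_neq.
have he : `|h| <= e / (B + 1).
  near: h; apply: dnbhs0_le; rewrite divr_gt0 // ltr_wpDl //.
rewrite /= [h *: _]mulr1 [h + x]addrC /GRing.scale /=.
rewrite -[l](mulKf h0) -mulrBr normrM normfV distrC ler_pdivrMl ?normr_gt0 //.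
apply: le_trans (H h) _; rewrite -real_normK ?num_real // expr2 mulrCA ler_wpM2l //.
have BB : 0 < B + 1 by rewrite ltr_wpDl.
have : `|h| * (B + 1) <= e by rewrite -ler_pdivlMr.
by have := normr_ge0 h; nra.
Unshelve. all: by end_near.
Qed.

End RealLine.

Section Partials.
Context {R : realType} {d : nat}.
Implicit Types (g : 'rV[R]_d -> R) (u v x : 'rV[R]_d) (i j : 'I_d).

Definition partial i g x : R := 'D_(delta_mx 0 i) g x.

Lemma is_derive_line i g x : (forall y, derivable g y (delta_mx 0 i)) ->
  forall t : R, is_derive t 1 (fun t : R => g (x + t *: delta_mx 0 i))
    (partial i g (x + t *: delta_mx 0 i)).
Proof.
move=> dg t.
have E : (fun h : R => h^-1 *: (((fun t : R => g (x + t *: delta_mx 0 i)) \o shift t)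
    (h *: (1 : R)) -
     g (x + t *: delta_mx 0 i))) =
   (fun h : R => h^-1 *: ((g \o shift (x + t *: delta_mx 0 i)) (h *: delta_mx 0 i) -
     g (x + t *: delta_mx 0 i))).
  apply/funext => h /=; congr (_ *: (g _ - _)).
  by rewrite [h *: 1]mulr1 scalerDl addrCA.
split; first by rewrite /derivable E; exact: dg.
by rewrite /partial /derive E.
Qed.

(* Interpolates between [v] and [u] one coordinate at a time. *)
Definition mix u v (k : nat) : 'rV[R]_d := \row_j (if (j < k)%N then u 0 j else v 0 j).

Lemma mix0 u v : mix u v 0 = v.
Proof. by apply/rowP => j; rewrite mxE. Qed.

Lemma mix_full u v : mix u v d = u.
Proof. by apply/rowP => j; rewrite mxE ltn_ord. Qed.

Lemma mixS u v i : mix u v i.+1 = mix u v i + (u 0 i - v 0 i) *: delta_mx 0 i.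
Proof.
apply/rowP => j; rewrite !mxE eqxx /= ltnS leq_eqVlt.
have [->|ji] := eqVneq j i; first by rewrite eqxx ltnn /= mulr1 addrC subrK.
by rewrite mulr0 addr0 -val_eqE /= in ji *; rewrite (negbTE ji).
Qed.

Lemma telescope_mix g u v :
  g u - g v = \sum_(i < d) (g (mix u v i.+1) - g (mix u v i)).
Proof.
have /= := telescope_sumr (fun k => g (mix u v k)) (leq0n d).
by rewrite mix_full mix0 big_mkord.
Qed.

Lemma mix_step g u v i : (forall y, derivable g y (delta_mx 0 i)) ->
  exists2 c : R, `|c| <= `|u 0 i - v 0 i| & g (mix u v i.+1) - g (mix u v i) =
    (u 0 i - v 0 i) * partial i g (mix u v i + c *: delta_mx 0 i).
Proof.
move=> dg; have [c] := mean_value 0 (u 0 i - v 0 i) (is_derive_line (mix u v i) dg).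
rewrite !subr0 scale0r addr0 -mixS => cle E.
by exists c.
Qed.

Lemma lipschitz_partials g u v :
  (forall i y, derivable g y (delta_mx 0 i)) ->
  (forall i x, `|partial i g x| <= 1) ->
  `|g u - g v| <= \sum_j `|u 0 j - v 0 j|.
Proof.
move=> dg g1; rewrite telescope_mix; apply: le_trans (ler_norm_sum _ _ _) _.
apply: ler_sum => i _; have [c _ ->] := mix_step u v (dg i).
by rewrite normrM ler_piMr.
Qed.

(** At step [i] of the interpolation, the point given by the mean value theorem differs from [v] by
    at most [|u_j - v_j|] in each coordinate [j]. The Lipschitz bound thus allows replacing the
    partial derivative there by its value at [v]. *)
Lemma taylor_partials g u v :
  (forall i y, derivable g y (delta_mx 0 i)) ->
  (forall i u v, `|partial i g u - partial i g v| <= \sum_j `|u 0 j - v 0 j|) ->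
  `|g u - g v - \sum_j (u 0 j - v 0 j) * partial j g v| <=
    (\sum_j `|u 0 j - v 0 j|) ^+ 2.
Proof.
move=> dg lip; rewrite telescope_mix -sumrB expr2 mulr_suml.
apply: le_trans (ler_norm_sum _ _ _) _; apply: ler_sum => i _.
have [c cle ->] := mix_step u v (dg i); rewrite -mulrBr normrM ler_wpM2l //.
apply: le_trans (lip _ _ _) _; apply: ler_sum => j _.
rewrite !mxE eqxx /=; have [->|ji] := eqVneq j i.
  by rewrite ltnn mulr1 addrAC subrr add0r.
by rewrite mulr0 addr0; case: ifP => _ //; rewrite subrr normr0.
Qed.

Lemma d4_test_partials g : d4_test g ->
  (forall s i x, (size s <= 3)%N -> derivable (partials s g) x (delta_mx 0 i)) /\
  (forall s x, (1 <= size s <= 4)%N -> `|partials s g x| <= 1).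
Proof.
move=> [[dg _] bg]; split=> [s i x s3|s x s14]; first exact: dg.
have := bg _ s14; rewrite /max_partial => H.
rewrite -lee_fin; apply: le_trans H.
apply: le_trans (ereal_sup_ubound _) (_ : ereal_sup [set `|partials (in_tuple s) g x|%:E
  | x in [set: 'rV[R]_d]] <= _)%E; first by exists x.
exact: (le_bigmax_cond 0%E (fun s' : (size s).-tuple 'I_d =>
   ereal_sup [set `|partials s' g x|%:E | x in [set: 'rV[R]_d]])).
Qed.

End Partials.

(** * The smart path *)

Definition lipschitz_l1 {R : realType} {d : nat} (f : 'rV[R]_d -> R) :=
  forall u v, `|f u - f v| <= \sum_j `|u 0 j - v 0 j|.

Definition taylor_l1 {R : realType} {d : nat} (f : 'rV[R]_d -> R)
    (fd : 'I_d -> 'rV[R]_d -> R) :=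
  forall u v, `|f u - f v - \sum_j (u 0 j - v 0 j) * fd j v| <=
    (\sum_j `|u 0 j - v 0 j|) ^+ 2.

(** This class of pairs is stable under precomposition with [u |-> x *: u + z] for [|x| <= 1], which
    is how the partial derivatives of the test function enter along the path. *)
Definition stein_bound {R : realType} {d : nat} {T : finType} (F : T -> 'rV[R]_d)
    (sigma : 'I_d -> R) (e : R) :=
  forall (f : 'rV[R]_d -> R) (fd : 'I_d -> 'rV[R]_d -> R),
    (forall u, `|f u| <= 1) -> (forall j u, `|fd j u| <= 1) ->
    lipschitz_l1 f -> taylor_l1 f fd ->
    forall i, `|mean (fun w => F w 0 i * f (F w)) -
      sigma i * mean (fun w => fd i (F w))| <= e.

(* The weights [p] at the points [v] satisfy the normal integration by parts
   [E (xi h(xi)) = E h'(xi)] up to [e], for the [h] met along the path. *)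
Definition normal_ibp {R : realType} {K : nat} (p v : 'I_K -> R) (a e : R) :=
  forall (h h' : R -> R), (forall x : R, is_derive x 1 h (h' x)) ->
    (forall x, `|h x| <= 1) -> (forall x, `|h' x| <= a) ->
    (forall x y, `|h' x - h' y| <= a ^+ 2 * `|x - y|) ->
    `|\sum_c p c * (v c * h (v c) - h' (v c))| <= e.

Section SmartPath.
Context {R : realType} {d : nat}.
Variables (g : 'rV[R]_d -> R) (dg : 'I_d -> 'rV[R]_d -> R).
Hypothesis g_taylor : taylor_l1 g dg.
Hypothesis dg_le1 : forall i u, `|dg i u| <= 1.

Section Derivative.
Variables (T : finType) (P : T -> R) (F Z : T -> 'rV[R]_d).
Hypothesis P_ge0 : forall t, 0 <= P t.

(** The trigonometric form keeps the covariance constant when both ends have the same one, and its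
    derivative stays bounded at both ends of the path. *)
Definition rotation (x : R) (t : T) : 'rV[R]_d := sin x *: F t + cos x *: Z t.

Definition rotation_drift (x : R) (t : T) : R :=
  \sum_i (cos x * F t 0 i - sin x * Z t 0 i) * dg i (rotation x t).

Let S t : R := \sum_i (`|F t 0 i| + `|Z t 0 i|).

(** Two errors of second order: the Taylor remainder of [g], and those of [sin] and [cos], weighted
    by the bounded partial derivatives. *)
Lemma rotation_quadratic x h t :
  `|g (rotation (x + h) t) - g (rotation x t) - h * rotation_drift x t| <=
  (S t ^+ 2 + S t) * h ^+ 2.
Proof.
set U' := rotation (x + h) t; set U := rotation x t.
have xh : x + h - x = h by rewrite addrC addKr.
have dU i : U' 0 i - U 0 i = (sin (x + h) - sin x) * F t 0 i +
    (cos (x + h) - cos x) * Z t 0 i.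
  by rewrite /U' /U /rotation !mxE; ring.
have sinl : `|sin (x + h) - sin x| <= `|h|.
  rewrite -{2}xh -[leRHS]mul1r; apply: (lipschitz_derive (df := cos)) => z.
  by rewrite ler_norml cos_geN1 cos_le1.
have cosl : `|cos (x + h) - cos x| <= `|h|.
  rewrite -{2}xh -[leRHS]mul1r; apply: (lipschitz_derive (df := fun x => - sin x)) => z.
  by rewrite normrN ler_norml sin_geN1 sin_le1.
have H1 : \sum_i `|U' 0 i - U 0 i| <= `|h| * S t.
  rewrite mulr_sumr; apply: ler_sum => i _; rewrite dU mulrDr.
  by apply: le_trans (ler_normD _ _) _; rewrite !normrM lerD // ler_wpM2r.
have H2 : `|\sum_i (U' 0 i - U 0 i) * dg i U - h * rotation_drift x t| <= h ^+ 2 * S t.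
  rewrite /rotation_drift mulr_sumr -sumrB mulr_sumr.
  apply: le_trans (ler_norm_sum _ _ _) _; apply: ler_sum => i _.
  rewrite mulrA -mulrBl normrM; apply: le_trans (ler_piMr _ (dg_le1 _ _)) _ => //.
  have := sin_quadratic x (x + h); have := cos_quadratic x (x + h); rewrite xh => Hc Hs.
  rewrite (_ : _ - _ = (sin (x + h) - sin x - h * cos x) * F t 0 i +
    (cos (x + h) - cos x + h * sin x) * Z t 0 i); last by rewrite dU; ring.
  apply: le_trans (ler_normD _ _) _; rewrite !normrM mulrDr.
  by apply: lerD; rewrite ler_wpM2r.
have H3 := g_taylor U' U.
have S0 : 0 <= S t by apply: sumr_ge0 => i _; rewrite addr_ge0.
have H4 : (\sum_i `|U' 0 i - U 0 i|) ^+ 2 <= S t ^+ 2 * h ^+ 2.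
  rewrite -[h ^+ 2]real_normK ?num_real // -exprMn mulrC.
  by rewrite lerXn2r ?nnegrE ?mulr_ge0 ?sumr_ge0.
rewrite mulrDl (_ : _ - _ - _ = (g U' - g U - \sum_i (U' 0 i - U 0 i) * dg i U) +
  (\sum_i (U' 0 i - U 0 i) * dg i U - h * rotation_drift x t)); last by ring.
apply: le_trans (ler_normD _ _) _; apply: lerD; first exact: le_trans H3 H4.
by rewrite [leRHS]mulrC.
Qed.

Lemma rotation_path (e : R) :
  (forall x, `|\sum_t P t * rotation_drift x t| <= e) ->
  `|\sum_t P t * g (F t) - \sum_t P t * g (Z t)| <= 2 * e.
Proof.
move=> He; have e0 : 0 <= e := le_trans (normr_ge0 _) (He 0).
pose Phi (x : R) : R := \sum_t P t * g (rotation x t).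
have dPhi (x : R) : is_derive x 1 Phi (\sum_t P t * rotation_drift x t).
  apply: (@is_derive_quadratic _ _ _ (\sum_t P t * (S t ^+ 2 + S t))) => h.
  rewrite /Phi -sumrB mulr_sumr -sumrB mulr_suml.
  apply: le_trans (ler_norm_sum _ _ _) _; apply: ler_sum => t _.
  rewrite (_ : _ - _ = P t * (g (rotation (x + h) t) - g (rotation x t) -
    h * rotation_drift x t)); last by ring.
  by rewrite normrM ger0_norm // -mulrA ler_wpM2l ?rotation_quadratic.
(* The path goes from [Z] at [0] to [F] at [pi / 2]; its length is less than [2], the constant in
   the conclusion. *)
have := lipschitz_derive (0 : R) (pi / 2) dPhi He; rewrite subr0.
have -> : Phi (pi / 2) = \sum_t P t * g (F t).
  apply: eq_bigr => t _; congr (_ * g _).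
  by rewrite /rotation sin_pihalf cos_pihalf scale1r scale0r addr0.
have -> : Phi 0 = \sum_t P t * g (Z t).
  apply: eq_bigr => t _; congr (_ * g _).
  by rewrite /rotation sin0 cos0 scale1r scale0r add0r.
move=> /le_trans; apply; rewrite [leRHS]mulrC ler_wpM2l //.
by rewrite ger0_norm ?divr_ge0 ?pi_ge0 // ltW // pihalf_lt2.
Qed.

End Derivative.

Variable (ddg : 'I_d -> 'I_d -> 'rV[R]_d -> R).
Hypothesis ddg_le1 : forall i j u, `|ddg i j u| <= 1.
Hypothesis dg_lip : forall i, lipschitz_l1 (dg i).
Hypothesis dg_taylor : forall i, taylor_l1 (dg i) (ddg i).
Hypothesis ddg_lip : forall i j, lipschitz_l1 (ddg i j).

Section Product.
Variables (l K : nat) (p v : 'I_K -> R) (A : 'M[R]_(l, d)).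
Hypothesis p_ge0 : forall c, 0 <= p c.
Hypothesis p_sum1 : \sum_c p c = 1.
Local Notation Xi := {ffun 'I_l -> 'I_K}.
Implicit Types (xi : Xi) (k : 'I_l) (c : 'I_K).

Definition weight xi : R := \prod_k p (xi k).

Definition linear_image xi : 'rV[R]_d := (\row_k v (xi k)) *m A.

Lemma weight_ge0 xi : 0 <= weight xi.
Proof. exact: prodr_ge0. Qed.

Lemma sum_weight : \sum_xi weight xi = 1.
Proof.
rewrite -(bigA_distr_bigA (fun _ c => p c)) /=.
by rewrite big1.
Qed.

Definition update xi k c : Xi := [ffun k' => if k' == k then c else xi k'].

(** Exchanging coordinate [k] with an independent copy preserves the product weight. This is
    independence in the form needed to integrate by parts in one coordinate with the others
    frozen. *)
Lemma resample k (f : Xi -> R) :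
  \sum_xi weight xi * f xi = \sum_xi weight xi * \sum_c p c * f (update xi k c).
Proof.
pose s (xc : Xi * 'I_K) := (update xc.1 k xc.2, xc.1 k).
have sK : involutive s.
  move=> [xi c]; rewrite /s /=; congr pair; last by rewrite ffunE eqxx.
  by apply/ffunP => k'; rewrite !ffunE; case: eqP => [->|].
have weight_s xc : weight (s xc).1 * p (s xc).2 = weight xc.1 * p xc.2.
  case: xc => xi c; rewrite /s /weight /= (bigD1 k) //= [in RHS](bigD1 k) //=.
  rewrite ffunE eqxx mulrAC [in RHS]mulrC [RHS]mulrA; congr (_ * _).
  by apply: eq_bigr => k' /negbTE kk; rewrite ffunE kk.
transitivity (\sum_(xc : Xi * 'I_K) weight xc.1 * p xc.2 * f xc.1).
  rewrite -(pair_bigA _ (fun xi c => weight xi * p c * f xi)) /=.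
  apply: eq_bigr => xi _; rewrite -mulr_suml -mulr_sumr p_sum1.
  by rewrite mulr1.
rewrite (reindex_inj (inv_inj sK)) /=.
under eq_bigr do rewrite weight_s.
rewrite -(pair_bigA _ (fun xi c => weight xi * p c * f (update xi k c))) /=.
by apply: eq_bigr => xi _; rewrite mulr_sumr; apply: eq_bigr => c _; rewrite mulrA.
Qed.

Lemma linear_image_update xi k c : linear_image (update xi k c) =
  (\row_k' (if k' == k then 0 else v (xi k'))) *m A + v c *: row k A.
Proof.
rewrite /linear_image rowE scalemxAl -mulmxDl; congr (_ *m _).
apply/rowP => k'; rewrite !mxE ffunE eqxx /=.
by case: eqP => _; rewrite ?mulr1 ?add0r // mulr0 addr0.
Qed.

Variables (a e : R).
Hypothesis A_le : forall k, \sum_j `|A k j| <= a.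
Hypothesis ibp : normal_ibp p v a e.

(** Once coordinate [k] is resampled, the integrand depends on it along the line of direction
    [r = x *: row k A]. Since [r] has norm at most [a], the function on this line has slope at most
    [a], itself [a^2]-Lipschitz: the class of [normal_ibp]. *)
Lemma ibp_coordinate (u : 'rV[R]_d) (x : R) i k : `|x| <= 1 ->
  `|\sum_xi weight xi * (v (xi k) * dg i (u + x *: linear_image xi) -
     \sum_j x * A k j * ddg i j (u + x *: linear_image xi))| <= e.
Proof.
move=> x1; rewrite (resample k).
rewrite -[leRHS]mul1r -sum_weight mulr_suml.
apply: le_trans (ler_norm_sum _ _ _) _; apply: ler_sum => xi _.
rewrite normrM ger0_norm ?weight_ge0 // ler_wpM2l ?weight_ge0 //.
pose w := u + x *: ((\row_k' (if k' == k then 0 else v (xi k'))) *m A).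
pose r := x *: row k A.
have E c : u + x *: linear_image (update xi k c) = w + v c *: r.
  by rewrite linear_image_update scalerDr addrA /r !scalerA [v c * x]mulrC.
pose h y := dg i (w + y *: r); pose h' y := \sum_j r 0 j * ddg i j (w + y *: r).
under eq_bigr => c _.
  rewrite E ffunE eqxx.
  rewrite (_ : \sum_j _ = h' (v c)); last first.
    by apply: eq_bigr => j _; rewrite /r !mxE.
  over.
have a0 : 0 <= a by apply: le_trans (A_le k); apply: sumr_ge0.
have r_le : \sum_j `|r 0 j| <= a.
  apply: le_trans (A_le k); apply: ler_sum => j _.
  by rewrite /r !mxE normrM ler_piMl.
have dline y z : \sum_j `|(w + y *: r) 0 j - (w + z *: r) 0 j| <= a * `|y - z|.
  rewrite mulrC; apply: le_trans (ler_wpM2l (normr_ge0 _) r_le).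
  rewrite mulr_sumr; apply: ler_sum => j _; rewrite !mxE -normrM.
  by rewrite le_eqVlt; apply/orP; left; apply/eqP; congr (`|_|); ring.
apply: (ibp (h := h) (h' := h')).
- move=> y; apply: (@is_derive_quadratic _ _ _ (a ^+ 2)) => t.
  have := dg_taylor i (w + (y + t) *: r) (w + y *: r).
  rewrite (_ : \sum_j (_ - _) * _ = t * h' y); last first.
    rewrite /h' mulr_sumr; apply: eq_bigr => j _; rewrite !mxE; ring.
  move=> /le_trans; apply.
  have := dline (y + t) y; rewrite [y + t]addrC addrK => H.
  rewrite -[t ^+ 2]real_normK ?num_real // -exprMn lerXn2r ?nnegrE ?mulr_ge0 //.
  exact: sumr_ge0.
- by move=> y; exact: dg_le1.
- move=> y; apply: le_trans r_le; apply: le_trans (ler_norm_sum _ _ _) _.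
  by apply: ler_sum => j _; rewrite normrM ler_piMr.
- move=> y z; rewrite /h' -sumrB expr2 -mulrA.
  apply: le_trans (_ : _ <= (\sum_j `|r 0 j|) * (a * `|y - z|)) _; last first.
    by rewrite ler_wpM2r ?mulr_ge0.
  rewrite mulr_suml; apply: le_trans (ler_norm_sum _ _ _) _; apply: ler_sum => j _.
  rewrite -mulrBr normrM ler_wpM2l //.
  exact: le_trans (ddg_lip _ _ _ _) (dline _ _).
Qed.

Variables (T : finType) (F : T -> 'rV[R]_d) (sigma : 'I_d -> R) (e1 : R).
Hypothesis T_gt0 : (0 < #|T|)%N.
Hypothesis A_sigma : A^T *m A = diag_mx (\row_i sigma i).
Hypothesis F_stein : stein_bound F sigma e1.

(** Coordinate [i] of the image is the combination of the variables with coefficients [A k i].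
    Integrating each by parts produces the sums over [k] of [A k i * A k j], which are the entries
    of [A^T *m A]; only [j = i] survives. *)
Lemma drift_gauss (u : 'rV[R]_d) (x : R) i : `|x| <= 1 ->
  `|\sum_xi weight xi * (linear_image xi 0 i * dg i (u + x *: linear_image xi)) -
    x * sigma i * \sum_xi weight xi * ddg i i (u + x *: linear_image xi)| <=
  (\sum_k `|A k i|) * e.
Proof.
move=> x1; rewrite mulr_suml.
set U := fun xi => u + x *: linear_image xi.
have -> : \sum_xi weight xi * (linear_image xi 0 i * dg i (U xi)) -
    x * sigma i * \sum_xi weight xi * ddg i i (U xi) =
  \sum_k A k i * \sum_xi weight xi * (v (xi k) * dg i (U xi) -
     \sum_j x * A k j * ddg i j (U xi)).
  have A_entry j : \sum_k A k i * A k j = (if j == i then sigma i else 0).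
    have := congr1 (fun M : 'M[R]_d => M i j) A_sigma; rewrite !mxE => H.
    transitivity (\sum_k A^T i k * A k j); first by apply: eq_bigr => k _; rewrite mxE.
    by rewrite H [j == i]eq_sym; case: (i == j).
  under [RHS]eq_bigr do rewrite mulr_sumr.
  rewrite exchange_big /= mulr_sumr -sumrB; apply: eq_bigr => xi _.
  under [RHS]eq_bigr do rewrite mulrCA; rewrite -mulr_sumr [x * _ * (_ * _)]mulrCA -mulrBr.
  congr (_ * _); under [RHS]eq_bigr do rewrite mulrBr; rewrite sumrB; congr (_ - _).
    by rewrite /linear_image mxE mulr_suml; apply: eq_bigr => k _; rewrite mxE; ring.
  under [RHS]eq_bigr do rewrite mulr_sumr; rewrite exchange_big /=.
  rewrite (bigD1 i) //= [X in _ + X]big1 ?addr0 => [|j /negbTE ji].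
    transitivity ((\sum_k A k i * A k i) * (x * ddg i i (U xi))).
      by rewrite A_entry eqxx; ring.
    by rewrite mulr_suml; apply: eq_bigr => k _; ring.
  transitivity ((\sum_k A k i * A k j) * (x * ddg i j (U xi))).
    by rewrite mulr_suml; apply: eq_bigr => k _; ring.
  by rewrite A_entry ji mul0r.
apply: le_trans (ler_norm_sum _ _ _) _; apply: ler_sum => k _.
by rewrite normrM ler_wpM2l // ibp_coordinate.
Qed.

Lemma drift_stein (z : 'rV[R]_d) (x y : R) i : `|x| <= 1 ->
  `|mean (fun w => F w 0 i * dg i (x *: F w + z)) -
    x * sigma i * mean (fun w => ddg i i (x *: F w + z))| <= e1.
Proof.
move=> x1.
have x0 := normr_ge0 x.
have := F_stein (f := fun w => dg i (x *: w + z)) (fd := fun j w => x * ddg i j (x *: w + z)).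
have dU (u w : 'rV[R]_d) j : (x *: u + z) 0 j - (x *: w + z) 0 j = x * (u 0 j - w 0 j).
  by rewrite !mxE; ring.
have sU (u w : 'rV[R]_d) : \sum_j `|(x *: u + z) 0 j - (x *: w + z) 0 j| <=
    \sum_j `|u 0 j - w 0 j|.
  by apply: ler_sum => j _; rewrite dU normrM ler_piMl.
move=> H; have {}H := H _ _ _ _ i; rewrite meanZ mulrCA mulrA in H; apply: H.
- by move=> u; exact: dg_le1.
- by move=> j u; rewrite normrM mulr_ile1.
- by move=> u w; apply: le_trans (dg_lip _ _ _) (sU _ _).
- move=> u w; have := dg_taylor i (x *: u + z) (x *: w + z).
  rewrite (eq_bigr (fun j => (u 0 j - w 0 j) * (x * ddg i j (x *: w + z)))); last first.
    by move=> j _; rewrite dU; ring.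
  by move=> /le_trans; apply; rewrite lerXn2r ?nnegrE ?sumr_ge0 // sU.
Qed.

Lemma smart_path :
  `|mean (fun w => g (F w)) - \sum_xi weight xi * g (linear_image xi)| <=
  2 * (d%:R * e1 + (\sum_i \sum_k `|A k i|) * e).
Proof.
pose P (t : T * Xi) := #|T|%:R^-1 * weight t.2.
have sumP (f : T -> Xi -> R) : \sum_t P t * f t.1 t.2 =
    \sum_xi weight xi * mean (fun w => f w xi).
  rewrite -(pair_bigA _ (fun w xi => #|T|%:R^-1 * weight xi * f w xi)) exchange_big /=.
  apply: eq_bigr => xi _; rewrite /mean -mulr_sumr; ring.
have := @rotation_path (T * Xi)%type P (fun t => F t.1) (fun t => linear_image t.2).
move=> H; have {}H := H _ (d%:R * e1 + (\sum_i \sum_k `|A k i|) * e) _.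
have E1 : \sum_t P t * g (F t.1) = mean (fun w => g (F w)).
  rewrite (sumP (fun w _ => g (F w))) -mulr_suml sum_weight mul1r //.
have E2 : \sum_t P t * g (linear_image t.2) = \sum_xi weight xi * g (linear_image xi).
  rewrite (sumP (fun _ xi => g (linear_image xi))); apply: eq_bigr => xi _.
  by rewrite mean_cst.
rewrite E1 E2 in H; apply: H => [t|x].
  by rewrite /P mulr_ge0 ?weight_ge0 // invr_ge0.
have sin1 : `|sin x| <= 1 by rewrite ler_norml sin_geN1 sin_le1.
have cos1 : `|cos x| <= 1 by rewrite ler_norml cos_geN1 cos_le1.
pose U w xi := sin x *: F w + cos x *: linear_image xi.
pose BF i := \sum_xi weight xi * (mean (fun w => F w 0 i * dg i (U w xi)) -
   sin x * sigma i * mean (fun w => ddg i i (U w xi))).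
pose BZ i := mean (fun w => \sum_xi weight xi * (linear_image xi 0 i * dg i (U w xi)) -
    cos x * sigma i * \sum_xi weight xi * ddg i i (U w xi)).
(* The correction in [BF i] is multiplied by [cos x] and that in [BZ i] by [- sin x]: the terms
   [sin x * cos x * sigma i * ddg i i] cancel, so both brackets may be estimated separately. *)
have -> : \sum_t P t * rotation_drift (fun t => F t.1) (fun t => linear_image t.2) x t =
    \sum_i (cos x * BF i - sin x * BZ i).
  rewrite (sumP (fun w xi => \sum_i (cos x * F w 0 i - sin x * linear_image xi 0 i) *
    dg i (U w xi))).
  under eq_bigr do rewrite mean_sum mulr_sumr.
  rewrite exchange_big /=; apply: eq_bigr => i _.
  have -> : BZ i = \sum_xi weight xi * (mean (fun w => linear_image xi 0 i * dg i (U w xi)) -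
       cos x * sigma i * mean (fun w => ddg i i (U w xi))).
    rewrite /BZ meanB meanZ !mean_sum mulr_sumr -sumrB; apply: eq_bigr => xi _.
    by rewrite !meanZ; ring.
  rewrite /BF !mulr_sumr -sumrB; apply: eq_bigr => xi _.
  rewrite (@eq_mean _ _ (fun w => (cos x * _ - _) * _)
    (fun w => cos x * (F w 0 i * dg i (U w xi)) -
     sin x * (linear_image xi 0 i * dg i (U w xi)))); last by move=> w; ring.
  by rewrite meanB !meanZ; ring.
apply: le_trans (ler_norm_sum _ _ _) _.
rewrite (_ : d%:R * e1 + _ = \sum_(i < d) (e1 + (\sum_k `|A k i|) * e)); last first.
  by rewrite big_split /= sumr_const card_ord -[e1 *+ d]mulr_natl mulr_suml.
apply: ler_sum => i _; apply: le_trans (ler_normB _ _) _.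
  rewrite [X in X + _]normrM [X in _ + X]normrM.
apply: lerD.
  apply: le_trans (ler_piMl _ cos1) _ => //.
  rewrite -[leRHS]mul1r -sum_weight mulr_suml.
  apply: le_trans (ler_norm_sum _ _ _) _; apply: ler_sum => xi _.
  rewrite normrM ger0_norm ?weight_ge0 // ler_wpM2l ?weight_ge0 //.
  exact: drift_stein.
apply: le_trans (ler_piMl _ sin1) _ => //.
apply: le_trans (ler_norm_mean _) _.
rewrite -[leRHS](mean_cst T_gt0); apply: ler_mean => w.
exact: drift_gauss.
Qed.

End Product.

End SmartPath.

(** * Integration by parts for the normal law *)

Section StandardNormal.
Context {R : realType}.
Local Notation mu := (@lebesgue_measure R).
Local Notation nu := (@normal_prob R 0 1).
Local Notation phi := (@normal_pdf R 0 1).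

Lemma normal_pdf01E x : phi x = normal_peak 1 * expR (- (x ^+ 2 / 2)).
Proof.
rewrite normal_pdfE ?oner_neq0 // /normal_fun subr0 expr1n.
by rewrite -[1 *+ 2]/(2%:R : R) mulNr.
Qed.

Lemma normal_pdf01N x : phi (- x) = phi x.
Proof. by rewrite !normal_pdf01E sqrrN. Qed.

Lemma is_derive_normal_pdf (x : R) : is_derive x 1 phi (- x * phi x).
Proof.
have -> : phi = (fun x => normal_peak 1 * expR (- (x ^+ 2 / 2))).
  by apply/funext => y; exact: normal_pdf01E.
apply: is_derive_eq; rewrite /GRing.scale /=.
by field.
Qed.

Lemma continuous_of_derive (h h' : R -> R) : (forall x : R, is_derive x 1 h (h' x)) ->
  continuous h.
Proof.
move=> dh x; apply: differentiable_continuous.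
by apply/derivable1_diffP; have [] := dh x.
Qed.

(** Since [phi' = - x phi], the integrand is the derivative of [h * phi]; evenness of [phi] merges
    the two boundary terms. *)
Lemma normal_pdf_ibp (h h' : R -> R) (m : R) : 0 < m ->
  (forall x : R, is_derive x 1 h (h' x)) -> continuous h' ->
  (\int[mu]_(x in `[(- m)%R, m]) ((h' x - x * h x) * phi x)%:E =
  ((h m - h (- m)) * phi m)%:E)%E.
Proof.
move=> m0 dh ch'.
have ch := continuous_of_derive dh.
have cphi := continuous_of_derive is_derive_normal_pdf.
have dF (x : R) : is_derive x 1 (fun x => h x * phi x) ((h' x - x * h x) * phi x).
  have d1 := dh x; have d2 := is_derive_normal_pdf x.
  apply: is_derive_eq; rewrite /GRing.scale /=; ring.
have cF := continuous_of_derive dF.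
rewrite (@continuous_FTC2 _ _ (fun x => h x * phi x)).
- by rewrite -EFinB normal_pdf01N mulrBl.
- lra.
- apply: continuous_subspaceT => x; apply: cvgM; last exact: cphi.
  by apply: cvgB; [exact: ch'|apply: cvgM; [exact: cvg_id|exact: ch]].
- split.
  + by move=> x _; have [] := dF x.
  + exact: cvg_at_right_filter (cF _).
  + exact: cvg_at_left_filter (cF _).
- by move=> x _; rewrite derive1E; have [_ ->] := dF x.
Qed.

Lemma normal_pdf_decay (m : R) : 0 < m -> m * phi m <= 2 * normal_peak 1 / m.
Proof.
move=> m0; rewrite normal_pdf01E ler_pdivlMr //.
have p0 : 0 <= normal_peak 1 :> R by exact: normal_peak_ge0.
have e0 := expR_gt0 (- (m ^+ 2 / 2)).
(* The inequality [1 + z <= exp z] at [z = m^2 / 2] already gives enough decay. *)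
have : expR (- (m ^+ 2 / 2)) * (1 + m ^+ 2 / 2) <= 1.
  rewrite expRN mulrC ler_pdivrMr ?expR_gt0 // mul1r.
  exact: expR_ge1Dx.
move=> H; rewrite [leLHS](_ : _ = normal_peak 1 * (m ^+ 2 * expR (- (m ^+ 2 / 2)))); last by ring.
rewrite [leRHS]mulrC ler_wpM2l //.
move: H; set y := expR _ in e0 *; set z := m ^+ 2 => H; nra.
Qed.

(** The Radon-Nikodym derivative of [nu] agrees almost everywhere with [phi], both having the same
    integral over every measurable set. *)
Lemma ge0_integral_normal f (A : set R) : measurable A ->
  measurable_fun A f -> (forall x, 0 <= f x)%E ->
  (\int[nu]_(x in A) f x = \int[mu]_(x in A) (f x * (phi x)%:E))%E.
Proof.
move=> mA mf f0.
have dom := normal_prob_dominates (0 : R) 1.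
rewrite -(Radon_Nikodym_SigmaFinite.change_of_variables dom) //.
have mRN : measurable_fun setT (Radon_Nikodym_SigmaFinite.f nu mu).
  by apply: measurable_int; exact: Radon_Nikodym_SigmaFinite.f_integrable.
apply: ae_eq_integral => //.
- by apply: emeasurable_funM => //; exact: measurable_funTS.
- apply: emeasurable_funM => //; apply/measurable_EFinP/measurable_funTS.
  exact: measurable_normal_pdf.
- apply: ae_eqe_mul2l => /=.
  apply: integral_ae_eq => //=.
  + apply: (integrableS measurableT) => //.
    exact: Radon_Nikodym_SigmaFinite.f_integrable.
  + by apply/measurable_funTS/measurable_EFinP; exact: measurable_normal_pdf.
  + move=> E _ mE; rewrite -Radon_Nikodym_SigmaFinite.f_integral //.
Qed.

Lemma integral_normal (f : R -> R) (A : set R) : measurable A ->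
  nu.-integrable A (EFin \o f) ->
  (\int[nu]_(x in A) (f x)%:E = \int[mu]_(x in A) (f x * phi x)%:E)%E.
Proof.
move=> mA intf; have mf := measurable_int _ intf.
have dom := normal_prob_dominates (0 : R) 1.
rewrite -(Radon_Nikodym_change_of_variables dom) //.
under [RHS]eq_integral do rewrite EFinM.
apply: ae_eq_integral => //.
- apply: emeasurable_funM => //; apply: (measurable_int mu).
  by apply: (integrableS measurableT) => //; exact: Radon_Nikodym_integrable.
- apply: emeasurable_funM => //; apply/measurable_EFinP/measurable_funTS.
  exact: measurable_normal_pdf.
- apply: ae_eqe_mul2l => /=.
  apply: integral_ae_eq => //=.
  + apply: (integrableS measurableT) => //.
    exact: Radon_Nikodym_integrable.
  + by apply/measurable_funTS/measurable_EFinP; exact: measurable_normal_pdf.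
  + by move=> E _ mE; rewrite -Radon_Nikodym_integral.
Qed.

End StandardNormal.

(** * Integrals over the line as limits over symmetric intervals *)

Section SymmetricIntervals.
Context {R : realType}.
Variable la : {measure set (measurableTypeR R) -> \bar R}.

Definition symitv (n : nat) : set (measurableTypeR R) := `[(- n%:R)%R, n%:R].

Lemma measurable_symitv n : measurable (symitv n).
Proof. exact: measurable_itv. Qed.

Lemma symitvE n x : symitv n x = (`|x| <= n%:R) :> Prop.
Proof. by rewrite /symitv /= in_itv /= ler_norml. Qed.

Lemma near_symitv x : \forall n \near \oo, symitv n x.
Proof.
exists (Num.truncn `|x|).+1 => // n /= xn; rewrite symitvE.
by rewrite (le_trans (ltW (truncnS_gt _))) // ler_nat.
Qed.

Lemma cvg_integral_symitv_ge0 (f : R -> \bar R) : measurable_fun setT f ->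
  (forall x, 0 <= f x)%E ->
  (\int[la]_(x in symitv n) f x)%E @[n --> \oo] --> (\int[la]_x f x)%E.
Proof.
move=> mf f0.
have -> : (\int[la]_x f x = \int[la]_x (limn (fun n => (f \_ (symitv n)) x)))%E.
  apply: eq_integral => x _; apply/esym/lim_near_cst => //.
  have := near_symitv x; apply: filterS => n xn.
  by rewrite patchE mem_set.
have H := @cvg_monotone_convergence _ _ R la setT measurableT
  (fun n => f \_ (symitv n)).
rewrite (_ : (fun n => _) = (fun n => (\int[la]_x (f \_ (symitv n)) x)%E)); last first.
  by apply/funext => n; rewrite integral_mkcond.
apply: H => [n|n x _|x _ m n mn].
- apply/(measurable_restrictT f (measurable_symitv n)); exact: measurable_funTS.
- by apply: erestrict_ge0.
- rewrite !patchE; case: ifPn => xm; last by case: ifP.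
  rewrite ifT // inE symitvE; move: xm; rewrite inE symitvE => /le_trans; apply.
  by rewrite ler_nat.
Qed.

Lemma cvg_integral_symitv (f : R -> \bar R) : la.-integrable setT f ->
  (\int[la]_(x in symitv n) f x)%E @[n --> \oo] --> (\int[la]_x f x)%E.
Proof.
move=> intf; have mf := measurable_int _ intf.
rewrite (_ : (fun n => _) = (fun n => (\int[la]_x (f \_ (symitv n)) x)%E)); last first.
  by apply/funext => n; rewrite integral_mkcond.
have H1 n : measurable_fun setT (f \_ (symitv n)).
  by apply/(measurable_restrictT f (measurable_symitv n)); exact: measurable_funTS.
have H2 : {ae la, forall x, setT x -> (f \_ (symitv n)) x @[n --> \oo] --> f x}.
  apply: nearW => x _; apply: cvg_near_cst.
  have := near_symitv x; apply: filterS => n xn.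
  by rewrite patchE mem_set.
have H3 : {ae la, forall x (n : nat), setT x -> (`|(f \_ (symitv n)) x| <= `|f x|)%E}.
  apply: nearW => x n _; rewrite patchE; case: ifP => // _.
  by rewrite abse0.
have [] := @dominated_convergence _ (measurableTypeR R) R la setT measurableT
  (fun n => f \_ (symitv n)) f (fun x => `|f x|%E) H1 mf H2 (integrable_abse intf) H3.
by [].
Qed.

End SymmetricIntervals.

Section NormalMoments.
Context {R : realType}.
Local Notation mu := (@lebesgue_measure R).
Local Notation nu := (@normal_prob R 0 1).
Local Notation phi := (@normal_pdf R 0 1).

Lemma continuous_normal_pdf01 : continuous phi.
Proof. exact: continuous_of_derive is_derive_normal_pdf. Qed.

Lemma normal_boundary_cvg0 : (fun n : nat => (2 * (n%:R * phi n%:R))%:E) @ \oo --> 0%E.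
Proof.
apply: cvg_EFin; first exact: nearW.
apply: (@squeeze_cvgr _ _ _ _ (cst 0) (fun n : nat => 4 * normal_peak 1 * n%:R^-1)).
- near=> n; have n0 : 0 < n%:R :> R by rewrite ltr0n; near: n; exact: nbhs_infty_gt.
  rewrite /= mulr_ge0 ?mulr_ge0 ?normal_pdf_ge0 //=.
  have := normal_pdf_decay n0; lra.
- exact: cvg_cst.
- rewrite -[X in _ --> X](mulr0 (4 * normal_peak 1)); apply: cvgMr.
  rewrite gtr0_cvgV0; first exact: cvgr_idn.
  by near=> n; rewrite ltr0n; near: n; exact: nbhs_infty_gt.
Unshelve. all: by end_near. Qed.

(** Integration by parts with [h = id] on [[-n, n]] gives the mass of the interval minus
    [2 n phi(n)]. Monotone convergence lets [n] grow without presupposing integrability, which for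
    functions of quadratic growth is deduced from this moment. *)
Lemma normal_second_moment : (\int[nu]_x (x ^+ 2)%:E = 1)%E.
Proof.
have m2 : measurable_fun setT (fun x : R => (x ^+ 2)%:E).
  by apply/measurable_EFinP; exact: measurable_funX.
have mphi : measurable_fun setT (fun x : R => (phi x)%:E).
  by apply/measurable_EFinP; exact: measurable_normal_pdf.
rewrite ge0_integral_normal // => [|x]; last by rewrite lee_fin sqr_ge0.
have cA : (\int[mu]_(x in symitv n) ((x ^+ 2)%:E * (phi x)%:E))%E @[n --> \oo] -->
    (\int[mu]_x ((x ^+ 2)%:E * (phi x)%:E))%E.
  apply: cvg_integral_symitv_ge0; first exact: emeasurable_funM.
  by move=> x; rewrite mule_ge0 // lee_fin ?sqr_ge0 ?normal_pdf_ge0.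
have cB : (\int[mu]_(x in symitv n) (phi x)%:E)%E @[n --> \oo] --> (1 : \bar R)%E.
  rewrite -(integral_normal_pdf 0 1); apply: cvg_integral_symitv_ge0 => // x.
  by rewrite lee_fin normal_pdf_ge0.
have E (n : nat) : (0 < n)%N -> (\int[mu]_(x in symitv n) ((x ^+ 2)%:E * (phi x)%:E) =
   \int[mu]_(x in symitv n) (phi x)%:E - (2 * (n%:R * phi n%:R))%:E)%E.
  move=> n0; have n0' : 0 < n%:R :> R by rewrite ltr0n.
  under eq_integral do rewrite -EFinM.
  have cc : continuous (cst 1 : R -> R) by move=> x; exact: cvg_cst.
  have := @normal_pdf_ibp R id (cst 1) n%:R n0' (fun x => is_derive_id x 1) cc.
  have ci f : continuous (f : R -> R) -> mu.-integrable (symitv n) (EFin \o f).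
    move=> cf; apply: continuous_compact_integrable; first exact: segment_compact.
    exact: continuous_subspaceT.
  have i1 : mu.-integrable (symitv n) (EFin \o phi) by exact: ci continuous_normal_pdf01.
  have i2 : mu.-integrable (symitv n) (EFin \o (fun x => x ^+ 2 * phi x)).
    apply: ci => x; apply: cvgM; last exact: continuous_normal_pdf01.
    exact: exprn_continuous.
  rewrite (_ : (\int[mu]_(x in `[(- n%:R)%R, n%:R]) _)%E =
    (\int[mu]_(x in symitv n) ((phi x)%:E - (x ^+ 2 * phi x)%:E))%E); last first.
    by apply: eq_integral => x _; rewrite -EFinB; congr (_%:E); rewrite /=; ring.
  rewrite integralB //; last exact: measurable_symitv.
  have f1 := integrable_fin_num (measurable_symitv n) i1.
  have f2 := integrable_fin_num (measurable_symitv n) i2.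
  move: f1 f2; rewrite /comp; set a := (\int[mu]_(x in _) (phi x)%:E)%E.
  set b := (\int[mu]_(x in _) _)%E => /fineK <- /fineK <-.
  rewrite -!EFinB => -[H]; congr (_%:E).
  by rewrite /= opprK in H; lra.
apply: (cvg_unique _ cA) => //.
have cC : (\int[mu]_(x in symitv n) (phi x)%:E - (2 * (n%:R * phi n%:R))%:E)%E
    @[n --> \oo] --> (1 - 0 : \bar R)%E.
  apply: cvgeB => //; exact: normal_boundary_cvg0.
rewrite sube0 in cC; apply: cvg_trans cC; apply: near_eq_cvg.
by exists 1%N => // n /= n0; rewrite E.
Qed.

Lemma integrable_normal_quadratic (f : R -> R) (c : R) : measurable_fun setT f ->
  (forall x, `|f x| <= c * (1 + x ^+ 2)) -> nu.-integrable setT (EFin \o f).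
Proof.
move=> mf fc.
have i1 : nu.-integrable setT (fun x : measurableTypeR R => (1 : R)%:E).
  by apply/finite_measure_integrable_cst.
have i2 : nu.-integrable setT (fun x : measurableTypeR R => (x ^+ 2 : R)%:E).
  apply/integrableP; split; first by apply/measurable_EFinP; exact: measurable_funX.
  under eq_integral do rewrite abse_EFin ger0_norm ?sqr_ge0 //.
  by rewrite normal_second_moment ltry.
have i3 := integrableZl measurableT c (integrableD measurableT i1 i2).
apply: (le_integrable measurableT _ _ i3); first exact/measurable_EFinP.
move=> x _ /=; rewrite lee_fin; apply: le_trans (fc x) _.
exact: ler_norm.
Qed.

Lemma normal_ibp_integral (h h' : R -> R) (a : R) :
  (forall x : R, is_derive x 1 h (h' x)) -> continuous h' ->
  (forall x, `|h x| <= 1) -> (forall x, `|h' x| <= a) ->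
  (\int[nu]_x (h' x - x * h x)%:E = 0)%E.
Proof.
move=> dh ch' h1 ha.
have ch := continuous_of_derive dh.
have mh : measurable_fun setT (fun x => h' x - x * h x).
  apply: measurable_funB; first exact: continuous_measurable_fun.
  by apply: measurable_funM => //; exact: continuous_measurable_fun.
have inth : nu.-integrable setT (EFin \o (fun x => h' x - x * h x)).
  apply: (integrable_normal_quadratic (c := a + 1)) => // x.
  apply: le_trans (ler_normB _ _) _; rewrite normrM.
  have := h1 x; have := ha x; have := sqr_ge0 (`|x| - 1).
  have := normr_ge0 x; have := normr_ge0 (h x); have := normr_ge0 (h' x).
  rewrite -[x ^+ 2]real_normK ?num_real //; set u := `|x|; set v := `|h x|; set w := `|h' x|.
  by move=> *; nra.
have cA := cvg_integral_symitv inth.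
apply: (cvg_unique _ cA) => //.
(* For bounded [h] the boundary term is at most [2 phi(n)], hence at most [2 n phi(n)] for [n >= 1],
   already known to vanish. *)
apply: (@squeeze_cvge _ _ _ _ (fun n : nat => - (2 * (n%:R * phi n%:R))%:E)%E
  _ (fun n : nat => (2 * (n%:R * phi n%:R))%:E)).
- exists 1%N => // n /= n0; have n0' : 0 < n%:R :> R by rewrite ltr0n.
  rewrite integral_normal ?normal_pdf_ibp //; last first.
  + exact: integrableS measurableT (measurable_symitv n) (@subsetT _ _) inth.
  + exact: measurable_symitv.
  have p0 := normal_pdf_ge0 0 1 n%:R : 0 <= phi n%:R.
  have n1 : 1 <= n%:R :> R by rewrite ler1n.
  rewrite !lee_fin -ler_norml normrM [`|phi _|]ger0_norm //.
  rewrite mulrA ler_wpM2r //; apply: le_trans (ler_normB _ _) _.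
  by have := h1 n%:R; have := h1 (- n%:R); lra.
- rewrite -oppe0; apply: cvgeN; exact: normal_boundary_cvg0.
- exact: normal_boundary_cvg0.
Qed.

End NormalMoments.

(** * Discretization of the normal law *)

Section FiniteValued.
Context {R : realType} {dT : measure_display} {T : measurableType dT}.
Context {I : finType}.
Variables (tau : T -> I).
Hypothesis mtau : forall c, measurable (tau @^-1` [set c]).

Lemma finite_valuedE (f : I -> R) w :
  f (tau w) = \sum_c f c * \1_(tau @^-1` [set c]) w.
Proof.
rewrite (bigD1 (tau w)) //= indicE mem_set // mulr1 big1 ?addr0 // => c cw.
rewrite indicE memNset ?mulr0 //= => wc.
by move: cw; rewrite -wc eqxx.
Qed.

Lemma measurable_finite_valued (f : I -> R) :
  measurable_fun setT (fun w => f (tau w)).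
Proof.
rewrite (_ : (fun w => _) = (fun w => \sum_c f c * \1_(tau @^-1` [set c]) w)); last first.
  by apply/funext => w; exact: finite_valuedE.
by apply: measurable_sum => c; apply: measurable_funM.
Qed.

Variable P : probability T R.

Lemma integrable_finite_valued (f : I -> R) :
  P.-integrable setT (EFin \o (fun w => f (tau w))).
Proof.
rewrite (_ : _ \o _ = (fun w => \sum_c (f c)%:E * (\1_(tau @^-1` [set c]) w)%:E)%E).
  apply: integrable_sum => // c _; apply: integrableZl => //.
  exact: integrable_indic.
apply/funext => w /=; rewrite finite_valuedE -sumEFin.
by apply: eq_bigr => c _; rewrite EFinM.
Qed.

Lemma Rintegral_finite_valued (f : I -> R) :
  \int[P]_w f (tau w) = \sum_c fine (P (tau @^-1` [set c])) * f c.
Proof.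
rewrite /Rintegral.
have -> : (\int[P]_w (f (tau w))%:E =
    \sum_c ((fine (P (tau @^-1` [set c])) * f c)%:E))%E; last by rewrite sumEFin.
transitivity (\int[P]_w (\sum_c (f c)%:E * (\1_(tau @^-1` [set c]) w)%:E))%E.
  apply: eq_integral => w _; rewrite finite_valuedE -sumEFin.
  by apply: eq_bigr => c _; rewrite EFinM.
rewrite integral_sum // => [|c]; last first.
  by apply: integrableZl => //; exact: integrable_indic.
apply: eq_bigr => c _; rewrite integralZl //; last exact: integrable_indic.
by rewrite integral_indic // setIT EFinM fineK ?fin_num_measure // muleC.
Qed.

End FiniteValued.

Section Closeness.
Context {R : realType} {dT : measure_display} {T : measurableType dT}.
Variable P : {measure set T -> \bar R}.

Lemma Rintegral_close (f g b : T -> R) :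
  P.-integrable setT (EFin \o f) -> P.-integrable setT (EFin \o g) ->
  P.-integrable setT (EFin \o b) -> (forall w, `|f w - g w| <= b w) ->
  `|\int[P]_w f w - \int[P]_w g w| <= \int[P]_w b w.
Proof.
move=> If Ig Ib fgb; rewrite -RintegralB //.
have IB : P.-integrable setT (EFin \o (fun w => f w - g w)).
  have := integrableB measurableT If Ig.
  by apply: eq_integrable => // w _ /=; rewrite EFinB.
apply: le_trans (le_normr_Rintegral measurableT IB) _.
apply: le_Rintegral => //.
by have := integrable_abse IB; apply: eq_integrable => // w _.
Qed.

End Closeness.

Section FiniteApproximation.
Context {R : realType} {dT : measure_display} {T : measurableType dT}.
Context {I : finType}.
Variables (tau : T -> I) (P : probability T R).
Hypothesis mtau : forall c, measurable (tau @^-1` [set c]).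

Lemma finite_valued_close (F : I -> R) (f b : T -> R) :
  P.-integrable setT (EFin \o f) -> P.-integrable setT (EFin \o b) ->
  (forall w, `|F (tau w) - f w| <= b w) ->
  `|\sum_c fine (P (tau @^-1` [set c])) * F c - \int[P]_w f w| <= \int[P]_w b w.
Proof.
move=> If Ib H; rewrite -(Rintegral_finite_valued mtau P F).
by apply: Rintegral_close => //; exact: (integrable_finite_valued mtau).
Qed.

End FiniteApproximation.

Section Discretization.
Context {R : realType}.
Local Notation nu := (@normal_prob R 0 1).
Variable m : nat.
Hypothesis m_gt0 : (0 < m)%N.

(* The cell of index [2 * m * m] gathers the tails [x < - m] and [m <= x]; its point is [0]. *)
Definition grid_index (x : R) : nat :=
  if (- m%:R <= x) && (x < m%:R) then Num.truncn (m%:R * (x + m%:R))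
  else (2 * m * m)%N.

Definition grid_cell (x : R) : 'I_(2 * m * m).+1 := inord (grid_index x).

Definition grid_point (c : 'I_(2 * m * m).+1) : R :=
  if (c < 2 * m * m)%N then - m%:R + c%:R / m%:R else 0.

Let m0 : 0 < m%:R :> R. Proof. by rewrite ltr0n. Qed.

Let grid_ge0 (x : R) : - m%:R <= x -> 0 <= m%:R * (x + m%:R).
Proof. by move=> xl; rewrite mulr_ge0 // -lerBlDr sub0r. Qed.

Let le_grid (x k : R) : (k <= m%:R * (x + m%:R)) = (- m%:R + k / m%:R <= x).
Proof. by rewrite -ler_pdivrMl // mulrC -lerBlDr [in RHS]addrC. Qed.

Let lt_grid (x k : R) : (m%:R * (x + m%:R) < k) = (x < - m%:R + k / m%:R).
Proof. by rewrite !ltNge le_grid. Qed.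

Lemma grid_index_inside x : - m%:R <= x -> x < m%:R ->
  (grid_index x < 2 * m * m)%N.
Proof.
move=> xl xr; rewrite /grid_index xl xr /=.
have y0 := grid_ge0 xl.
have /andP [ty _] := truncn_itv y0.
rewrite -(ltr_nat R); apply: le_lt_trans ty _.
rewrite [ltRHS](_ : _ = m%:R * (2 * m%:R)); last by rewrite !natrM; ring.
by rewrite ltr_pM2l //; lra.
Qed.

Lemma grid_index_le x : (grid_index x < (2 * m * m).+1)%N.
Proof.
have [/andP [xl xr]|/negbTE xo] := boolP ((- m%:R <= x) && (x < m%:R)).
  by rewrite ltnS ltnW // grid_index_inside.
by rewrite /grid_index xo.
Qed.

Lemma grid_cellE x : grid_cell x = grid_index x :> nat.
Proof. by rewrite /grid_cell inordK // grid_index_le. Qed.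

Lemma measurable_grid_cell c : measurable (grid_cell @^-1` [set c]).
Proof.
have E x : (grid_cell x = c) = (grid_index x = c :> nat).
  apply/propext; split=> [<-|xc]; first by rewrite grid_cellE.
  by apply: val_inj; rewrite /= grid_cellE.
have [cm|cm] := ltnP c (2 * m * m).
  rewrite (_ : _ @^-1` _ = `[- m%:R + c%:R / m%:R, - m%:R + c.+1%:R / m%:R[%classic); last first.
    apply/seteqP; split=> x /=; rewrite in_itv /= E.
      rewrite /grid_index; case: ifP => [/andP [xl xr] H|_ H]; last by rewrite -H ltnn in cm.
      have y0 := grid_ge0 xl.
      by have := truncn_itv y0; rewrite H le_grid lt_grid.
    move=> /andP; rewrite -le_grid -lt_grid => -[H1 H2].
    have xl : - m%:R <= x.
      have : 0 <= m%:R * (x + m%:R) by apply: le_trans H1.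
      by rewrite pmulr_rge0 // -lerBlDr sub0r.
    have xr : x < m%:R.
      have : m%:R * (x + m%:R) < m%:R * (2 * m%:R).
        apply: lt_le_trans H2 _; rewrite mulrCA -natrM -natrM ler_nat.
        by rewrite mulnA.
      by rewrite ltr_pM2l //; lra.
    by rewrite /grid_index xl xr /=; apply: truncn_def; rewrite H1 H2.
  exact: measurable_itv.
rewrite (_ : _ @^-1` _ = ~` `[- m%:R, m%:R[%classic); last first.
  apply/seteqP; split=> x /=; rewrite in_itv /= E => H.
    by move=> /andP [xl xr]; have := grid_index_inside xl xr; rewrite H ltnNge cm.
  rewrite /grid_index ifF; last by apply/negP.
  by apply/eqP; rewrite eqn_leq cm -ltnS ltn_ord.
by apply: measurableC; exact: measurable_itv.
Qed.

(** Inside the grid the error is at most the mesh; in the tails the point is [0] and the error is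
    [|x| <= x^2 / m]. The integrable global bound serves Lipschitz functions. The dichotomy serves
    [x * h x], which need not be Lipschitz: a displacement must be weighted by [|x|] inside the
    grid, and the value [0] is used in the tails. *)
Lemma grid_error x : `|grid_point (grid_cell x) - x| <= (1 + x ^+ 2) / m%:R /\
  (`|grid_point (grid_cell x) - x| <= m%:R^-1 \/
   grid_point (grid_cell x) = 0 /\ m%:R <= `|x|).
Proof.
have x20 := sqr_ge0 x; rewrite ler_pdivlMr //.
have [/andP [xl xr]|] := boolP ((- m%:R <= x) && (x < m%:R)).
  have cl := grid_index_inside xl xr.
  have H : `|grid_point (grid_cell x) - x| <= m%:R^-1.
    rewrite /grid_point grid_cellE cl /grid_index xl xr /=.
    have y0 := grid_ge0 xl.
    have /andP := truncn_itv y0; set k := Num.truncn _.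
    rewrite -natr1 => -[H1 H2].
    rewrite -[X in `|X|](mulfK (x := m%:R)) ?gt_eqF // normrM normfV [`|m%:R|]ger0_norm ?ler0n //.
    rewrite -[leRHS]mul1r ler_wpM2r ?invr_ge0 ?ler0n //.
    rewrite !mulrDl divfK ?gt_eqF // ler_norml; nra.
  split; last by left.
  by have := ler_wpM2r (ltW m0) H; rewrite mulVf ?gt_eqF //; lra.
move=> out; have := out; rewrite negb_and -ltNge -leNgt => xo.
have xm : m%:R <= `|x|.
  by have mm := m0; case/orP: xo => H; [rewrite ler0_norm|rewrite ger0_norm]; lra.
have c0 : grid_point (grid_cell x) = 0.
  by rewrite /grid_point grid_cellE /grid_index (negbTE out) ltnn.
split; last by right.
rewrite c0 sub0r normrN; have := normr_ge0 x; rewrite -[x ^+ 2]real_normK ?num_real //.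
by set u := `|x| in xm *; nra.
Qed.

(** Inside the grid, moving the factor [x], the function [h] and the function [h'] costs [1 / m],
    [a |x| / m] and [a^2 / m]. In the tails the whole difference is at most [|x| + 2 a], with
    [|x| >= m]. Both fit under [(1 + a)^2 / m * (1 + x^2)]. *)
Lemma grid_drift_error (h h' : R -> R) (a x : R) : 0 <= a ->
  (forall x : R, is_derive x 1 h (h' x)) ->
  (forall x, `|h x| <= 1) -> (forall x, `|h' x| <= a) ->
  (forall x y, `|h' x - h' y| <= a ^+ 2 * `|x - y|) ->
  forall xi : R, xi = grid_point (grid_cell x) ->
  `|(xi * h xi - h' xi) - (x * h x - h' x)| <= (1 + a) ^+ 2 / m%:R * (1 + x ^+ 2).
Proof.
move=> a0 dh h1 ha hl xi xiE.
have [_ [near_x|[xi0 far_x]]] := grid_error x.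
  rewrite -xiE in near_x; have hx := lipschitz_derive x xi dh ha.
  rewrite (_ : _ - _ = (xi - x) * h xi + x * (h xi - h x) - (h' xi - h' x)); last by ring.
  apply: le_trans (ler_normB _ _) _; apply: le_trans (lerD (ler_normD _ _) (lexx _)) _.
  rewrite [`|_ * h xi|]normrM [`|x * _|]normrM.
  have := hl xi x; have := h1 xi.
  have i0 : 0 <= m%:R^-1 :> R by rewrite invr_ge0 ltW.
  have e0 := normr_ge0 (xi - x); have u0 := normr_ge0 x.
  rewrite -[x ^+ 2]real_normK ?num_real //.
  move: near_x hx i0 e0 u0 (normr_ge0 (h xi)); set e := `|xi - x|; set i := _^-1.
  set u := `|x|; set A := `|h xi|; set B := `|h xi - h x|; set C := `|h' xi - h' x|.
  move=> ei BE i0 e0 u0 A0 A1 CE; clearbody e i u A B C.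
  have T1 : e * A <= i by apply: le_trans ei; rewrite ler_piMr.
  have T2 : u * B <= u * (a * i) by rewrite ler_wpM2l // (le_trans BE) // ler_wpM2l.
  have T3 : C <= a ^+ 2 * i by rewrite (le_trans CE) // ler_wpM2l // sqr_ge0.
  have ai0 : 0 <= a * i by rewrite mulr_ge0.
  have a2i0 : 0 <= a ^+ 2 * i by rewrite mulr_ge0 // sqr_ge0.
  have uu : u <= 1 + u ^+ 2 by have := sqr_ge0 (u - 1); nra.
  have u20 := sqr_ge0 u.
  apply: le_trans (lerD (lerD T1 T2) T3) _.
  have := ler_wpM2r ai0 uu; have := mulr_ge0 u20 ai0; have := mulr_ge0 u20 a2i0.
  have := mulr_ge0 u20 i0; nra.
rewrite xiE xi0 mul0r sub0r.
apply: le_trans (_ : _ <= `|x| + 2 * a) _.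
  rewrite (_ : _ - _ = - (x * h x) + (h' x - h' 0)); last by ring.
  apply: le_trans (ler_normD _ _) _; rewrite normrN normrM.
  apply: lerD; first by rewrite ler_piMr.
  apply: le_trans (ler_normB _ _) _; have := ha x; have := ha 0; lra.
rewrite mulrAC ler_pdivlMr // -[x ^+ 2]real_normK ?num_real //.
have m1 : 1 <= m%:R :> R by rewrite ler1n.
move: far_x (normr_ge0 x); set u := `|x|; set M := m%:R in m1 *.
move=> Mu u0.
have MM : M <= u ^+ 2 by nra.
have uM : u * M <= u ^+ 2 by rewrite expr2 ler_wpM2l.
have := ler_wpM2l a0 MM; have := sqr_ge0 a; have := sqr_ge0 u.
move=> v0 b0 H; have := mulr_ge0 v0 b0; nra.
Qed.

Definition grid_weight c : R := fine (nu (grid_cell @^-1` [set c])).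

Lemma integrable_one_sqr :
  nu.-integrable setT (EFin \o (fun x : R => 1 + x ^+ 2)).
Proof.
apply: (integrable_normal_quadratic (c := 1)).
  by apply: measurable_funD => //; exact: measurable_funX.
by move=> x; rewrite mul1r ger0_norm // addr_ge0 ?sqr_ge0.
Qed.

Lemma Rintegral_one_sqr : \int[nu]_x (1 + x ^+ 2) = 2.
Proof.
rewrite RintegralD //.
- have nuT : fine (nu [set: measurableTypeR R]) = 1.
    by have -> : nu [set: measurableTypeR R] = 1%E by exact: integral_normal_pdf.
  by rewrite Rintegral_cst // nuT mulr1 /Rintegral normal_second_moment.
- exact: finite_measure_integrable_cst.
- apply: (integrable_normal_quadratic (c := 1)); first exact: measurable_funX.
  by move=> x; rewrite mul1r ger0_norm ?sqr_ge0 // lerDr.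
Qed.

(** The grid sum is the normal integral of [psi] at the grid point of [x], while [psi] itself
    integrates to [0]. The factor [2] is the integral of [1 + x^2]. *)
Lemma grid_normal_ibp (a : R) : 0 <= a ->
  normal_ibp grid_weight grid_point a (2 * (1 + a) ^+ 2 / m%:R).
Proof.
move=> a0 h h' dh h1 ha hl.
have ch' : continuous h'.
  move=> x; apply/cvgrPdist_le => e e0; near=> y.
  apply: le_trans (hl _ _) _.
  have : `|x - y| <= e / (a ^+ 2 + 1).
    near: y; apply: cvgr_dist_le; first exact: cvg_id.
    by rewrite divr_gt0 // ltr_wpDl ?sqr_ge0.
  rewrite ler_pdivlMr ?ltr_wpDl ?sqr_ge0 //.
  by have := normr_ge0 (x - y); set u := `|_|; nra.
have ch := continuous_of_derive dh.
pose psi x := x * h x - h' x.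
have mpsi : measurable_fun setT psi.
  apply: measurable_funB; last exact: continuous_measurable_fun.
  by apply: measurable_funM => //; exact: continuous_measurable_fun.
have Ipsi : nu.-integrable setT (EFin \o psi).
  apply: (integrable_normal_quadratic (c := a + 1)) => // x.
  apply: le_trans (ler_normB _ _) _; rewrite normrM.
  have := h1 x; have := ha x; have := sqr_ge0 (`|x| - 1).
  have := normr_ge0 x; have := normr_ge0 (h x).
  rewrite -[x ^+ 2]real_normK ?num_real //; set u := `|x|; set v := `|h x|; set w := `|h' x|.
  by move=> *; nra.
have psi0 : \int[nu]_x psi x = 0.
  rewrite (_ : \int[nu]_x psi x = - \int[nu]_x (h' x - x * h x)).
    by rewrite /Rintegral (normal_ibp_integral dh ch' h1 ha) oppr0.
  rewrite -mulN1r -RintegralZl //.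
    by apply: eq_Rintegral => x _; rewrite /psi; ring.
  have := integrableN Ipsi; apply: eq_integrable => // x _ /=.
  by rewrite /psi opprB.
have IC : nu.-integrable setT (EFin \o (fun x : R => (1 + a) ^+ 2 / m%:R * (1 + x ^+ 2))).
  have := integrableZl measurableT ((1 + a) ^+ 2 / m%:R) integrable_one_sqr.
  by apply: eq_integrable.
have Hb x : `|psi (grid_point (grid_cell x)) - psi x| <=
    (1 + a) ^+ 2 / m%:R * (1 + x ^+ 2) by apply: grid_drift_error.
have := @finite_valued_close R _ (measurableTypeR R) _ grid_cell nu
  measurable_grid_cell (fun c => psi (grid_point c)) psi _ Ipsi IC Hb.
rewrite psi0 subr0 RintegralZl //; last exact: integrable_one_sqr.
by rewrite Rintegral_one_sqr => /le_trans; apply; rewrite mulrC mulrA.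
Unshelve. all: by end_near. Qed.

End Discretization.

(** * Gaussian vectors *)

Section SameLaw.
Context {R : realType}.
Context {d1 d2 : measure_display} {T1 : measurableType d1} {T2 : measurableType d2}.
Variables (P1 : {measure set T1 -> \bar R}) (P2 : {measure set T2 -> \bar R}).
Variables (f1 : T1 -> R) (f2 : T2 -> R).
Hypothesis mf1 : measurable_fun setT f1.
Hypothesis mf2 : measurable_fun setT f2.
Hypothesis law : forall C : set (measurableTypeR R), measurable C ->
  P1 (f1 @^-1` C) = P2 (f2 @^-1` C).

Lemma same_law_ge0 (h : measurableTypeR R -> \bar R) : measurable_fun setT h ->
  (forall y, 0 <= h y)%E -> (\int[P1]_w h (f1 w) = \int[P2]_w h (f2 w))%E.
Proof.
move=> mh h0.
have e1 := @ge0_integral_pushforward _ _ T1 (measurableTypeR R) R f1 mf1 P1 setT h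
  measurableT mh (fun y _ => h0 y).
have e2 := @ge0_integral_pushforward _ _ T2 (measurableTypeR R) R f2 mf2 P2 setT h
  measurableT mh (fun y _ => h0 y).
rewrite !preimage_setT in e1 e2; rewrite -[LHS]e1 -[RHS]e2.
by apply: eq_measure_integral => A mA _; exact: law.
Qed.

Lemma same_law_integrable : P2.-integrable setT (EFin \o f2) ->
  P1.-integrable setT (EFin \o f1).
Proof.
move=> /integrableP [_ i2]; apply/integrableP; split; first exact/measurable_EFinP.
rewrite (same_law_ge0 (h := fun y => `|y%:E|%E)) //.
by apply: measurableT_comp => //; exact/measurable_EFinP.
Qed.

Lemma same_law_integral : P2.-integrable setT (EFin \o f2) ->
  (\int[P1]_w (f1 w)%:E = \int[P2]_w (f2 w)%:E)%E.
Proof.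
move=> i2; have i1 := same_law_integrable i2.
have mE : measurable_fun setT (EFin : measurableTypeR R -> \bar R).
  exact/measurable_EFinP.
have i1' : P1.-integrable (f1 @^-1` setT) (EFin \o f1) by rewrite preimage_setT.
have i2' : P2.-integrable (f2 @^-1` setT) (EFin \o f2) by rewrite preimage_setT.
have e1 := @integral_pushforward _ _ T1 (measurableTypeR R) R f1 mf1 P1 setT
  EFin mE i1' measurableT.
have e2 := @integral_pushforward _ _ T2 (measurableTypeR R) R f2 mf2 P2 setT
  EFin mE i2' measurableT.
rewrite !preimage_setT in e1 e2; rewrite -[LHS]e1 -[RHS]e2.
by apply: eq_measure_integral => A mA _; exact: law.
Qed.

End SameLaw.

(** * Measurability of Lipschitz functions of random variables *)

Section LipschitzMeasurable.
Context {R : realType} {dT : measure_display} {T : measurableType dT} {d : nat}.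
Variable X : 'I_d -> T -> R.
Hypothesis mX : forall i, measurable_fun setT (X i).

Definition grid_vector (m : nat) w : {ffun 'I_d -> 'I_(2 * m * m).+1} :=
  [ffun i => grid_cell m (X i w)].

Lemma grid_vector_fiber m c : grid_vector m @^-1` [set c] =
  \bigcap_(i in [set` enum 'I_d]) (X i @^-1` (grid_cell m @^-1` [set c i])).
Proof.
apply/seteqP; split=> w /=.
  by move=> <- i _ /=; rewrite ffunE.
move=> H; apply/ffunP => i; rewrite ffunE.
by apply: H; rewrite /= mem_enum.
Qed.

Lemma measurable_grid_vector m : (0 < m)%N ->
  forall c, measurable (grid_vector m @^-1` [set c]).
Proof.
move=> m0 c; rewrite grid_vector_fiber.
apply: fin_bigcap_measurable => // i _.
rewrite -[X in measurable X]setTI; apply: mX => //.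
exact: measurable_grid_cell.
Qed.

(** A pointwise limit of the functions obtained by rounding each coordinate to the grid; these take
    finitely many values on measurable sets. No measurable structure on ['rV[R]_d] enters. *)
Lemma measurable_lipschitz (g : 'rV[R]_d -> R) : lipschitz_l1 g ->
  measurable_fun setT (fun w => g (\row_i X i w)).
Proof.
move=> gl.
pose h (m : nat) w := g (\row_i grid_point (grid_vector m.+1 w i)).
apply: (@measurable_fun_cvg _ _ _ _ h) => [m|w _].
  exact: (measurable_finite_valued (measurable_grid_vector (ltn0Sn m))
    (fun c => g (\row_i grid_point (c i)))).
apply/cvgrPdist_le => e e0.
pose S := \sum_i (1 + X i w ^+ 2).
have S0 : 0 <= S by apply: sumr_ge0 => i _; rewrite addr_ge0 ?sqr_ge0.
near=> m.
have mS : S <= e * m.+1%:R.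
  rewrite -ler_pdivrMl //; apply: (@le_trans _ _ m%:R); last by rewrite ler_nat.
  by near: m; exact: nbhs_infty_ger.
rewrite distrC; apply: le_trans (gl _ _) _.
apply: (@le_trans _ _ (S / m.+1%:R)); last by rewrite ler_pdivrMr.
rewrite /S mulr_suml; apply: ler_sum => i _; rewrite !mxE ffunE.
by have [] := grid_error (ltn0Sn m) (X i w).
Unshelve. all: by end_near. Qed.

End LipschitzMeasurable.

Section GeneratedBorel.
Context {R : realType} {d : nat}.

(** Sets with Borel preimage form a sigma-algebra containing the open intervals. This turns equality
    of laws on the sets generated by [open] into equality of the laws of continuous real
    functions. *)
Lemma continuous_preimage_borel (f : 'rV[R]_d -> R) (C : set (measurableTypeR R)) :
  continuous f -> measurable C -> <<s open >> (f @^-1` C).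
Proof.
move=> cf mC.
have sa := @smallest_sigma_algebra ('rV[R]_d) setT open.
have H : (@RGenOpens.G R).-sigma.-measurable `<=`
    [set C : set R | <<s open >> (f @^-1` C)].
  apply: smallest_sub.
    split => /=.
    - by rewrite preimage_set0; case: sa.
    - move=> A sA; rewrite setTD preimage_setC.
      by case: sa => _ + _ => /(_ _ sA); rewrite setTD.
    - move=> F sF; rewrite preimage_bigcup.
      by case: sa => _ _; apply.
  move=> _ [a [b ->]] /=; apply: sub_sigma_algebra.
  by move/continuousP : cf; apply; exact: interval_open.
by apply: H; rewrite -RGenOpens.measurableE.
Qed.

End GeneratedBorel.

(** * Moments of independent standard Gaussians *)

Section StandardGaussianVector.
Context {R : realType} {dT : measure_display} {T : measurableType dT}.
Variables (P : probability T R) (l : nat) (G : 'I_l -> {RV P >-> R}).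
Hypothesis GH : standard_gaussian_vector G.
Local Notation nu := (@normal_prob R 0 1).

Lemma gaussian_law k (C : set (measurableTypeR R)) : measurable C ->
  P (G k @^-1` C) = nu C.
Proof. by move=> mC; have [_ H] := GH; exact: (H k C mC). Qed.

Lemma integrable_gaussian_comp (f : R -> R) (k : 'I_l) :
  measurable_fun setT f -> nu.-integrable setT (EFin \o f) ->
  P.-integrable setT (EFin \o (fun w => f (G k w))).
Proof.
move=> mf If; have mG := @measurable_funPT _ _ _ _ (G k).
apply: (@same_law_integrable R _ _ T (measurableTypeR R) P nu (fun w => f (G k w)) f) => //.
- exact: measurableT_comp.
- move=> C mC; apply: (gaussian_law k (C := f @^-1` C)).
  by rewrite -[X in measurable X]setTI; apply: mf.
Qed.

Lemma integral_gaussian_comp (f : R -> R) (k : 'I_l) :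
  measurable_fun setT f -> nu.-integrable setT (EFin \o f) ->
  (\int[P]_w (f (G k w))%:E = \int[nu]_x (f x)%:E)%E.
Proof.
move=> mf If; have mG := @measurable_funPT _ _ _ _ (G k).
apply: (@same_law_integral R _ _ T (measurableTypeR R) P nu (fun w => f (G k w)) f) => //.
- exact: measurableT_comp.
- move=> C mC; apply: (gaussian_law k (C := f @^-1` C)).
  by rewrite -[X in measurable X]setTI; apply: mf.
Qed.

Lemma normal_integrable_id : nu.-integrable setT (EFin \o (id : R -> R)).
Proof.
apply: (integrable_normal_quadratic (c := 1)); first exact: measurable_id.
move=> x; rewrite mul1r -[x ^+ 2]real_normK ?num_real //.
by have := sqr_ge0 (`|x| - 1); nra.
Qed.

Lemma normal_integral_id : (\int[nu]_x x%:E = 0)%E.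
Proof.
have c0 : continuous (cst 0 : R -> R) by move=> x; exact: cvg_cst.
have := @normal_ibp_integral R (cst (-1)) (cst 0) 1 (fun x => is_derive_cst _ _ _) c0.
move=> /(_ _ _) H; rewrite -[RHS]H => [|x|x].
- by apply: eq_integral => x _; congr (_%:E); rewrite /=; ring.
- by rewrite /= normrN normr1.
- by rewrite /= normr0.
Qed.

Lemma integrable_gaussian k : P.-integrable setT (EFin \o G k).
Proof.
exact: (integrable_gaussian_comp k (@measurable_id _ _ _) normal_integrable_id).
Qed.

Lemma integral_gaussian k : (\int[P]_w (G k w)%:E = 0)%E.
Proof.
rewrite -normal_integral_id.
exact: (integral_gaussian_comp k (@measurable_id _ _ _) normal_integrable_id).
Qed.

Lemma normal_integrable_sqr : nu.-integrable setT (EFin \o (fun x : R => x ^+ 2)).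
Proof.
apply: (integrable_normal_quadratic (c := 1)); first exact: measurable_funX.
by move=> x; rewrite mul1r ger0_norm ?sqr_ge0 // lerDr.
Qed.

Lemma gaussian_sqr k : P.-integrable setT (EFin \o (fun w => G k w ^+ 2)) /\
  (\int[P]_w (G k w ^+ 2)%:E = 1)%E.
Proof.
have m2 : measurable_fun setT (fun x : R => x ^+ 2) by exact: measurable_funX.
split; first exact: (integrable_gaussian_comp k m2 normal_integrable_sqr).
by rewrite (integral_gaussian_comp k m2 normal_integrable_sqr) normal_second_moment.
Qed.

Local Notation RR := (measurableTypeR R * measurableTypeR R)%type.

Lemma normal_prod_integrable : (nu \x nu)%E.-integrable setT
  (EFin \o (fun z : RR => z.1 * z.2)).
Proof.
have mf : measurable_fun setT (EFin \o (fun z : RR => z.1 * z.2)).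
  apply/measurable_EFinP; apply: measurable_funM;
    [exact: measurable_fst|exact: measurable_snd].
apply/(integrable12ltyP _ _ mf).
have iN := normal_integrable_id; have /integrableP [mi li] := iN.
have i2 : (\int[nu]_x `|x%:E| < +oo)%E by exact: li.
have E (x : measurableTypeR R) : (\int[nu]_y `|(EFin \o (fun z : RR => z.1 * z.2)%R) (x, y)| =
    `|x%:E| * \int[nu]_y `|y%:E|)%E.
  rewrite -ge0_integralZl //; last first.
    by apply: measurableT_comp => //; exact/measurable_EFinP.
  by apply: eq_integral => y _; rewrite /= normrM EFinM.
under eq_integral do rewrite E.
rewrite ge0_integralZr //.
- apply: lte_mul_pinfty => //; first exact: integral_ge0.
  by rewrite ge0_fin_numE //; exact: integral_ge0.
- by apply: measurableT_comp => //; exact/measurable_EFinP.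
- exact: integral_ge0.
Qed.

Lemma normal_prod_integral : (\int[nu \x nu]_z ((z : RR).1 * z.2)%:E = 0)%E.
Proof.
rewrite -(integral12_prod_meas1 normal_prod_integrable).
apply: integral0_eq => x _ /=.
transitivity (x%:E * \int[nu]_y y%:E)%E; last by rewrite normal_integral_id mule0.
by rewrite -integralZl //; exact: normal_integrable_id.
Qed.

(** By independence the law of the pair agrees with [nu \x nu] on rectangles, hence everywhere, and
    Fubini reduces the expectation of the product to the vanishing mean. *)
Lemma gaussian_prod k k' : k != k' ->
  P.-integrable setT (EFin \o (fun w => G k w * G k' w)) /\
  (\int[P]_w (G k w * G k' w)%:E = 0)%E.
Proof.
move=> kk.
have mG i : measurable_fun setT (G i : T -> measurableTypeR R).
  exact (@measurable_funPT _ _ _ _ (G i)).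
have mp : measurable_fun setT (fun w => (G k w, G k' w) : RR).
  by apply/measurable_fun_pairP; split; exact: mG.
pose pm := isMeasurableFun.Build _ _ _ _ _ mp.
pose pp : {mfun T >-> RR} := HB.pack (fun w => (G k w, G k' w) : RR) pm.
have U := @product_measure_unique _ _ (measurableTypeR R) (measurableTypeR R) R nu nu
  (distribution P pp).
have mf2 : measurable_fun setT (fun z : RR => z.1 * z.2).
  by apply: measurable_funM; [exact: measurable_fst|exact: measurable_snd].
have law (C : set (measurableTypeR R)) : measurable C ->
    P ((fun w => G k w * G k' w) @^-1` C) = (nu \x nu)%E ((fun z : RR => z.1 * z.2) @^-1` C).
  move=> mC; rewrite U //.
    move=> A B mA mB.
    have [ind _] := GH.
    have := ind [:: k; k'] (fun i => if i == k then A else B).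
    rewrite /= inE kk => /(_ isT).
    have mAB i : measurable (if i == k then A else B) by case: ifP.
    move=> /(_ mAB).
    rewrite !big_cons big_nil mule1 eqxx eq_sym (negbTE kk) !gaussian_law // => <-.
    congr (P _); apply/seteqP; split=> w /=.
      move=> [wA wB] i /=; rewrite !inE => /orP [/eqP ->|/eqP ->].
        by rewrite eqxx.
      by rewrite eq_sym (negbTE kk).
    move=> H; split.
      by have := H k; rewrite /= inE eqxx => /(_ isT).
    by have := H k'; rewrite /= !inE eqxx orbT eq_sym (negbTE kk) => /(_ isT).
  by rewrite -[X in measurable X]setTI; apply: mf2.
have mf1 : measurable_fun setT (fun w => G k w * G k' w).
  by apply: measurable_funM; exact: measurable_funPT.
split.
  exact: (@same_law_integrable R _ _ T _ P _ _ _ mf1 mf2 law normal_prod_integrable).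
rewrite -normal_prod_integral.
exact: (@same_law_integral R _ _ T _ P _ _ _ mf1 mf2 law normal_prod_integrable).
Qed.

End StandardGaussianVector.

Section FiniteSums.
Context {R : realType} {dT : measure_display} {T : measurableType dT}.
Variable P : probability T R.
Local Notation integrable f := (P.-integrable setT (EFin \o f)).

Lemma integrableD_EFin (f g : T -> R) : integrable f -> integrable g ->
  integrable (fun w => f w + g w).
Proof.
by move=> If Ig; have := integrableD measurableT If Ig; apply: eq_integrable.
Qed.

Lemma integrableZ_EFin (c : R) (f : T -> R) : integrable f ->
  integrable (fun w => c * f w).
Proof.
by move=> If; have := integrableZl measurableT c If; apply: eq_integrable.
Qed.

Lemma integrable_cst_EFin (c : R) : integrable (fun _ : T => c).
Proof. exact: finite_measure_integrable_cst. Qed.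

Lemma integrable_sum_EFin (I : Type) (r : seq I) (f : I -> T -> R) :
  (forall i, integrable (f i)) -> integrable (fun w => \sum_(i <- r) f i w).
Proof.
move=> If; have := @integrable_sum _ _ _ P setT measurableT _ r xpredT
  (fun i w => (f i w)%:E) (fun i _ => If i).
by apply: eq_integrable => // w _ /=; rewrite sumEFin.
Qed.

Lemma Rintegral_sum (I : Type) (r : seq I) (f : I -> T -> R) :
  (forall i, integrable (f i)) ->
  \int[P]_w (\sum_(i <- r) f i w) = \sum_(i <- r) \int[P]_w f i w.
Proof.
move=> If; elim: r => [|i r IH].
  rewrite big_nil; under eq_Rintegral do rewrite big_nil.
  by rewrite Rintegral_cst // mul0r.
rewrite big_cons -IH; under eq_Rintegral do rewrite big_cons.
by rewrite RintegralD //; exact: integrable_sum_EFin.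
Qed.

Lemma Rintegral_prob_cst (c : R) : \int[P]_w (fun _ : T => c) w = c.
Proof.
rewrite Rintegral_cst // -[RHS]mulr1; congr (_ * _).
exact: (congr1 fine (probability_setT P)).
Qed.

Lemma EFin_Rintegral (f : T -> R) : integrable f ->
  (\int[P]_w (f w)%:E)%E = (\int[P]_w f w)%:E.
Proof. by move=> If; rewrite /Rintegral fineK // integrable_fin_num. Qed.

End FiniteSums.

(** * Linear images of standard Gaussians and their discretization *)

Section AffineGaussian.
Context {R : realType} {dT : measure_display} {T : measurableType dT}.
Variables (P : probability T R) (l : nat) (G : 'I_l -> {RV P >-> R}).
Hypothesis GH : standard_gaussian_vector G.
Variables (d : nat) (A : 'M[R]_(l, d)).
Local Notation nu := (@normal_prob R 0 1).
Local Notation integrable f := (P.-integrable setT (EFin \o f)).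

Definition gauss_image w : 'rV[R]_d := random_vector G w *m A.

Lemma gauss_imageE w i : gauss_image w 0 i = \sum_k A k i * G k w.
Proof. by rewrite mxE; apply: eq_bigr => k _; rewrite mxE mulrC. Qed.

Lemma integrable_gauss_image i : integrable (fun w => gauss_image w 0 i).
Proof.
under [fun w => _]eq_fun do rewrite gauss_imageE.
by apply: integrable_sum_EFin => k; apply/integrableZ_EFin/integrable_gaussian.
Qed.

Lemma mean_gauss_image i : \int[P]_w gauss_image w 0 i = 0.
Proof.
under eq_Rintegral do rewrite gauss_imageE.
rewrite Rintegral_sum => [|k]; last by apply/integrableZ_EFin/integrable_gaussian.
rewrite big1 // => k _; rewrite RintegralZl //; last exact: integrable_gaussian.
by rewrite /Rintegral integral_gaussian // mulr0.
Qed.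

Lemma integrable_gauss_mul k k' : integrable (fun w => G k w * G k' w).
Proof.
have [<-|kk] := eqVneq k k'; last by case: (gaussian_prod GH kk).
have [H _] := gaussian_sqr GH k.
by move: H; apply: eq_integrable => // w _ /=; rewrite expr2.
Qed.

Lemma mean_gauss_mul k k' : \int[P]_w (G k w * G k' w) = (k == k')%:R.
Proof.
have [<-|kk] := eqVneq k k'.
  have [_ H] := gaussian_sqr GH k.
  by rewrite /Rintegral; under eq_integral do rewrite -expr2; rewrite H.
by have [_ H] := gaussian_prod GH kk; rewrite /Rintegral H.
Qed.

Lemma gauss_image_mulE w i j : gauss_image w 0 i * gauss_image w 0 j =
  \sum_k \sum_k' (A k i * A k' j) * (G k w * G k' w).
Proof.
rewrite !gauss_imageE mulr_suml; apply: eq_bigr => k _.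
by rewrite mulr_sumr; apply: eq_bigr => k' _; rewrite mulrACA.
Qed.

Lemma integrable_gauss_image_mul i j :
  integrable (fun w => gauss_image w 0 i * gauss_image w 0 j).
Proof.
under [fun w => _]eq_fun do rewrite gauss_image_mulE.
apply: integrable_sum_EFin => k; apply: integrable_sum_EFin => k'.
exact/integrableZ_EFin/integrable_gauss_mul.
Qed.

Lemma mean_gauss_image_mul i j :
  \int[P]_w (gauss_image w 0 i * gauss_image w 0 j) = (A^T *m A) i j.
Proof.
under eq_Rintegral do rewrite gauss_image_mulE.
rewrite Rintegral_sum => [|k]; last first.
  by apply: integrable_sum_EFin => k'; exact/integrableZ_EFin/integrable_gauss_mul.
rewrite mxE; apply: eq_bigr => k _.
rewrite Rintegral_sum => [|k']; last exact/integrableZ_EFin/integrable_gauss_mul.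
rewrite (bigD1 k) //= RintegralZl //; last exact: integrable_gauss_mul.
rewrite mean_gauss_mul eqxx mulr1 big1 ?addr0 ?mxE // => k' kk.
rewrite RintegralZl //; last exact: integrable_gauss_mul.
by rewrite mean_gauss_mul eq_sym (negbTE kk) mulr0.
Qed.

Variables (g : 'rV[R]_d -> R).
Hypothesis g_lip : lipschitz_l1 g.

Lemma measurable_lipschitz_gauss_image : measurable_fun setT (fun w => g (gauss_image w)).
Proof.
have mG i : measurable_fun setT (fun w => gauss_image w 0 i).
  by apply/measurable_EFinP; apply: measurable_int; exact: (integrable_gauss_image i).
rewrite (_ : (fun w => _) = (fun w => g (\row_i gauss_image w 0 i))).
  exact: measurable_lipschitz.
by apply/funext => w; congr g; apply/rowP => i; rewrite mxE.
Qed.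

Lemma integrable_lipschitz_gauss_image : integrable (fun w => g (gauss_image w)).
Proof.
have Ib : integrable (fun w => `|g 0| + \sum_i `|gauss_image w 0 i|).
  apply: integrableD_EFin; first exact: integrable_cst_EFin.
  apply: integrable_sum_EFin => i.
  by have := integrable_abse (integrable_gauss_image i); apply: eq_integrable.
apply: (le_integrable measurableT _ _ Ib).
  by apply/measurable_EFinP; exact: measurable_lipschitz_gauss_image.
move=> w _ /=; rewrite lee_fin [leRHS]ger0_norm ?addr_ge0 ?sumr_ge0 //.
rewrite -[X in `|X|](subrK (g 0)) addrC; apply: le_trans (ler_normD _ _) _.
rewrite lerD2l; apply: le_trans (g_lip _ _) _.
by apply: ler_sum => i _; rewrite [(0 : 'rV[R]_d) 0 i]mxE subr0.
Qed.

Variable m : nat.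
Hypothesis m_gt0 : (0 < m)%N.

Lemma grid_vector_weight xi :
  fine (P (grid_vector G m @^-1` [set xi])) = weight (@grid_weight R m) xi.
Proof.
rewrite grid_vector_fiber.
have [ind law] := GH.
rewrite (ind (enum 'I_l) (fun k => grid_cell m @^-1` [set xi k])); first last.
- by move=> k; exact: measurable_grid_cell.
- exact: enum_uniq.
rewrite /weight /grid_weight.
have E k : P (G k @^-1` (grid_cell m @^-1` [set xi k])) =
    (fine (nu (grid_cell m @^-1` [set xi k])))%:E.
  rewrite -(gaussian_law GH k (measurable_grid_cell m_gt0 (xi k))) fineK //.
  apply: fin_num_measure; rewrite -[X in measurable X]setTI.
  by apply: (@measurable_funPT _ _ _ _ (G k)) => //; exact: measurable_grid_cell.
rewrite (eq_bigr _ (fun k _ => E k)) prodEFin /=.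
by rewrite big_enum.
Qed.

(** Rounding variable [k] moves the image by at most the sum over [j] of [|A k j|] times
    [(1 + G_k^2) / m], whose expectation involves [1 + 1 = 2]. *)
Lemma gauss_image_discretize :
  `|\sum_xi weight (@grid_weight R m) xi * g (linear_image (@grid_point R m) A xi) -
    \int[P]_w g (gauss_image w)| <= (\sum_k \sum_j `|A k j|) * (2 / m%:R).
Proof.
have mG i : measurable_fun setT (G i) := @measurable_funPT _ _ _ _ (G i).
pose b w := \sum_k (\sum_j `|A k j|) / m%:R * (1 + G k w ^+ 2).
have Iq k : integrable (fun w => 1 + G k w ^+ 2).
  apply: integrableD_EFin; first exact: integrable_cst_EFin.
  by case: (gaussian_sqr GH k).
have Ib : integrable b.
  by apply: integrable_sum_EFin => k; exact: integrableZ_EFin.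
have bE : \int[P]_w b w = (\sum_k \sum_j `|A k j|) * (2 / m%:R).
  rewrite Rintegral_sum => [|k]; last exact: integrableZ_EFin.
  rewrite mulr_suml; apply: eq_bigr => k _; rewrite RintegralZl //.
  have [I2 E2] := gaussian_sqr GH k.
  rewrite RintegralD //; last exact: integrable_cst_EFin.
  rewrite (Rintegral_prob_cst P 1) /Rintegral E2 /=; ring.
have H w : `|g (linear_image (@grid_point R m) A (grid_vector G m w)) -
    g (gauss_image w)| <= b w.
  apply: le_trans (g_lip _ _) _.
  apply: (@le_trans _ _ (\sum_j \sum_k `|A k j| * ((1 + G k w ^+ 2) / m%:R))).
    apply: ler_sum => j _; rewrite gauss_imageE mxE -sumrB.
    apply: le_trans (ler_norm_sum _ _ _) _; apply: ler_sum => k _.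
    rewrite mxE ffunE [_ * A k j]mulrC -mulrBr normrM ler_wpM2l //.
    by have [] := grid_error m_gt0 (G k w).
  rewrite exchange_big /=; apply: ler_sum => k _; rewrite -mulr_suml.
  by rewrite le_eqVlt; apply/orP; left; apply/eqP; ring.
have := finite_valued_close (measurable_grid_vector mG m_gt0)
  (F := fun xi => g (linear_image (@grid_point R m) A xi))
  integrable_lipschitz_gauss_image Ib H.
by under eq_bigr do rewrite grid_vector_weight; rewrite bE.
Qed.

End AffineGaussian.

Section CenteredGaussianVector.
Context {R : realType} {dQ : measure_display} {TQ : measurableType dQ}.
Variables (Q : probability TQ R) (d : nat) (N : 'I_d -> {RV Q >-> R}) (sigma : 'I_d -> R).
Hypothesis NH : centered_gaussian_vector N
  (\matrix_(i < d, j < d) if i == j then sigma i else 0).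

(** The definition gives the law of [m + G A]. Equality of laws passes to moments: the vanishing
    mean forces [m = 0], and the covariance identifies [A^T *m A], with no assumption on the rank or
    shape of [A]. *)
Lemma centered_gaussian_image :
  exists (l : nat) (dT : measure_display) (T : measurableType dT)
    (P : probability T R) (G : 'I_l -> {RV P >-> R}) (A : 'M[R]_(l, d)),
    [/\ standard_gaussian_vector G, A^T *m A = diag_mx (\row_i sigma i) &
      forall g : 'rV[R]_d -> R, continuous g -> lipschitz_l1 g ->
        'E_Q[g \o random_vector N]%E = (\int[P]_w g (gauss_image G A w))%:E].
Proof.
have [[l [dT [T [P [G [m [A [GH law]]]]]]]] N0 NS] := NH.
exists l, dT, T, P, G, A.
pose Y w := m + random_vector G w *m A.
have mN i : measurable_fun setT (N i) := @measurable_funPT _ _ _ _ (N i).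
have mGA i : measurable_fun setT (fun w => gauss_image G A w 0 i).
  by apply/measurable_EFinP; apply: measurable_int; exact: (integrable_gauss_image GH A i).
have transfer (f : 'rV[R]_d -> R) : continuous f ->
    measurable_fun setT (fun w => f (random_vector N w)) ->
    measurable_fun setT (fun w => f (Y w)) ->
    P.-integrable setT (EFin \o (fun w => f (Y w))) ->
    (\int[Q]_w (f (random_vector N w))%:E = \int[P]_w (f (Y w))%:E)%E.
  move=> cf mf1 mf2 If.
  apply: (same_law_integral (P1 := Q) (P2 := P) mf1 mf2) => // C mC.
  exact: (law (f @^-1` C) (continuous_preimage_borel cf mC)).
have proj_cont i : continuous (fun x : 'rV[R]_d => x 0 i).
  exact: coord_continuous.
have YE i : (fun w => Y w 0 i) = (fun w => m 0 i + gauss_image G A w 0 i).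
  by apply/funext => w; rewrite /Y mxE.
have m0 : m = 0.
  apply/rowP => i; rewrite mxE.
  have IY : P.-integrable setT (EFin \o (fun w => Y w 0 i)).
    rewrite YE; apply: integrableD_EFin; first exact: integrable_cst_EFin.
    exact: integrable_gauss_image.
  have H := transfer (fun x => x 0 i) (proj_cont i).
  have : (\int[Q]_w (random_vector N w 0 i)%:E = 0)%E.
    by rewrite -(N0 i) unlock; apply: eq_integral => w _; rewrite mxE.
  rewrite H ?YE //.
  - rewrite (EFin_Rintegral (P := P)) -?YE // YE RintegralD //; last 2 first.
    + exact: integrable_cst_EFin.
    + exact: integrable_gauss_image.
    by rewrite (Rintegral_prob_cst P (m 0 i)) mean_gauss_image // addr0 => -[].
  - by under eq_fun do rewrite mxE; exact: mN.
  - by apply: measurable_funD.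
  - by rewrite -YE.
have {YE} YE w : Y w = gauss_image G A w by rewrite /Y m0 add0r.
split=> //.
- apply/matrixP => i j; rewrite -(mean_gauss_image_mul GH).
  have := NS i j; rewrite mxE unlock !N0 /= => cov_eq.
  have H := transfer (fun x => x 0 i * x 0 j).
  have c2 : continuous (fun x : 'rV[R]_d => x 0 i * x 0 j).
    by move=> x; exact: (continuousM (proj_cont i x) (proj_cont j x)).
  have Iij := integrable_gauss_image_mul GH A i j.
  have EY : (fun w => Y w 0 i * Y w 0 j) =
      (fun w => gauss_image G A w 0 i * gauss_image G A w 0 j).
    by apply/funext => w; rewrite !YE.
  have {}H : (\int[Q]_w (random_vector N w 0 i * random_vector N w 0 j)%:E =
      \int[P]_w (Y w 0 i * Y w 0 j)%:E)%E.
    apply: H => //; rewrite ?EY //.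
    + by under eq_fun do rewrite !mxE; exact: measurable_funM.
    + exact: measurable_funM.
  have : (\int[P]_w (gauss_image G A w 0 i * gauss_image G A w 0 j)%:E =
      (if i == j then sigma i else 0)%:E)%E.
    rewrite -cov_eq unlock; under eq_integral do rewrite -!YE; rewrite -H.
    apply: eq_integral => w _; rewrite !mxE /=.
    by rewrite -[in LHS](subr0 (N i w)) -[in LHS](subr0 (N j w)).
  rewrite EFin_Rintegral // => -[->]; rewrite !mxE.
  by case: eqP.
- move=> g cg lg.
  have gY : (fun w => g (Y w)) = (fun w => g (gauss_image G A w)).
    by apply/funext => w; rewrite YE.
  rewrite -EFin_Rintegral; last exact: integrable_lipschitz_gauss_image.
  transitivity (\int[P]_w (g (Y w))%:E)%E; last by apply: eq_integral => w _; rewrite YE.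
  rewrite unlock; apply: (transfer g cg); rewrite ?gY.
  + exact: measurable_lipschitz.
  + exact: measurable_lipschitz_gauss_image.
  + exact: integrable_lipschitz_gauss_image.
Qed.

End CenteredGaussianVector.

(** * Rademacher matrices *)

Section RademacherMatrix.
Context {R : realType} {dT : measure_display} {T : measurableType dT}.
Variables (P : probability T R) (X : nat -> nat -> {RV P >-> R}) (n : nat).
Hypothesis XH : iid_rademacher X.

Let mX i j : measurable_fun setT (X i j) := @measurable_funPT _ _ _ _ (X i j).

Definition sign_cube w : cube n := [ffun e : 'I_n * 'I_n => X e.1 e.2 w == -1].

(** Independence is stated for a family of sets indexed by all pairs of integers, so positions
    outside the block receive [setT]. The positive sign is encoded by the complement of [-1], which
    makes the description of the fibres of [sign_cube] exact, without discarding a null set. *)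
Definition sign_event (c : cube n) (p : nat * nat) : set R :=
  if [pick e : 'I_n * 'I_n | (e.1 == p.1 :> nat) && (e.2 == p.2 :> nat)] is Some e
  then if c e then [set -1] else ~` [set -1] else setT.

Lemma sign_eventE c (e : 'I_n * 'I_n) :
  sign_event c (val e.1, val e.2) = if c e then [set -1] else ~` [set -1].
Proof.
rewrite /sign_event; case: pickP => /= [f /andP [/eqP f1 /eqP f2]|/(_ e)].
  by rewrite (_ : f = e) //; case: f e f1 f2 => [? ?] [? ?] /= /val_inj -> /val_inj ->.
by rewrite !eqxx.
Qed.

Lemma measurable_sign_event c p : measurable (sign_event c p).
Proof.
rewrite /sign_event; case: pickP => // e _.
by case: (c e); [exact: measurable_set1 | apply: measurableC; exact: measurable_set1].
Qed.

Definition positions : seq (nat * nat) :=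
  [seq (val e.1, val e.2) | e <- enum {: 'I_n * 'I_n}].

Lemma sign_cube_fiber c : sign_cube @^-1` [set c] =
  \bigcap_(p in [set` positions]) (X p.1 p.2 @^-1` sign_event c p).
Proof.
apply/seteqP; split=> w /=.
- move=> <- p /= /mapP [e _ ->]; rewrite /= sign_eventE ffunE.
  by case: eqP.
- move=> H; apply/ffunP => e; rewrite ffunE.
  have /= := H (val e.1, val e.2); rewrite map_f ?mem_enum // sign_eventE => /(_ isT).
  by case: (c e) => /=; [move=> ->; rewrite eqxx | move/eqP/negbTE].
Qed.

Lemma measurable_sign_cube c : measurable (sign_cube @^-1` [set c]).
Proof.
rewrite sign_cube_fiber; apply: fin_bigcap_measurable => //.
move=> p _; rewrite -[X in measurable X]setTI.
by apply: mX => //; exact: measurable_sign_event.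
Qed.

Lemma sign_cube_uniform c : fine (P (sign_cube @^-1` [set c])) = #|cube n|%:R^-1.
Proof.
have [indep half] := XH.
rewrite sign_cube_fiber indep; first last.
- exact: measurable_sign_event.
- rewrite map_inj_uniq ?enum_uniq // => -[i j] [i' j'] /= [].
  by move=> /val_inj -> /val_inj ->.
have H (e : 'I_n * 'I_n) :
    P (X (val e.1) (val e.2) @^-1` sign_event c (val e.1, val e.2)) = (2^-1)%:E.
  rewrite sign_eventE; have [_ hm] := half e.1 e.2; case: (c e); first exact: hm.
  rewrite -preimage_setC probability_setC ?hm.
    by rewrite -EFinB; congr (_%:E); lra.
  by rewrite -[X in measurable X]setTI; apply: mX => //; exact: measurable_set1.
rewrite big_map (eq_bigr _ (fun e _ => H e)) prodEFin /= big_const_seq.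
by rewrite count_predT -cardE iter_mulr_1 exprVn -natrX card_ffun card_bool.
Qed.

Lemma bernoulli_mx_ae : \forall w \ae P, bernoulli_mx X n w = smx (sign_cube w).
Proof.
have : \forall w \ae P, forall i j, X i j w = 1 \/ X i j w = -1.
  apply: ae_foralln => i; apply: ae_foralln => j.
  have [_ /(_ i j) [h1 hm]] := XH.
  have m1 (x : R) : measurable (X i j @^-1` [set x]).
    by rewrite -[X in measurable X]setTI; apply: mX => //; exact: measurable_set1.
  exists (~` (X i j @^-1` [set 1] `|` X i j @^-1` [set -1])); split.
  - by apply: measurableC; exact: measurableU.
  - rewrite /= probability_setC; last exact: measurableU.
    rewrite (_ : P _ = 1%:E) ?subee //.
    transitivity (P (X i j @^-1` [set 1%R]) + P (X i j @^-1` [set (-1)%R]))%E.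
      apply: measureU => //.
      apply/seteqP; split=> w //= [] -> /eqP; rewrite -subr_eq0 opprK.
      by rewrite (_ : 1 + 1 = 2%:R) ?pnatr_eq0.
    by rewrite h1 hm -EFinD; congr (_%:E); lra.
  - by move=> w /= H1 H2; apply: H1; case: H2 => H; [left | right].
apply: filterS => w H; apply/matrixP => i j; rewrite !mxE /sgn ffunE /=.
have [->|->] := H i j; last by rewrite eqxx expr1.
by rewrite -[X in X == _]opprK eqr_opp eq_sym -subr_eq0 opprK (_ : 1 + 1 = 2%:R) ?pnatr_eq0.
Qed.

Lemma integral_bernoulli_mx (f : 'M[R]_n -> R) :
  measurable_fun setT (fun w => f (bernoulli_mx X n w)) ->
  'E_P[fun w => f (bernoulli_mx X n w)]%E = (mean (fun c : cube n => f (smx c)))%:E.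
Proof.
move=> mf; have mc := measurable_sign_cube.
have mg := measurable_finite_valued mc (fun c => f (smx c)).
rewrite unlock (ae_eq_integral (fun w => (f (smx (sign_cube w)))%:E)) //; first last.
- by apply: filterS bernoulli_mx_ae => w -> _.
- exact/measurable_EFinP.
- exact/measurable_EFinP.
have := Rintegral_finite_valued mc P (fun c => f (smx c)).
have := integrable_finite_valued mc P (fun c => f (smx c)).
move=> /integrable_fin_num /fineK <- //; rewrite /Rintegral => ->; congr (_%:E).
by under eq_bigr do rewrite sign_cube_uniform; rewrite -mulr_sumr mulrC.
Qed.

Lemma measurable_trace_pow q : measurable_fun setT (trace_pow X n q).
Proof.
have mB i j : measurable_fun setT (fun w => bernoulli_mx X n w i j).
  by under eq_fun do rewrite mxE; apply: measurable_funM.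
have mpow i j : measurable_fun setT (fun w => (bernoulli_mx X n w ^+ q) i j).
  elim: q i j => [|q IH] i j; first exact: measurable_cst.
  under eq_fun do rewrite exprS mxE.
  by apply: measurable_sum => k; apply: measurable_funM.
by rewrite /trace_pow; apply: measurable_sum => k.
Qed.

Lemma expectation_trace_pow q :
  fine 'E_P[trace_pow X n q]%E = mean (@trpow R n q).
Proof.
have := @integral_bernoulli_mx (fun B => \tr (B ^+ q)) (@measurable_trace_pow q).
by move=> ->.
Qed.

Lemma expectation_centered_traces d (q : 'I_d -> nat) (g : 'rV[R]_d -> R) :
  lipschitz_l1 g ->
  'E_P[g \o centered_traces X q n]%E = (mean (fun c : cube n => g (trv q c)))%:E.
Proof.
move=> gl.
pose f (B : 'M[R]_n) := g (\row_i (\tr (B ^+ q i) - mean (@trpow R n (q i)))).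
have E w : g (centered_traces X q n w) = f (bernoulli_mx X n w).
  by congr g; apply/rowP => i; rewrite !mxE expectation_trace_pow.
rewrite (_ : _ \o _ = fun w => f (bernoulli_mx X n w)); last by apply/funext.
apply: integral_bernoulli_mx.
rewrite (_ : (fun w => _) = (fun w => g (centered_traces X q n w))); last by apply/funext.
apply: measurable_lipschitz gl => i.
by apply: measurable_funB => //; exact: measurable_trace_pow.
Qed.

End RademacherMatrix.

(** * Conclusion *)

Section GridWeights.
Context {R : realType} (m : nat).
Hypothesis m_gt0 : (0 < m)%N.

Lemma grid_weight_ge0 c : 0 <= @grid_weight R m c.
Proof. exact: fine_ge0. Qed.

Lemma grid_weight_sum1 : \sum_c @grid_weight R m c = 1.
Proof.
have := @Rintegral_finite_valued R _ (measurableTypeR R) _ (grid_cell m)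
  (measurable_grid_cell m_gt0) (@normal_prob R 0 1) (fun=> 1).
rewrite (@Rintegral_prob_cst R _ _ (@normal_prob R 0 1) 1) => ->.
by apply: eq_bigr => c _; rewrite mulr1.
Qed.

End GridWeights.

Section GaussianComparison.
Context {R : realType} {d : nat}.

Lemma d4_test_continuous (g : 'rV[R]_d -> R) : d4_test g -> continuous g.
Proof. by move=> [[_ H] _]; exact: (H [::]). Qed.

Lemma d4_test_lipschitz (g : 'rV[R]_d -> R) : d4_test g -> lipschitz_l1 g.
Proof.
move=> /d4_test_partials [dr bnd] u v; apply: lipschitz_partials => [i y|i x].
- exact: (dr [::]).
- exact: (bnd [:: i]).
Qed.

Lemma gaussian_comparison (T : finType) (F : T -> 'rV[R]_d) (sigma : 'I_d -> R) (e : R)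
    dQ (TQ : measurableType dQ) (Q : probability TQ R) (N : 'I_d -> {RV Q >-> R})
    (g : 'rV[R]_d -> R) :
  (0 < #|T|)%N -> stein_bound F sigma e ->
  centered_gaussian_vector N (\matrix_(i < d, j < d) if i == j then sigma i else 0) ->
  d4_test g ->
  exists2 y : R, 'E_Q[g \o random_vector N]%E = y%:E &
    `|mean (fun w => g (F w)) - y| <= 2 * d%:R * e.
Proof.
move=> T_gt0 Fst NH gt; have [dr bnd] := d4_test_partials gt.
have [l [dT [T' [P [G [A [GH AA EN]]]]]]] := centered_gaussian_image NH.
have glip := d4_test_lipschitz gt.
eexists; first exact: EN (d4_test_continuous gt) glip.
set y := \int[P]_w _.
pose S := \sum_i \sum_k `|A k i|; pose S' := \sum_k \sum_j `|A k j|; pose a := S'.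
have a_ge0 : 0 <= a by apply: sumr_ge0 => k _; apply: sumr_ge0.
have A_le k : \sum_j `|A k j| <= a.
  rewrite /a /S' (bigD1 k) //= lerDl; apply: sumr_ge0 => i _; exact: sumr_ge0.
have lip1 i : lipschitz_l1 (partial i g).
  move=> u v; apply: lipschitz_partials => [j z|j z]; first exact: (dr [:: i]).
  exact: (bnd [:: j; i]).
have lip2 i j : lipschitz_l1 (partial j (partial i g)).
  move=> u v; apply: lipschitz_partials => [k z|k z]; first exact: (dr [:: j; i]).
  exact: (bnd [:: k; j; i]).
(* The first term is [2 * S] times the error [2 (1 + a)^2] of [grid_normal_ibp], the second comes
   from [gauss_image_discretize]. The constant [c] depends on [A] but not on [m], so [c / m] is made
   smaller than any [eps]. *)
pose c := 4 * S * (1 + a) ^+ 2 + 2 * S'.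
have H m : (0 < m)%N -> `|mean (fun w => g (F w)) - y| <=
    2 * d%:R * e + c / m%:R.
  move=> m0.
  have B1 := @smart_path R d g (fun i => partial i g)
    (fun u v => taylor_partials u v (fun i x => dr [::] i x isT) lip1)
    (fun i u => bnd [:: i] u isT)
    (fun i j => partial j (partial i g))
    (fun i j u => bnd [:: j; i] u isT) lip1
    (fun i u v => taylor_partials u v (fun j x => dr [:: i] j x isT) (lip2 i)) lip2
    l _ _ _ A (@grid_weight_ge0 R m) (grid_weight_sum1 m0) a _ A_le
    (grid_normal_ibp m0 a_ge0) T F sigma e T_gt0 AA Fst.
  have B2 := gauss_image_discretize GH A glip m0.
  rewrite -[X in `|X|](subrKA
    (\sum_xi weight (@grid_weight R m) xi * g (linear_image (@grid_point R m) A xi))).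
  apply: le_trans (ler_normD _ _) _; apply: le_trans (lerD B1 B2) _.
  by rewrite -/S -/S' /c le_eqVlt; apply/orP; left; apply/eqP; ring.
apply/ler_addgt0Pr => eps eps0.
apply: le_trans (H (Num.truncn (c / eps)).+1 isT) _.
rewrite lerD2l ler_pdivrMr ?ltr0n // -ler_pdivrMl // mulrC.
exact/ltW/truncnS_gt.
Qed.

End GaussianComparison.

Lemma sqrt_rho {R : realType} (n : nat) :
  Num.sqrt (inv_sqrtn R n) = n%:R `^ (- (1 / 4)).
Proof.
rewrite /inv_sqrtn -!powR12_sqrt ?invr_ge0 ?sqrtr_ge0 ?ler0n //.
rewrite -powRN -powRrM; congr (_ `^ _); lra.
Qed.

Lemma inj_increasing d (q : 'I_d -> nat) :
  (forall i j : 'I_d, (i < j)%N -> (q i < q j)%N) -> injective q.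
Proof.
by move=> hq i j ij; have [/hq|/hq|/val_inj] := ltngtP i j; rewrite ?ij ?ltnn.
Qed.

Theorem theorem6p3 (R : realType) (d : nat) (q : 'I_d -> nat)
    (hd : (2 <= d)%N)
    (hq1 : forall i : 'I_d, (1 <= q i)%N)
    (hq : forall i j : 'I_d, (i < j)%N -> (q i < q j)%N) :
  exists C : R, 0 < C /\
    forall (d1 d2 : measure_display)
           (T1 : measurableType d1) (T2 : measurableType d2)
           (P : probability T1 R) (Q : probability T2 R)
           (X : nat -> nat -> {RV P >-> R}) (N : 'I_d -> {RV Q >-> R}),
      iid_rademacher X ->
      centered_gaussian_vector N
        (\matrix_(i < d, j < d) if i == j then (q i)%:R else 0) ->
      forall n : nat, (1 <= n)%N ->
        (d4 P (centered_traces X q n) Q (random_vector N)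
           <= (C * n%:R `^ (- (1 / 4)))%:E)%E.
Proof.
pose D := \max_i q i.
have q_le i : (q i <= D)%N := leq_bigmax i.
(* [Cstein d D] is built from [d] and the largest exponent [D] only. The absolute value and the
   [+ 1] give positivity without examining its sign. *)
exists (2 * d%:R * `|Cstein d D| + 1); split; first by rewrite ltr_wpDl // !mulr_ge0.
move=> d1 d2 T1 T2 P Q X N XH NH n n_gt0; apply: ge_ereal_sup => _ [g gt <-].
have st : stein_bound (@trv R n d q) (fun i => (q i)%:R) (Cstein d D * Num.sqrt (inv_sqrtn R n)).
  move=> f fd f_le fd_le f_lip f_tay i.
  (* The exponent of the opened walk is [(q i).-1]; [q i >= 1] makes its successor [q i] again. *)
  apply: (@mean_trv_phi R n d D q n_gt0 hq1 (inj_increasing hq) q_le f fd f_le fd_le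
    f_lip f_tay (q i).-1); rewrite prednK //; exact: hq1.
rewrite (expectation_centered_traces n XH q (d4_test_lipschitz gt)).
have [y -> Hy] := gaussian_comparison (@cube_gt0 n) st NH gt.
rewrite -EFinB abse_EFin lee_fin; apply: le_trans Hy _.
rewrite sqrt_rho mulrA ler_wpM2r ?powR_ge0 //.
by rewrite -[leLHS]addr0 lerD // ler_wpM2l ?mulr_ge0 // ler_norm.
Qed.
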